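(* Let $\alpha\ge-1$, $n$ a positive integer, $\psi$ analytic on $\mathbb D$ and $\varphi$ an analytic self-map of $\mathbb D$ such that $D_{\psi,\varphi,n}$ is compact on $\mathcal H_\alpha$. Suppose $w\in\mathbb D$ satisfies $\varphi(w)=w$ and $\psi$ has a zero at $w$ of order exactly $n$ (i.e. $\psi^{(j)}(w)=0$ for $0\le j\le n-1$ and $\psi^{(n)}(w)\ne0$). Then, with $N=\big\lfloor \frac{n}{1-|\varphi'(w)|}\big\rfloor$, $$r_\alpha(D_{\psi,\varphi,n})=\binom{N}{n}\,|\psi^{(n)}(w)|\,|\varphi'(w)|^{N-n}.$$
   Context: For $\alpha=-1$, $\mathcal H_\alpha$ denotes the Hardy space $H^2$ on the open unit disk $\mathbb D$; for $\alpha>-1$, $\mathcal H_\alpha$ denotes the weighted Bergman space $A^2_\alpha$ of analytic $f$ on $\mathbb D$ with $\int_{\mathbb D}|f(z)|^2(\alpha+1)(1-|z|^2)^\alpha\,dA(z)<\infty$, $dA$ normalized area measure. $D_{\psi,\varphi,n}f=\psi\cdot(f^{(n)}\circ\varphi)$. $r_\alpha(T)$ is the spectral radius of $T$ on $\mathcal H_\alpha$; $\lfloor\cdot\rfloor$ is the greatest integer function. Convention: $0^0=1$. *)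

(* Defs.v *)
From Stdlib Require Import Reals ClassicalEpsilon.
From Coquelicot Require Import Coquelicot.
Open Scope R_scope.

Definition inD (z : C) : Prop := Cmod z < 1.

Definition analytic_on_D (f : C -> C) : Prop :=
  forall z : C, inD z -> ex_derive (K := C_AbsRing) (V := C_NormedModule) f z.

(* the complex derivative (chosen; unique at points of the open disk where f is differentiable) *)
Definition cderiv (f : C -> C) : C -> C :=
  fun z => epsilon (inhabits (0 : C))
    (fun l : C => is_derive (K := C_AbsRing) (V := C_NormedModule) f z l).

Definition cderiv_n (n : nat) (f : C -> C) : C -> C := Nat.iter n cderiv f.

Definition polar (r t : R) : C := (r * cos t, r * sin t).

Definition circ_mean2 (f : C -> C) (r : R) : R :=
  / (2 * PI) * RInt (fun t => (Cmod (f (polar r t)))^2) 0 (2 * PI).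

Definition hardy_norm2 (f : C -> C) : Rbar :=
  Lub_Rbar (fun v => exists r, 0 <= r < 1 /\ v = circ_mean2 f r).

(* weighted Bergman norm squared:
   int_D |f|^2 (alpha+1)(1-|z|^2)^alpha dA, with dA = dx dy / pi = r dr dt / pi,
   computed (nonnegative integrand) as the sup over the subdisks |z| <= rho < 1 *)
Definition bergman_norm2 (alpha : R) (f : C -> C) : Rbar :=
  Lub_Rbar (fun v => exists rho, 0 <= rho < 1 /\
    v = RInt (fun r => 2 * r * circ_mean2 f r * (alpha + 1) * Rpower (1 - r^2) alpha) 0 rho).

Definition Hnorm2 (alpha : R) (f : C -> C) : Rbar :=
  if Req_EM_T alpha (-1) then hardy_norm2 f else bergman_norm2 alpha f.

Definition inH (alpha : R) (f : C -> C) : Prop :=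
  analytic_on_D f /\ Rbar_lt (Hnorm2 alpha f) p_infty.

Definition Dop (psi phi : C -> C) (n : nat) (f : C -> C) : C -> C :=
  fun z => Cmult (psi z) (cderiv_n n f (phi z)).

Definition compact_on (alpha : R) (T : (C -> C) -> (C -> C)) : Prop :=
  (forall f, inH alpha f -> inH alpha (T f)) /\
  (forall (u : nat -> C -> C) (M : R),
     (forall k, inH alpha (u k)) -> (forall k, Rbar_le (Hnorm2 alpha (u k)) M) ->
     exists (s : nat -> nat) (g : C -> C),
       (forall k, (s k < s (S k))%nat) /\ inH alpha g /\
       forall eps, 0 < eps -> exists K, forall k, (K <= k)%nat ->
         Rbar_le (Hnorm2 alpha (fun z => Cminus (T (u (s k)) z) (g z))) eps).

(* S is a bijection of H_alpha onto itself (elements of H_alpha are identified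
   when they agree on D) *)
Definition bij_on_H (alpha : R) (S : (C -> C) -> (C -> C)) : Prop :=
  (forall f g, inH alpha f -> inH alpha g -> (forall z, inD z -> S f z = S g z) ->
      forall z, inD z -> f z = g z) /\
  (forall g, inH alpha g -> exists f, inH alpha f /\ forall z, inD z -> S f z = g z).

Definition spectrum (alpha : R) (T : (C -> C) -> (C -> C)) (lam : C) : Prop :=
  ~ bij_on_H alpha (fun f z => Cminus (T f z) (Cmult lam (f z))).

Definition spec_radius (alpha : R) (T : (C -> C) -> (C -> C)) : Rbar :=
  Lub_Rbar (fun x => exists lam, spectrum alpha T lam /\ x = Cmod lam).

(* greatest integer function, as a natural number (used on nonnegative arguments) *)
Definition floor_nat (x : R) : nat := Z.to_nat (Int_part x).

(* Main.v *)
Require Import Defs.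
From Stdlib Require Import Reals ZArith Lra Lia Factorial Compare_dec ClassicalEpsilon.
From Coquelicot Require Import Coquelicot.
Open Scope R_scope.

(* Write [T] for the operator. If [f = (z - w)^m h], then [T f = (z - w)^m k] with
   [k(w) = mu_m h(w)], where [mu_m = C(m, n) psi^(n)(w) phi'(w)^(m - n)] for [m >= n] and
   [mu_m = 0] otherwise: in Taylor coefficients at [w], [T] is lower triangular with
   diagonal [mu]. Compactness forces the norm of [T] on the functions vanishing to order [m]
   at [w] to tend to 0, because a limit point of images of unit vectors vanishes to infinite
   order. So for [lam <> 0] the equation [T f - lam f = g] is solvable by iteration among
   functions of high order of vanishing, and, when [lam] avoids [mu], the remaining finitely
   many coefficients are found by triangular elimination; injectivity is read off the
   coefficients. Conversely, if [M] is the least index with [mu_M = lam], then [(z - w)^M] is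
   not in the range of [T - lam]. Hence the spectrum lies in [{0} U {mu_m}] and contains
   every [mu_m]. The same solvability shows that [|mu_m|] is not bounded away from 0, whence
   [|phi'(w)| < 1], and comparing consecutive terms shows that [|mu_m|] is largest at
   [m = N]. *)

(** * Complex differentiation *)

(** [analytic_on_D] asks for nothing but a complex derivative at each point of the disc, so the
    function theory starts from Goursat's argument. It is run on a family of circles contracted
    towards [z], which gives Cauchy's formula at an off-centre point directly; formulas for higher
    derivatives, removal of zeros and derivative estimates all come from Cauchy integrals. The norms
    enter through inequalities between their squares, with (x + y)^2 <= 2 x^2 + 2 y^2 in the role of
    the triangle inequality; the numerical constants in the iteration absorb the resulting factors
    2. The order of vanishing has two descriptions: a factorization, on which the operator acts
    visibly, and vanishing derivatives, which survive norm limits because evaluating a derivative at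
    a point is bounded. The passage from infinite order to 0 is the identity theorem, obtained by
    comparison with powers of a Blaschke factor. *)

Notation Ccont f x := (continuous (U := C_UniformSpace) f x).

(** Balls of the product uniform structure on [C] are squares; the factor sqrt 2 compares them with
    the discs of [Cmod]. *)
Lemma Ccont_spec (X : UniformSpace) (f : X -> C) (x : X) :
  Ccont f x <->
  forall eps, 0 < eps -> locally x (fun y => Cmod (f y - f x)%C < eps).
Proof.
split.
- intros H eps He.
  assert (He' : 0 < eps / sqrt 2) by (apply Rdiv_lt_0_compat; [lra|apply Rlt_sqrt2_0]).
  specialize (H (fun z => Cmod (z - f x)%C < eps)).
  apply H. exists (mkposreal _ He'). intros z Hz.
  pose proof (C_NormedModule_mixin_compat2 (f x) z (mkposreal _ He') Hz) as K. simpl in K.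
  replace (sqrt 2 * (eps / sqrt 2)) with eps in K; [exact K|field].
  apply Rgt_not_eq, Rlt_sqrt2_0.
- intros H P [eps HP].
  specialize (H eps (cond_pos eps)).
  change (locally x (fun y => P (f y))).
  generalize H. apply filter_imp. intros y Hy. apply HP.
  apply C_NormedModule_mixin_compat1. exact Hy.
Qed.

Lemma Ccont_const (X : UniformSpace) (c : C) (x : X) : Ccont (fun _ => c) x.
Proof. apply continuous_const. Qed.

Lemma Ccont_plus (X : UniformSpace) (f g : X -> C) (x : X) :
  Ccont f x -> Ccont g x -> Ccont (fun y => f y + g y)%C x.
Proof. apply (continuous_plus (V := C_R_NormedModule)). Qed.

Lemma Ccont_opp (X : UniformSpace) (f : X -> C) (x : X) :
  Ccont f x -> Ccont (fun y => - f y)%C x.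
Proof. apply (continuous_opp (V := C_R_NormedModule)). Qed.

Lemma Ccont_minus (X : UniformSpace) (f g : X -> C) (x : X) :
  Ccont f x -> Ccont g x -> Ccont (fun y => f y - g y)%C x.
Proof. apply (continuous_minus (V := C_R_NormedModule)). Qed.

Lemma Ccont_fst (X : UniformSpace) (f : X -> C) (x : X) :
  Ccont f x -> continuous (fun y => fst (f y)) x.
Proof.
intros H. apply (continuous_comp f fst); [exact H|].
destruct (f x) as [a b]. apply continuous_fst.
Qed.

Lemma Ccont_snd (X : UniformSpace) (f : X -> C) (x : X) :
  Ccont f x -> continuous (fun y => snd (f y)) x.
Proof.
intros H. apply (continuous_comp f snd); [exact H|].
destruct (f x) as [a b]. apply continuous_snd.
Qed.

Lemma Ccont_pair (X : UniformSpace) (f : X -> C) (x : X) :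
  continuous (fun y => fst (f y)) x -> continuous (fun y => snd (f y)) x -> Ccont f x.
Proof.
intros H1 H2 P [eps HP].
specialize (H1 (ball (fst (f x)) eps) (locally_ball _ _)).
specialize (H2 (ball (snd (f x)) eps) (locally_ball _ _)).
change (locally x (fun y => P (f y))).
change (locally x (fun y => ball (fst (f x)) eps (fst (f y)))) in H1.
change (locally x (fun y => ball (snd (f x)) eps (snd (f y)))) in H2.
generalize (filter_and _ _ H1 H2). apply filter_imp. intros y [A B].
apply HP. split; assumption.
Qed.

Lemma Ccont_mult (X : UniformSpace) (f g : X -> C) (x : X) :
  Ccont f x -> Ccont g x -> Ccont (fun y => f y * g y)%C x.
Proof.
intros Hf Hg.
pose proof (Ccont_fst _ _ _ Hf); pose proof (Ccont_fst _ _ _ Hg).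
pose proof (Ccont_snd _ _ _ Hf); pose proof (Ccont_snd _ _ _ Hg).
apply Ccont_pair; unfold Cmult; simpl.
- apply (continuous_minus (V := R_NormedModule));
  apply (continuous_mult (K := R_AbsRing)); assumption.
- apply (continuous_plus (V := R_NormedModule));
  apply (continuous_mult (K := R_AbsRing)); assumption.
Qed.

Lemma Csqr_norm_neq_0 (z : C) : z <> 0%C -> fst z ^ 2 + snd z ^ 2 <> 0.
Proof.
intros Hz E. apply Hz. destruct z as [a b]; simpl in E.
assert (a = 0) by nra. assert (b = 0) by nra. subst. reflexivity.
Qed.

Lemma continuous_sqr (X : UniformSpace) (f : X -> R) (x : X) :
  continuous f x -> continuous (fun y => f y ^ 2) x.
Proof.
intros H. apply (continuous_mult (K := R_AbsRing) f (fun y => f y * 1)); [exact H|].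
apply (continuous_mult (K := R_AbsRing) f (fun _ => 1)); [exact H|apply continuous_const].
Qed.

Lemma Ccont_inv (X : UniformSpace) (f : X -> C) (x : X) :
  Ccont f x -> f x <> 0%C -> Ccont (fun y => / f y)%C x.
Proof.
intros Hf Hn.
pose proof (Ccont_fst _ _ _ Hf) as H1. pose proof (Ccont_snd _ _ _ Hf) as H2.
assert (Hd : continuous (fun y => fst (f y) ^ 2 + snd (f y) ^ 2) x).
{ apply (continuous_plus (V := R_NormedModule) (fun y => fst (f y) ^ 2) (fun y => snd (f y) ^ 2));
  apply continuous_sqr; assumption. }
assert (Hi : continuous (fun y => / (fst (f y) ^ 2 + snd (f y) ^ 2)) x).
{ apply (continuous_comp (fun y => fst (f y) ^ 2 + snd (f y) ^ 2) Rinv); [exact Hd|].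
  apply continuity_pt_filterlim. apply continuity_pt_inv.
  apply continuity_pt_id. apply Csqr_norm_neq_0; assumption. }
apply Ccont_pair; unfold Cinv; simpl.
- apply (continuous_mult (K := R_AbsRing)); assumption.
- apply (continuous_mult (K := R_AbsRing)); [|assumption].
  apply (continuous_opp (V := R_NormedModule)). assumption.
Qed.

Lemma Cmod_minus_ge (a b : C) : Cmod a - Cmod b <= Cmod (a - b)%C.
Proof.
pose proof (Cmod_triangle (a - b)%C b) as K.
replace (a - b + b)%C with a in K by ring. lra.
Qed.

Lemma Ccont_Cmod (X : UniformSpace) (f : X -> C) (x : X) :
  Ccont f x -> continuous (fun y => Cmod (f y)) x.
Proof.
intros H. rewrite Ccont_spec in H. intros P [eps HP].
change (locally x (fun y => P (Cmod (f y)))).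
generalize (H eps (cond_pos eps)). apply filter_imp. intros y Hy.
apply HP. change (Rabs (Cmod (f y) - Cmod (f x)) < eps).
apply Rle_lt_trans with (2 := Hy).
apply Rabs_le. pose proof (Cmod_minus_ge (f y) (f x)) as K1.
pose proof (Cmod_minus_ge (f x) (f y)) as K2.
replace (f x - f y)%C with (- (f y - f x))%C in K2 by ring. rewrite Cmod_opp in K2.
split; lra.
Qed.

Lemma Ccont_comp (X : UniformSpace) (f : X -> C) (g : C -> C) (x : X) :
  Ccont f x -> Ccont g (f x) -> Ccont (fun y => g (f y)) x.
Proof. apply continuous_comp. Qed.

Lemma locally_Cmod (z : C) (P : C -> Prop) :
  locally (T := C_UniformSpace) z P <->
  exists d, 0 < d /\ forall y, Cmod (y - z)%C < d -> P y.
Proof.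
split.
- intros [e He]. exists e. split; [apply cond_pos|]. intros y Hy.
  apply He. apply C_NormedModule_mixin_compat1. exact Hy.
- intros [d [Hd H]].
  generalize (proj1 (Ccont_spec _ (fun y : C_UniformSpace => y) z) (continuous_id _) d Hd).
  apply filter_imp. exact H.
Qed.

(* Caratheodory's formulation turns the differentiation rules into algebraic identities
   between the slope functions [q]. *)
Definition cdiff (f : C -> C) (z l : C) : Prop :=
  exists q : C -> C, Ccont q z /\ q z = l /\ forall y, (f y - f z = q y * (y - z))%C.

Definition is_cder (f : C -> C) (z l : C) : Prop :=
  is_derive (K := C_AbsRing) (V := C_NormedModule) f z l.

Lemma is_cder_spec (f : C -> C) (z l : C) :
  is_cder f z l <->
  forall eps, 0 < eps -> exists d, 0 < d /\ forall y, Cmod (y - z) < d ->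
    Cmod (f y - f z - l * (y - z))%C <= eps * Cmod (y - z)%C.
Proof.
assert (E : forall a b c : C, minus (minus (a : C_NormedModule) b) c = (a - b - c)%C)
  by reflexivity.
split.
- intros [_ H] eps He.
  specialize (H z (fun P HP => HP) (mkposreal eps He)). simpl in H.
  destruct H as [d Hd]. exists d. split; [apply cond_pos|].
  intros y Hy. specialize (Hd y Hy).
  rewrite (Cmult_comm l). exact Hd.
- intros H. split. apply is_linear_scal_l.
  intros x Hx.
  assert (Ex : z = x) by (apply (is_filter_lim_locally_unique (K := C_AbsRing)
     (V := AbsRing_NormedModule C_AbsRing)); exact Hx).
  subst x. intros eps. destruct (H eps (cond_pos eps)) as [d [Hd Hb]].
  exists (mkposreal d Hd). intros y Hy. specialize (Hb y Hy).
  rewrite (Cmult_comm l) in Hb. exact Hb.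
Qed.

Lemma Cminus_eq_0 (a b : C) : (a - b = 0)%C -> a = b.
Proof. intros H. replace a with ((a - b) + b)%C by ring. rewrite H. ring. Qed.

Lemma Cmod_minus_pos (a b : C) : a <> b -> 0 < Cmod (a - b)%C.
Proof. intros H. apply Cmod_gt_0. intros E. apply H, Cminus_eq_0, E. Qed.

(** The witness [q] for [cdiff]: the difference quotient, completed by [l] at the centre so that
    [slope_mult] has no exceptional point. With [l] the derivative it later serves as the cofactor
    of a zero. *)
Definition slope (f : C -> C) (z l y : C) : C :=
  if excluded_middle_informative (y = z) then l else ((f y - f z) / (y - z))%C.

Lemma slope_eq (f : C -> C) (z l : C) : slope f z l z = l.
Proof.
unfold slope. destruct (excluded_middle_informative (z = z)) as [_|n]; [reflexivity|now elim n].
Qed.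

Lemma slope_mult (f : C -> C) (z l y : C) : (f y - f z = slope f z l y * (y - z))%C.
Proof.
unfold slope. destruct (excluded_middle_informative (y = z)) as [->|n]; [ring|].
field. intros E; apply n, Cminus_eq_0, E.
Qed.

Lemma slope_close (f : C -> C) (z l y : C) (eps : R) :
  0 <= eps -> Cmod (f y - f z - l * (y - z))%C <= eps * Cmod (y - z)%C ->
  Cmod (slope f z l y - l)%C <= eps.
Proof.
intros He Hb. destruct (excluded_middle_informative (y = z)) as [->|n].
- rewrite slope_eq. replace (l - l)%C with (RtoC 0) by ring. rewrite Cmod_0. exact He.
- rewrite (slope_mult f z l) in Hb.
  replace (slope f z l y * (y - z) - l * (y - z))%C
    with ((slope f z l y - l) * (y - z))%C in Hb by ring.
  rewrite Cmod_mult in Hb. apply Rmult_le_reg_r with (2 := Hb), Cmod_minus_pos, n.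
Qed.

Lemma is_cder_cdiff (f : C -> C) (z l : C) : is_cder f z l <-> cdiff f z l.
Proof.
rewrite is_cder_spec. split.
- intros H. exists (slope f z l). split; [|split; [apply slope_eq|apply slope_mult]].
  apply Ccont_spec. intros eps He. rewrite slope_eq.
  assert (He2 : 0 < eps / 2) by (apply Rdiv_lt_0_compat; [exact He|apply Rlt_0_2]).
  destruct (H (eps / 2) He2) as [d [Hd Hb]].
  apply locally_Cmod. exists d. split; [exact Hd|]. intros y Hy.
  apply Rle_lt_trans with (eps / 2).
  + apply slope_close; [apply Rlt_le, He2|exact (Hb y Hy)].
  + clear - He. lra.
- intros [q [Hq [Hl Hy]]] eps He.
  rewrite Ccont_spec in Hq. specialize (Hq eps He).
  apply locally_Cmod in Hq. destruct Hq as [d [Hd Hb]].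
  exists d. split; [exact Hd|]. intros y Hyd. specialize (Hb y Hyd).
  rewrite Hy. subst l. replace (q y * (y - z) - q z * (y - z))%C
    with ((q y - q z) * (y - z))%C by ring.
  rewrite Cmod_mult. apply Rmult_le_compat_r; [apply Cmod_ge_0|lra].
Qed.

Lemma is_cder_Ccont (f : C -> C) (z l : C) : is_cder f z l -> Ccont f z.
Proof.
rewrite is_cder_cdiff. intros [q [Hq [_ Hy]]].
assert (E : forall y : C, (f z + q y * (y - z))%C = f y) by (intros y; rewrite <- Hy; ring).
apply (continuous_ext (fun y : C_UniformSpace => f z + q y * (y - z))%C); [exact E|].
apply Ccont_plus; [apply Ccont_const|apply Ccont_mult; [exact Hq|]].
apply Ccont_minus; [apply continuous_id|apply Ccont_const].
Qed.

Lemma is_cder_unique (f : C -> C) (z l l' : C) : is_cder f z l -> is_cder f z l' -> l = l'.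
Proof.
intros H H'. rewrite <- (is_C_derive_unique _ _ _ H). apply is_C_derive_unique, H'.
Qed.

(** Uniqueness of the derivative makes the choice by [epsilon] immaterial. *)
Lemma cderiv_eq (f : C -> C) (z l : C) : is_cder f z l -> cderiv f z = l.
Proof.
intros H. apply (is_cder_unique f z); [|exact H].
apply (epsilon_spec (inhabits (0 : C)) (fun l => is_cder f z l)). exists l; exact H.
Qed.

Lemma is_cder_cderiv (f : C -> C) (z : C) : analytic_on_D f -> inD z -> is_cder f z (cderiv f z).
Proof. intros Hf Hz. destruct (Hf z Hz) as [l Hl]. rewrite (cderiv_eq _ _ _ Hl). exact Hl. Qed.

Lemma is_cder_const (c z : C) : is_cder (fun _ => c) z 0%C.
Proof.
apply is_cder_cdiff. exists (fun _ => 0%C). split; [apply Ccont_const|split; [reflexivity|]].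
intros; ring.
Qed.

Lemma is_cder_id (z : C) : is_cder (fun y => y) z 1%C.
Proof.
apply is_cder_cdiff. exists (fun _ => 1%C). split; [apply Ccont_const|split; [reflexivity|]].
intros; ring.
Qed.

Lemma is_cder_plus (f g : C -> C) (z a b : C) :
  is_cder f z a -> is_cder g z b -> is_cder (fun y => f y + g y)%C z (a + b)%C.
Proof.
rewrite !is_cder_cdiff. intros [p [Hp [<- Ep]]] [q [Hq [<- Eq]]].
exists (fun y => p y + q y)%C. split; [apply Ccont_plus; assumption|split; [reflexivity|]].
intros y. replace (f y + g y - (f z + g z))%C with ((f y - f z) + (g y - g z))%C by ring.
rewrite Ep, Eq. ring.
Qed.

Lemma is_cder_mult (f g : C -> C) (z a b : C) :
  is_cder f z a -> is_cder g z b ->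
  is_cder (fun y => f y * g y)%C z (a * g z + f z * b)%C.
Proof.
intros Hf Hg. pose proof (is_cder_Ccont _ _ _ Hg) as Cg. revert Hf Hg.
rewrite !is_cder_cdiff. intros [p [Hp [<- Ep]]] [q [Hq [<- Eq]]].
exists (fun y => p y * g y + f z * q y)%C.
split; [|split; [reflexivity|]].
{ apply Ccont_plus; apply Ccont_mult; auto. apply Ccont_const. }
intros y. replace (f y * g y - f z * g z)%C with ((f y - f z) * g y + f z * (g y - g z))%C by ring.
rewrite Ep, Eq. ring.
Qed.

Lemma is_cder_comp (f g : C -> C) (z a b : C) :
  is_cder f (g z) a -> is_cder g z b -> is_cder (fun y => f (g y)) z (a * b)%C.
Proof.
intros Hf Hg. pose proof (is_cder_Ccont _ _ _ Hg) as Cg. revert Hf Hg.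
rewrite !is_cder_cdiff. intros [p [Hp [<- Ep]]] [q [Hq [<- Eq]]].
exists (fun y => p (g y) * q y)%C. split; [|split; [reflexivity|]].
{ apply Ccont_mult; [|exact Hq]. apply Ccont_comp; assumption. }
intros y. rewrite Ep, Eq. ring.
Qed.

Lemma is_cder_scal (c : C) (f : C -> C) (z a : C) :
  is_cder f z a -> is_cder (fun y => c * f y)%C z (c * a)%C.
Proof.
intros H. replace (c * a)%C with (0 * f z + c * a)%C by ring.
apply (is_cder_mult (fun _ => c)); [apply is_cder_const|exact H].
Qed.

Lemma inD_nbhd (z : C) : inD z -> exists d, 0 < d /\ forall y, Cmod (y - z)%C < d -> inD y.
Proof.
unfold inD. intros Hz. exists (1 - Cmod z). split; [lra|]. intros y Hy.
replace y with ((y - z) + z)%C by ring.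
apply Rle_lt_trans with (1 := Cmod_triangle _ _). lra.
Qed.

Lemma is_cder_ext_loc (f g : C -> C) (z l : C) (r : R) :
  0 < r -> (forall y, Cmod (y - z)%C < r -> f y = g y) -> is_cder f z l -> is_cder g z l.
Proof.
rewrite !is_cder_spec. intros Hr E H eps He.
destruct (H eps He) as [d' [Hd Hb]]. exists (Rmin d' r). split; [now apply Rmin_pos|].
intros y Hy. rewrite <- !E.
- apply Hb. apply Rlt_le_trans with (1 := Hy), Rmin_l.
- replace (z - z)%C with (RtoC 0) by ring. rewrite Cmod_0. exact Hr.
- apply Rlt_le_trans with (1 := Hy), Rmin_r.
Qed.

Lemma is_cder_ext_D (f g : C -> C) (z l : C) :
  inD z -> (forall y, inD y -> f y = g y) -> is_cder f z l -> is_cder g z l.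
Proof.
intros Hz E H. destruct (inD_nbhd z Hz) as [d [Hd Hb]].
apply (is_cder_ext_loc f g z l d Hd); [|exact H]. intros y Hy. apply E, Hb, Hy.
Qed.

Lemma analytic_ext (f g : C -> C) :
  (forall y, inD y -> f y = g y) -> analytic_on_D f -> analytic_on_D g.
Proof.
intros E H z Hz. destruct (H z Hz) as [l Hl]. exists l.
exact (is_cder_ext_D f g z l Hz E Hl).
Qed.

Lemma analytic_const (c : C) : analytic_on_D (fun _ => c).
Proof. intros z _. exists (RtoC 0). apply is_cder_const. Qed.

Lemma analytic_id : analytic_on_D (fun z => z).
Proof. intros z _. exists (RtoC 1). apply is_cder_id. Qed.

Lemma analytic_plus (f g : C -> C) :
  analytic_on_D f -> analytic_on_D g -> analytic_on_D (fun z => f z + g z)%C.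
Proof.
intros Hf Hg z Hz. destruct (Hf z Hz) as [a Ha]. destruct (Hg z Hz) as [b Hb].
eexists. apply (is_cder_plus _ _ _ _ _ Ha Hb).
Qed.

Lemma analytic_mult (f g : C -> C) :
  analytic_on_D f -> analytic_on_D g -> analytic_on_D (fun z => f z * g z)%C.
Proof.
intros Hf Hg z Hz. destruct (Hf z Hz) as [a Ha]. destruct (Hg z Hz) as [b Hb].
eexists. apply (is_cder_mult _ _ _ _ _ Ha Hb).
Qed.

Lemma analytic_comp (f g : C -> C) :
  analytic_on_D f -> analytic_on_D g -> (forall z, inD z -> inD (g z)) ->
  analytic_on_D (fun z => f (g z)).
Proof.
intros Hf Hg Hm z Hz. destruct (Hf _ (Hm z Hz)) as [a Ha]. destruct (Hg z Hz) as [b Hb].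
eexists. apply (is_cder_comp _ _ _ _ _ Ha Hb).
Qed.

Lemma analytic_minus (f g : C -> C) :
  analytic_on_D f -> analytic_on_D g -> analytic_on_D (fun z => f z - g z)%C.
Proof.
intros Hf Hg. apply (analytic_ext (fun z => f z + (-1) * g z)%C).
{ intros; ring. }
apply analytic_plus; [exact Hf|]. apply analytic_mult; [apply analytic_const|exact Hg].
Qed.

Lemma analytic_scal (c : C) (f : C -> C) :
  analytic_on_D f -> analytic_on_D (fun z => c * f z)%C.
Proof. intros Hf. apply analytic_mult; [apply analytic_const|exact Hf]. Qed.

Lemma analytic_pow (f : C -> C) (k : nat) :
  analytic_on_D f -> analytic_on_D (fun z => f z ^ k)%C.
Proof.
intros Hf. induction k as [|k IH].
- apply (analytic_const 1%C).
- apply (analytic_ext (fun z => f z * f z ^ k)%C); [reflexivity|].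
  apply analytic_mult; assumption.
Qed.

Lemma analytic_Ccont (f : C -> C) (z : C) : analytic_on_D f -> inD z -> Ccont f z.
Proof. intros Hf Hz. destruct (Hf z Hz) as [l Hl]. exact (is_cder_Ccont _ _ _ Hl). Qed.

(** * Integrals of complex-valued functions and Goursat's subdivision *)

Notation CInt := (RInt (V := C_R_CompleteNormedModule)).
Notation ex_CInt := (ex_RInt (V := C_R_CompleteNormedModule)).

Lemma norm_C_R (z : C) : norm (z : C_R_NormedModule) = Cmod z.
Proof.
destruct z as [x y]. unfold norm; simpl. unfold prod_norm, Cmod; simpl.
unfold norm; simpl. unfold abs; simpl. f_equal.
rewrite !Rmult_1_r, <- !Rabs_mult, !Rabs_pos_eq; nra.
Qed.

Lemma ex_CInt_cont (f : R -> C) (a b : R) :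
  a <= b -> (forall t, a <= t <= b -> Ccont f t) -> ex_CInt f a b.
Proof.
intros Hab H. apply (ex_RInt_continuous (V := C_R_CompleteNormedModule)).
rewrite Rmin_left, Rmax_right by assumption. exact H.
Qed.

Lemma CInt_plus (f g : R -> C) (a b : R) :
  ex_CInt f a b -> ex_CInt g a b ->
  CInt (fun t => f t + g t)%C a b = (CInt f a b + CInt g a b)%C.
Proof. apply (RInt_plus (V := C_R_CompleteNormedModule)). Qed.

Lemma CInt_minus (f g : R -> C) (a b : R) :
  ex_CInt f a b -> ex_CInt g a b ->
  CInt (fun t => f t - g t)%C a b = (CInt f a b - CInt g a b)%C.
Proof. apply (RInt_minus (V := C_R_CompleteNormedModule)). Qed.

Lemma CInt_Chasles (f : R -> C) (a b c : R) :
  ex_CInt f a b -> ex_CInt f b c -> (CInt f a b + CInt f b c = CInt f a c)%C.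
Proof. apply (RInt_Chasles (V := C_R_CompleteNormedModule)). Qed.

Lemma CInt_ext (f g : R -> C) (a b : R) :
  a <= b -> (forall t, a <= t <= b -> f t = g t) -> CInt f a b = CInt g a b.
Proof.
intros Hab H. apply (RInt_ext (V := C_R_CompleteNormedModule)). intros t Ht.
rewrite Rmin_left, Rmax_right in Ht by assumption. apply H. lra.
Qed.

Lemma is_RInt_pair (f : R -> C) (a b u v : R) :
  is_RInt (fun t => fst (f t)) a b u -> is_RInt (fun t => snd (f t)) a b v ->
  is_RInt (V := C_R_NormedModule) f a b (u, v).
Proof.
intros H1 H2.
apply (is_RInt_fct_extend_pair (U := R_NormedModule) (V := R_NormedModule) f a b u v); assumption.
Qed.

(** [CInt] integrates in [C] as a real normed space, so complex scalars are handled through real and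
    imaginary parts. *)
Lemma CInt_scal (k : C) (f : R -> C) (a b : R) :
  ex_CInt f a b -> CInt (fun t => k * f t)%C a b = (k * CInt f a b)%C.
Proof.
intros Hf. apply (is_RInt_unique (V := C_R_CompleteNormedModule)).
pose proof (RInt_correct (V := C_R_CompleteNormedModule) f a b Hf) as H.
destruct (CInt f a b) as [u v] eqn:E.
pose proof (is_RInt_fct_extend_fst (U := R_NormedModule) (V := R_NormedModule) f a b _ H) as H1.
pose proof (is_RInt_fct_extend_snd (U := R_NormedModule) (V := R_NormedModule) f a b _ H) as H2.
simpl in H1, H2. destruct k as [k1 k2].
apply is_RInt_pair; simpl.
- apply (is_RInt_minus (V := R_NormedModule));
  apply (is_RInt_scal (V := R_NormedModule)); assumption.
- apply (is_RInt_plus (V := R_NormedModule));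
  apply (is_RInt_scal (V := R_NormedModule)); assumption.
Qed.

Lemma Cmod_CInt_le (f : R -> C) (g : R -> R) (a b : R) :
  a <= b -> ex_CInt f a b -> ex_RInt g a b ->
  (forall t, a <= t <= b -> Cmod (f t) <= g t) ->
  Cmod (CInt f a b) <= RInt g a b.
Proof.
intros Hab Hf Hg H. rewrite <- norm_C_R.
apply (norm_RInt_le (V := C_R_NormedModule) f g a b); auto.
- intros t Ht. rewrite norm_C_R. auto.
- apply (RInt_correct (V := C_R_CompleteNormedModule)), Hf.
- apply (RInt_correct (V := R_CompleteNormedModule)), Hg.
Qed.

Lemma Cmod_CInt_le_const (f : R -> C) (a b M : R) :
  a <= b -> ex_CInt f a b -> (forall t, a <= t <= b -> Cmod (f t) <= M) ->
  Cmod (CInt f a b) <= (b - a) * M.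
Proof.
intros Hab Hf H.
replace ((b - a) * M) with (RInt (fun _ => M) a b)
  by (rewrite RInt_const; reflexivity).
apply Cmod_CInt_le; auto. apply ex_RInt_const.
Qed.

Lemma CInt_const (c : C) (a b : R) : CInt (fun _ => c) a b = (RtoC (b - a) * c)%C.
Proof.
rewrite (RInt_const (V := C_R_CompleteNormedModule)).
destruct c as [x y]. unfold scal; simpl. unfold prod_scal, Cmult, scal; simpl.
unfold mult; simpl. f_equal; ring.
Qed.

Lemma Ccont_polar (r t : R) : Ccont (polar r) t.
Proof.
apply Ccont_pair; unfold polar; simpl;
apply (ex_derive_continuous (K := R_AbsRing) (V := R_NormedModule)); auto_derive; exact I.
Qed.

Lemma Cmod_polar (r t : R) : 0 <= r -> Cmod (polar r t) = r.
Proof.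
intros Hr. unfold polar, Cmod; simpl.
replace (r * cos t * (r * cos t * 1) + r * sin t * (r * sin t * 1))
  with (r * r * (Rsqr (sin t) + Rsqr (cos t))) by (unfold Rsqr; ring).
rewrite sin2_cos2, Rmult_1_r. apply sqrt_square, Hr.
Qed.

Lemma polar_periodic (r : R) : polar r (2 * PI) = polar r 0.
Proof. unfold polar. now rewrite cos_2PI, sin_2PI, cos_0, sin_0. Qed.

Lemma CInt_Ci_polar (r a b : R) :
  CInt (fun t => Ci * polar r t)%C a b = (polar r b - polar r a)%C.
Proof.
apply (is_RInt_unique (V := C_R_CompleteNormedModule)).
unfold polar, Cminus, Cplus, Copp; simpl. apply is_RInt_pair; simpl.
- apply (is_RInt_ext (fun t => - (r * sin t))); [intros; simpl; ring|].
  apply (is_RInt_derive (V := R_CompleteNormedModule) (fun t => r * cos t)).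
  + intros x _. auto_derive; [exact I|ring].
  + intros x _. apply (ex_derive_continuous (K := R_AbsRing) (V := R_NormedModule)); auto_derive; exact I.
- apply (is_RInt_ext (fun t => (r * cos t))); [intros; simpl; ring|].
  apply (is_RInt_derive (V := R_CompleteNormedModule) (fun t => r * sin t)).
  + intros x _. auto_derive; [exact I|ring].
  + intros x _. apply (ex_derive_continuous (K := R_AbsRing) (V := R_NormedModule)); auto_derive; exact I.
Qed.

Lemma CInt_exp (a b : R) :
  CInt (fun t => RtoC (exp t)) a b = RtoC (exp b - exp a).
Proof.
apply (is_RInt_unique (V := C_R_CompleteNormedModule)).
apply is_RInt_pair; simpl.
- apply (is_RInt_derive (V := R_CompleteNormedModule) exp exp).
  + intros x _. auto_derive; [exact I|ring].
  + intros x _. apply (ex_derive_continuous (K := R_AbsRing) (V := R_NormedModule)); auto_derive; exact I.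
- pose proof (is_RInt_const (V := R_NormedModule) a b 0) as K.
  replace (scal (b - a) (0 : R_NormedModule)) with 0 in K
    by (unfold scal; simpl; unfold mult; simpl; ring).
  exact K.
Qed.

(** A chord is the integral of the velocity [Ci * polar r t], whose modulus is [r]. *)
Lemma Cmod_polar_lipschitz (r s t : R) :
  0 <= r -> Cmod (polar r t - polar r s)%C <= r * Rabs (t - s).
Proof.
intros Hr.
assert (W : forall s t, s <= t -> Cmod (polar r t - polar r s)%C <= r * (t - s)).
{ clear s t. intros s t Hst. rewrite <- CInt_Ci_polar, Rmult_comm.
  assert (Hc : forall u, Ccont (fun t => Ci * polar r t)%C u)
    by (intros u; apply Ccont_mult; [apply Ccont_const|apply Ccont_polar]).
  apply Cmod_CInt_le_const; [exact Hst|apply ex_CInt_cont; auto|].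
  intros u _. rewrite Cmod_mult, Cmod_Ci, Cmod_polar by exact Hr. lra. }
destruct (Rle_dec s t) as [H|H].
- rewrite Rabs_pos_eq by lra. apply W, H.
- rewrite Rabs_minus_sym, Rabs_pos_eq by lra.
  replace (polar r t - polar r s)%C with (- (polar r s - polar r t))%C by ring.
  rewrite Cmod_opp. apply W. lra.
Qed.

Lemma exp_lipschitz_nonpos (x y : R) :
  x <= 0 -> y <= 0 -> Rabs (exp x - exp y) <= Rabs (x - y).
Proof.
assert (W : forall x y, x <= 0 -> y <= x -> exp x - exp y <= x - y).
{ clear x y. intros x y Hx Hy.
  replace (exp y) with (exp x * exp (y - x)) by (rewrite <- exp_plus; f_equal; ring).
  pose proof (exp_ineq1_le (y - x)). pose proof (exp_pos x).
  assert (exp x <= 1) by (rewrite <- exp_0; destruct Hx as [Hx| ->];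
    [left; apply exp_increasing, Hx|right; reflexivity]).
  nra. }
assert (M : forall x y, y <= x -> exp y <= exp x).
{ intros u v [H| ->]; [left; apply exp_increasing, H|right; reflexivity]. }
intros Hx Hy. destruct (Rle_dec y x) as [H|H].
- rewrite !Rabs_pos_eq; [apply W; lra|lra|specialize (M x y H); lra].
- rewrite (Rabs_minus_sym x), (Rabs_minus_sym (exp x)), !Rabs_pos_eq;
  [apply W; lra|lra|specialize (M y x ltac:(lra)); lra].
Qed.

Section Quadrisection.

Variables (F : R -> R -> R -> R -> C) (a b c d : R).
Hypothesis (Hab : a <= b) (Hcd : c <= d).
Hypothesis split_x : forall x1 x x2 t1 t2,
  a <= x1 -> x1 <= x -> x <= x2 -> x2 <= b -> c <= t1 -> t1 <= t2 -> t2 <= d ->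
  F x1 x2 t1 t2 = (F x1 x t1 t2 + F x x2 t1 t2)%C.
Hypothesis split_t : forall x1 x2 t1 t t2,
  a <= x1 -> x1 <= x2 -> x2 <= b -> c <= t1 -> t1 <= t -> t <= t2 -> t2 <= d ->
  F x1 x2 t1 t2 = (F x1 x2 t1 t + F x1 x2 t t2)%C.

Record rect := mkrect { rx1 : R; rx2 : R; rt1 : R; rt2 : R }.

Let Fr (p : rect) := F (rx1 p) (rx2 p) (rt1 p) (rt2 p).

Let valid (p : rect) :=
  a <= rx1 p /\ rx1 p <= rx2 p /\ rx2 p <= b /\ c <= rt1 p /\ rt1 p <= rt2 p /\ rt2 p <= d.

Let sub (p q : rect) :=
  (rx1 p <= rx1 q /\ rx2 q <= rx2 p /\ rt1 p <= rt1 q /\ rt2 q <= rt2 p) /\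
  (rx2 q - rx1 q = (rx2 p - rx1 p) / 2 /\ rt2 q - rt1 q = (rt2 p - rt1 p) / 2) /\
  Cmod (Fr p) <= 4 * Cmod (Fr q).

(** If all four quarters carried less than a fourth of the modulus, the triangle inequality applied
    to their sum would fail. *)
Let quarter (p : rect) : valid p -> exists q, valid q /\ sub p q.
Proof.
destruct p as [x1 x2 t1 t2]. unfold valid, sub, Fr; simpl. intros Hv.
set (x := (x1 + x2) / 2). set (t := (t1 + t2) / 2).
assert (Hx : x1 <= x <= x2) by (unfold x; lra).
assert (Ht : t1 <= t <= t2) by (unfold t; lra).
assert (E : F x1 x2 t1 t2 = (F x1 x t1 t + F x1 x t t2 + (F x x2 t1 t + F x x2 t t2))%C).
{ rewrite (split_x x1 x x2 t1 t2), (split_t x1 x t1 t t2), (split_t x x2 t1 t t2);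
  [reflexivity|lra..]. }
destruct (Rle_dec (Cmod (F x1 x2 t1 t2)) (4 * Cmod (F x1 x t1 t))) as [H1|H1].
{ exists (mkrect x1 x t1 t); simpl. unfold x, t in *; repeat split; lra. }
destruct (Rle_dec (Cmod (F x1 x2 t1 t2)) (4 * Cmod (F x1 x t t2))) as [H2|H2].
{ exists (mkrect x1 x t t2); simpl. unfold x, t in *; repeat split; lra. }
destruct (Rle_dec (Cmod (F x1 x2 t1 t2)) (4 * Cmod (F x x2 t1 t))) as [H3|H3].
{ exists (mkrect x x2 t1 t); simpl. unfold x, t in *; repeat split; lra. }
destruct (Rle_dec (Cmod (F x1 x2 t1 t2)) (4 * Cmod (F x x2 t t2))) as [H4|H4].
{ exists (mkrect x x2 t t2); simpl. unfold x, t in *; repeat split; lra. }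
exfalso.
pose proof (Cmod_triangle (F x1 x t1 t + F x1 x t t2)%C (F x x2 t1 t + F x x2 t t2)%C) as T1.
pose proof (Cmod_triangle (F x1 x t1 t) (F x1 x t t2)) as T2.
pose proof (Cmod_triangle (F x x2 t1 t) (F x x2 t t2)) as T3.
rewrite <- E in T1. lra.
Qed.

Let next (p : rect) : rect := epsilon (inhabits p) (fun q => valid q /\ sub p q).
Let rects (n : nat) : rect := Nat.iter n next (mkrect a b c d).

Let rects_valid (n : nat) : valid (rects n).
Proof.
induction n as [|n IH].
- unfold valid; simpl. repeat split; lra.
- apply (epsilon_spec (inhabits (rects n)) _ (quarter _ IH)).
Qed.

Let rects_sub (n : nat) : sub (rects n) (rects (S n)).
Proof. apply (epsilon_spec (inhabits (rects n)) _ (quarter _ (rects_valid n))). Qed.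

Let rects_size (n : nat) :
  rx2 (rects n) - rx1 (rects n) = (b - a) * (/ 2) ^ n /\
  rt2 (rects n) - rt1 (rects n) = (d - c) * (/ 2) ^ n.
Proof.
induction n as [|n [IH1 IH2]]; [simpl; lra|].
destruct (rects_sub n) as [_ [[E1 E2] _]]. rewrite E1, E2, IH1, IH2. simpl. lra.
Qed.

Let rects_F (n : nat) : Cmod (F a b c d) * (/ 4) ^ n <= Cmod (Fr (rects n)).
Proof.
induction n as [|n IH].
- unfold Fr; simpl. lra.
- destruct (rects_sub n) as [_ [_ E]]. simpl ((/ 4) ^ S n). lra.
Qed.

Let nested (n k : nat) :
  rx1 (rects n) <= rx1 (rects (k + n)) /\ rx2 (rects (k + n)) <= rx2 (rects n) /\
  rt1 (rects n) <= rt1 (rects (k + n)) /\ rt2 (rects (k + n)) <= rt2 (rects n).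
Proof.
induction k as [|k IH]; [simpl; lra|].
destruct (rects_sub (k + n)) as [E _]. simpl (S k + n)%nat. lra.
Qed.

Let cross (m n : nat) :
  rx1 (rects m) <= rx2 (rects n) /\ rt1 (rects m) <= rt2 (rects n).
Proof.
destruct (Nat.le_ge_cases m n) as [H|H].
- pose proof (nested m (n - m)) as K. pose proof (rects_valid n) as V. unfold valid in V.
  replace (n - m + m)%nat with n in K by lia. lra.
- pose proof (nested n (m - n)) as K. pose proof (rects_valid m) as V. unfold valid in V.
  replace (m - n + n)%nat with m in K by lia. lra.
Qed.

(** The supremum of the left ends lies in every interval. *)
Lemma nested_point (u v : nat -> R) :
  (forall m n, u m <= v n) -> exists x, forall n, u n <= x <= v n.
Proof.
intros H.
destruct (completeness (fun y => exists n, y = u n)) as [x [Hx1 Hx2]].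
- exists (v 0%nat). intros y [n ->]. apply H.
- exists (u 0%nat). exists 0%nat. reflexivity.
- exists x. intros n. split; [apply Hx1; now exists n|].
  apply Hx2. intros y [m ->]. apply H.
Qed.

Lemma pow_half_small (M eps : R) : 0 < eps -> exists n : nat, M * (/ 2) ^ n < eps.
Proof.
intros He.
(* Adding 1 keeps the divisor positive when [M = 0]. *)
destruct (pow_lt_1_zero (/ 2) ltac:(rewrite Rabs_pos_eq; lra) (eps / (Rabs M + 1))) as [n Hn].
{ apply Rdiv_lt_0_compat; [exact He|]. pose proof (Rabs_pos M). lra. }
exists n. specialize (Hn n (Nat.le_refl n)).
pose proof (pow_lt (/ 2) n ltac:(lra)). rewrite Rabs_pos_eq in Hn by lra.
pose proof (Rabs_pos M). pose proof (Rle_abs M).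
apply (Rmult_lt_compat_l (Rabs M + 1)) in Hn; [|lra].
replace ((Rabs M + 1) * (eps / (Rabs M + 1))) with eps in Hn by (field; lra). nra.
Qed.

(* Goursat's argument: a rectangle function that is additive under subdivision and
   o(perimeter^2) at every point vanishes. *)
Lemma quadrisection :
  (forall x0 t0, a <= x0 <= b -> c <= t0 <= d -> forall eps, 0 < eps ->
    exists del, 0 < del /\ forall x1 x2 t1 t2,
      a <= x1 -> x1 <= x0 -> x0 <= x2 -> x2 <= b ->
      c <= t1 -> t1 <= t0 -> t0 <= t2 -> t2 <= d ->
      x2 - x1 + (t2 - t1) < del ->
      Cmod (F x1 x2 t1 t2) <= eps * (x2 - x1 + (t2 - t1)) ^ 2) ->
  F a b c d = RtoC 0.
Proof.
intros Hloc.
destruct (nested_point (fun n => rx1 (rects n)) (fun n => rx2 (rects n))) as [x0 Hx0].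
{ intros m n. apply cross. }
destruct (nested_point (fun n => rt1 (rects n)) (fun n => rt2 (rects n))) as [t0 Ht0].
{ intros m n. apply cross. }
apply Cmod_eq_0. apply Rle_antisym; [|apply Cmod_ge_0].
apply Rnot_lt_le. intros Hpos.
set (s := b - a + (d - c)).
assert (Hs : 0 <= s) by (unfold s; lra).
(* The local bound will give [Cmod (F a b c d) <= eps * s ^ 2], which this choice makes less than
   half of the left side; adding 1 covers [s = 0]. *)
set (eps := Cmod (F a b c d) / (2 * (s ^ 2 + 1))).
assert (Hs2 : 0 < 2 * (s ^ 2 + 1)) by nra.
assert (He : 0 < eps) by (apply Rdiv_lt_0_compat; assumption).
destruct (Hloc x0 t0) with (eps := eps) as [del [Hdel Hb]]; auto.
{ exact (Hx0 0%nat). }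
{ exact (Ht0 0%nat). }
destruct (pow_half_small s del Hdel) as [n Hn].
pose proof (rects_size n) as [S1 S2]. pose proof (rects_valid n) as V. unfold valid in V.
specialize (Hx0 n). specialize (Ht0 n). simpl in Hx0, Ht0.
assert (Es : rx2 (rects n) - rx1 (rects n) + (rt2 (rects n) - rt1 (rects n)) = s * (/ 2) ^ n)
  by (rewrite S1, S2; unfold s; ring).
specialize (Hb (rx1 (rects n)) (rx2 (rects n)) (rt1 (rects n)) (rt2 (rects n))).
rewrite Es in Hb.
assert (Hb' := Hb ltac:(lra) ltac:(lra) ltac:(lra) ltac:(lra) ltac:(lra) ltac:(lra)
  ltac:(lra) ltac:(lra) Hn).
pose proof (rects_F n) as L. unfold Fr in L.
(* The modulus loses a factor 4 per subdivision, exactly as the squared perimeter does, so the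
   powers cancel. *)
assert (E4 : (/ 4) ^ n = ((/ 2) ^ n) ^ 2).
{ rewrite <- pow_mult, Nat.mul_comm, pow_mult. f_equal. lra. }
rewrite E4 in L.
pose proof (pow_lt (/ 2) n ltac:(lra)) as Hp.
set (h := (/ 2) ^ n) in *.
assert (K : Cmod (F a b c d) <= eps * s ^ 2).
{ apply Rmult_le_reg_r with (h ^ 2); [nra|].
  replace (eps * s ^ 2 * h ^ 2) with (eps * (s * h) ^ 2) by ring. lra. }
assert (E : Cmod (F a b c d) = eps * (2 * (s ^ 2 + 1))) by (unfold eps; field; lra).
rewrite E in K. nra.
Qed.

End Quadrisection.

(** * Cauchy's theorem on dilated circles *)

(* With [G x t = f (zeta x t)] and [k] the logarithmic derivative of [zeta] in [t] divided by
   [Ci], this is the integral of [f(zeta) dzeta / (zeta - z)] along the image of the boundary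
   of [x1, x2] x [t1, t2]. *)
Definition boundary_int (k : R -> C) (G : R -> R -> C) (x1 x2 t1 t2 : R) : C :=
  (CInt (fun x => G x t1 - G x t2) x1 x2
   + CInt (fun t => Ci * k t * (G x2 t - G x1 t)) t1 t2)%C.

(** Continuity along each edge is what the one-variable integrals require; [x <= 0] is the range in
    which the contracted circles stay in the disc. *)
Definition sep_cont (G : R -> R -> C) : Prop :=
  forall x t, x <= 0 -> Ccont (fun x => G x t) x /\ Ccont (G x) t.

Section Boundary.

Variable k : R -> C.
Hypothesis Hk : forall t, Ccont k t.

Lemma ex_boundary_x (G : R -> R -> C) (x1 x2 t1 t2 : R) :
  sep_cont G -> x1 <= x2 -> x2 <= 0 -> ex_CInt (fun x => G x t1 - G x t2)%C x1 x2.
Proof.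
intros HG H1 H2. apply ex_CInt_cont; [exact H1|]. intros x Hx.
apply Ccont_minus; apply HG; lra.
Qed.

Lemma ex_boundary_t (G : R -> R -> C) (x1 x2 t1 t2 : R) :
  sep_cont G -> x1 <= 0 -> x2 <= 0 -> t1 <= t2 ->
  ex_CInt (fun t => Ci * k t * (G x2 t - G x1 t))%C t1 t2.
Proof.
intros HG H1 H2 H3. apply ex_CInt_cont; [exact H3|]. intros t _.
apply Ccont_mult; [apply Ccont_mult; [apply Ccont_const|apply Hk]|].
apply Ccont_minus; apply HG; lra.
Qed.

Lemma boundary_split_x (G : R -> R -> C) (x1 x x2 t1 t2 : R) :
  sep_cont G -> x1 <= x -> x <= x2 -> x2 <= 0 -> t1 <= t2 ->
  boundary_int k G x1 x2 t1 t2
  = (boundary_int k G x1 x t1 t2 + boundary_int k G x x2 t1 t2)%C.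
Proof.
intros HG H1 H2 H3 H4. unfold boundary_int.
rewrite <- (CInt_Chasles (fun x => G x t1 - G x t2)%C x1 x x2)
  by (apply ex_boundary_x; auto; lra).
rewrite (CInt_ext (fun t => Ci * k t * (G x2 t - G x1 t))%C
  (fun t => Ci * k t * (G x t - G x1 t) + Ci * k t * (G x2 t - G x t))%C t1 t2)
  by (auto; intros; ring).
rewrite CInt_plus by (apply ex_boundary_t; auto; lra).
ring.
Qed.

Lemma boundary_split_t (G : R -> R -> C) (x1 x2 t1 t t2 : R) :
  sep_cont G -> x1 <= x2 -> x2 <= 0 -> t1 <= t -> t <= t2 ->
  boundary_int k G x1 x2 t1 t2
  = (boundary_int k G x1 x2 t1 t + boundary_int k G x1 x2 t t2)%C.
Proof.
intros HG H1 H2 H3 H4. unfold boundary_int.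
rewrite <- (CInt_Chasles (fun t => Ci * k t * (G x2 t - G x1 t))%C t1 t t2)
  by (apply ex_boundary_t; auto; lra).
rewrite (CInt_ext (fun x => G x t1 - G x t2)%C
  (fun x => (G x t1 - G x t) + (G x t - G x t2))%C x1 x2)
  by (auto; intros; ring).
rewrite CInt_plus by (apply ex_boundary_x; auto; lra).
ring.
Qed.

Lemma boundary_plus (G H : R -> R -> C) (x1 x2 t1 t2 : R) :
  sep_cont G -> sep_cont H -> x1 <= x2 -> x2 <= 0 -> t1 <= t2 ->
  boundary_int k (fun x t => G x t + H x t)%C x1 x2 t1 t2
  = (boundary_int k G x1 x2 t1 t2 + boundary_int k H x1 x2 t1 t2)%C.
Proof.
intros HG HH H1 H2 H3. unfold boundary_int.
rewrite (CInt_ext (fun x => G x t1 + H x t1 - (G x t2 + H x t2))%C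
  (fun x => (G x t1 - G x t2) + (H x t1 - H x t2))%C x1 x2) by (auto; intros; ring).
rewrite (CInt_ext (fun t => Ci * k t * (G x2 t + H x2 t - (G x1 t + H x1 t)))%C
  (fun t => Ci * k t * (G x2 t - G x1 t) + Ci * k t * (H x2 t - H x1 t))%C t1 t2)
  by (auto; intros; ring).
rewrite (CInt_plus (fun x => G x t1 - G x t2)%C (fun x => H x t1 - H x t2)%C)
  by (apply ex_boundary_x; assumption).
rewrite (CInt_plus (fun t => Ci * k t * (G x2 t - G x1 t))%C
  (fun t => Ci * k t * (H x2 t - H x1 t))%C) by (apply ex_boundary_t; auto; lra).
ring.
Qed.

Lemma boundary_bound (G : R -> R -> C) (x1 x2 t1 t2 M K : R) :
  sep_cont G -> x1 <= x2 -> x2 <= 0 -> t1 <= t2 -> 0 <= M ->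
  (forall t, Cmod (k t) <= K) ->
  (forall x t, x1 <= x <= x2 -> t1 <= t <= t2 -> Cmod (G x t) <= M) ->
  Cmod (boundary_int k G x1 x2 t1 t2) <= 2 * M * (x2 - x1 + K * (t2 - t1)).
Proof.
intros HG H1 H2 H3 HM HK HB. unfold boundary_int.
assert (D : forall a b : C, Cmod a <= M -> Cmod b <= M -> Cmod (a - b)%C <= 2 * M).
{ intros a b Ha Hb. pose proof (Cmod_triangle a (- b)%C) as T. rewrite Cmod_opp in T.
  unfold Cminus. lra. }
apply Rle_trans with (1 := Cmod_triangle _ _).
assert (B1 : Cmod (CInt (fun x => G x t1 - G x t2)%C x1 x2) <= (x2 - x1) * (2 * M)).
{ apply Cmod_CInt_le_const; [exact H1|apply ex_boundary_x; auto|].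
  intros x Hx. apply D; apply HB; lra. }
assert (B2 : Cmod (CInt (fun t => Ci * k t * (G x2 t - G x1 t))%C t1 t2)
  <= (t2 - t1) * (K * (2 * M))).
{ apply Cmod_CInt_le_const; [exact H3|apply ex_boundary_t; auto; lra|].
  intros t Ht. rewrite !Cmod_mult, Cmod_Ci, Rmult_1_l.
  apply Rmult_le_compat; try apply Cmod_ge_0; [apply HK|].
  apply D; apply HB; lra. }
lra.
Qed.

End Boundary.

Section CauchyFormula.

Variables (z : C) (r : R).
Hypothesis Hzr : Cmod z < r.
Hypothesis Hr1 : r < 1.

Let Hr0 : 0 < r.
Proof. apply Rle_lt_trans with (2 := Hzr), Cmod_ge_0. Qed.

Let g (t : R) := polar r t.
(** The circle contracted towards [z] by the factor [exp x]: it is the circle itself at [x = 0] and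
    shrinks to [z] as x tends to minus infinity. With this exponential scale d zeta / (zeta - z) is
    dx along [x] and [Ci * k t] dt along [t], so the kernel no longer depends on [x]. *)
Let zeta (x t : R) : C := (z + RtoC (exp x) * (g t - z))%C.
Let k (t : R) : C := (g t / (g t - z))%C.

Lemma Cmod_polar_minus_ge (t : R) : r - Cmod z <= Cmod (polar r t - z)%C.
Proof.
pose proof (Cmod_minus_ge (polar r t) z) as K. rewrite Cmod_polar in K; lra.
Qed.

Lemma polar_minus_neq_0 (t : R) : (polar r t - z)%C <> RtoC 0.
Proof. apply Cmod_gt_0. pose proof (Cmod_polar_minus_ge t). lra. Qed.

Let k_cont (t : R) : Ccont k t.
Proof.
apply Ccont_mult; [apply Ccont_polar|]. apply Ccont_inv; [|apply polar_minus_neq_0].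
apply Ccont_minus; [apply Ccont_polar|apply Ccont_const].
Qed.

Let k_bound (t : R) : Cmod (k t) <= / (r - Cmod z).
Proof.
unfold k. rewrite Cmod_div by apply polar_minus_neq_0.
unfold g. rewrite Cmod_polar by lra. pose proof (Cmod_polar_minus_ge t) as K.
unfold Rdiv. rewrite <- (Rmult_1_l (/ (r - Cmod z))).
assert (/ Cmod (polar r t - z)%C <= / (r - Cmod z)) by (apply Rinv_le_contravar; lra).
assert (0 < / Cmod (polar r t - z)%C) by (apply Rinv_0_lt_compat; lra).
apply Rmult_le_compat; lra.
Qed.

Let exp_01 (x : R) : x <= 0 -> 0 < exp x <= 1.
Proof.
intros Hx. split; [apply exp_pos|]. rewrite <- exp_0.
destruct Hx as [Hx| ->]; [left; apply exp_increasing, Hx|right; reflexivity].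
Qed.

Let zeta_inD (x t : R) : x <= 0 -> inD (zeta x t).
Proof.
intros Hx. destruct (exp_01 x Hx) as [E1 E2]. unfold inD, zeta.
replace (z + RtoC (exp x) * (g t - z))%C with (RtoC (1 - exp x) * z + RtoC (exp x) * g t)%C
  by (rewrite RtoC_minus; ring).
apply Rle_lt_trans with (1 := Cmod_triangle _ _).
rewrite !Cmod_mult, !Cmod_R, !Rabs_pos_eq by lra.
unfold g. rewrite Cmod_polar by lra.
pose proof (Cmod_ge_0 z). nra.
Qed.

Let RtoC_cont (u : R -> R) (x : R) : continuous u x -> Ccont (fun x => RtoC (u x)) x.
Proof. intros H. apply Ccont_pair; simpl; [exact H|apply continuous_const]. Qed.

Let exp_cont (x : R) : Ccont (fun x => RtoC (exp x)) x.
Proof.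
apply RtoC_cont. apply (ex_derive_continuous (K := R_AbsRing) (V := R_NormedModule)).
auto_derive; exact I.
Qed.

Let zeta_cont : sep_cont zeta.
Proof.
intros x t _. split; unfold zeta.
- apply Ccont_plus; [apply Ccont_const|]. apply Ccont_mult; [apply exp_cont|apply Ccont_const].
- apply Ccont_plus; [apply Ccont_const|]. apply Ccont_mult; [apply Ccont_const|].
  apply Ccont_minus; [apply Ccont_polar|apply Ccont_const].
Qed.

Let zeta_lipschitz (x0 t0 x t : R) :
  x0 <= 0 -> x <= 0 -> Cmod (zeta x t - zeta x0 t0)%C <= 2 * (Rabs (x - x0) + Rabs (t - t0)).
Proof.
intros H0 H. unfold zeta.
replace (z + RtoC (exp x) * (g t - z) - (z + RtoC (exp x0) * (g t0 - z)))%C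
  with (RtoC (exp x - exp x0) * (g t - z) + RtoC (exp x0) * (g t - g t0))%C
  by (rewrite RtoC_minus; ring).
apply Rle_trans with (1 := Cmod_triangle _ _).
rewrite !Cmod_mult, !Cmod_R.
pose proof (exp_lipschitz_nonpos x x0 H H0) as L1.
pose proof (Cmod_polar_lipschitz r t0 t ltac:(lra)) as L2.
destruct (exp_01 x0 H0) as [E1 E2]. rewrite (Rabs_pos_eq (exp x0)) by lra.
assert (B : Cmod (g t - z)%C <= 2).
{ unfold Cminus. apply Rle_trans with (1 := Cmod_triangle _ _).
  rewrite Cmod_opp. unfold g. rewrite Cmod_polar; lra. }
fold (g t) (g t0) in L2.
pose proof (Rabs_pos (exp x - exp x0)). pose proof (Rabs_pos (t - t0)).
pose proof (Cmod_ge_0 (g t - z)%C). pose proof (Cmod_ge_0 (g t - g t0)%C).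
assert (Rabs (exp x - exp x0) * Cmod (g t - z)%C <= Rabs (x - x0) * 2)
  by (apply Rmult_le_compat; assumption).
assert (exp x0 * Cmod (g t - g t0)%C <= 1 * (2 * Rabs (t - t0))).
{ apply Rmult_le_compat; try lra. nra. }
lra.
Qed.

(** The constant [a] drops out of the differences, and the factor [g t - z] of
    [zeta x2 t - zeta x1 t] cancels the denominator of [k]. Both integrals become explicit and
    opposite. *)
Let affine_boundary (a c : C) (x1 x2 t1 t2 : R) : t1 <= t2 -> x1 <= x2 ->
  boundary_int k (fun x t => a + c * zeta x t)%C x1 x2 t1 t2 = RtoC 0.
Proof.
intros Ht Hx. unfold boundary_int, zeta.
rewrite (CInt_ext _ (fun x => c * (g t1 - g t2) * RtoC (exp x))%C x1 x2)
  by (auto; intros; ring).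
rewrite (CInt_ext _ (fun t => c * RtoC (exp x2 - exp x1) * (Ci * polar r t))%C t1 t2).
- rewrite (CInt_scal _ (fun x => RtoC (exp x))), (CInt_scal _ (fun t => Ci * polar r t)%C),
    CInt_exp, CInt_Ci_polar.
  + unfold g. ring.
  + apply ex_CInt_cont; [exact Ht|]. intros u _.
    apply Ccont_mult; [apply Ccont_const|apply Ccont_polar].
  + apply ex_CInt_cont; [exact Hx|]. intros u _. apply exp_cont.
- exact Ht.
- intros t _. unfold k, g. rewrite RtoC_minus. field. apply polar_minus_neq_0.
Qed.

Variable f : C -> C.
Hypothesis Hf : analytic_on_D f.

Let fz_cont : sep_cont (fun x t => f (zeta x t)).
Proof.
intros x t Hx. destruct (zeta_cont x t Hx) as [C1 C2].
split; (apply Ccont_comp; [assumption|apply analytic_Ccont; [exact Hf|apply zeta_inD, Hx]]).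
Qed.

(** Locally, subtract from [f] its first-order expansion, whose boundary integral is 0 by
    [affine_boundary]. What is left is small compared with the size of the rectangle, and
    integrating it over the edges gains a second factor of that size. *)
Let goursat (X T : R) : X <= 0 -> 0 <= T ->
  boundary_int k (fun x t => f (zeta x t)) X 0 0 T = RtoC 0.
Proof.
intros HX HT. apply quadrisection; [exact HX|exact HT|..].
- intros. apply boundary_split_x; auto; lra.
- intros. apply boundary_split_t; auto; lra.
- intros x0 t0 Hx0 Ht0 eps He.
  pose proof (is_cder_cderiv f _ Hf (zeta_inD x0 t0 (proj2 Hx0))) as Hd.
  rewrite is_cder_spec in Hd. set (l := cderiv f (zeta x0 t0)) in *.
  set (K := / (r - Cmod z)).
  assert (HK : 0 < K) by (apply Rinv_0_lt_compat; lra).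
  (* The final estimate is [2 * (eta * (2 * s)) * ((1 + K) * s)], which is to equal
     [eps * s ^ 2]. *)
  set (eta := eps / (4 * (1 + K))).
  assert (Heta : 0 < eta) by (apply Rdiv_lt_0_compat; lra).
  destruct (Hd eta Heta) as [del [Hdel Hb]].
  (* Halved because [zeta] has Lipschitz constant 2. *)
  exists (del / 2). split; [lra|].
  intros x1 x2 t1 t2 A1 A2 A3 A4 A5 A6 A7 A8 Hs.
  set (s := x2 - x1 + (t2 - t1)) in *.
  set (E := fun x t => (f (zeta x t) + - (f (zeta x0 t0) - l * zeta x0 t0 + l * zeta x t))%C).
  assert (Ca : sep_cont (fun x t => f (zeta x0 t0) - l * zeta x0 t0 + l * zeta x t)%C).
  { intros x t Hx. destruct (zeta_cont x t Hx) as [C1 C2].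
    split; (apply Ccont_plus; [apply Ccont_const|apply Ccont_mult; [apply Ccont_const|assumption]]). }
  assert (CE : sep_cont E).
  { intros x t Hx. destruct (fz_cont x t Hx) as [C1 C2]. destruct (Ca x t Hx) as [C3 C4].
    split; (apply Ccont_plus; [assumption|apply Ccont_opp; assumption]). }
  assert (EQ : boundary_int k (fun x t => f (zeta x t)) x1 x2 t1 t2
    = boundary_int k (fun x t => E x t + (f (zeta x0 t0) - l * zeta x0 t0 + l * zeta x t))%C x1 x2 t1 t2).
  { unfold boundary_int. f_equal; apply CInt_ext; try lra; intros; unfold E; ring. }
  rewrite EQ, boundary_plus, affine_boundary by (auto; lra).
  rewrite Cplus_0_r.
  apply Rle_trans with (2 * (eta * (2 * s)) * (x2 - x1 + K * (t2 - t1))).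
  + apply boundary_bound; auto; try lra.
    * unfold s. nra.
    * intros x t Hx Ht. unfold E.
      assert (Hsm : Rabs (x - x0) + Rabs (t - t0) <= s).
      { assert (Rabs (x - x0) <= x2 - x1) by (apply Rabs_le; lra).
        assert (Rabs (t - t0) <= t2 - t1) by (apply Rabs_le; lra). unfold s; lra. }
      pose proof (zeta_lipschitz x0 t0 x t ltac:(lra) ltac:(lra)) as L.
      replace (f (zeta x t) + - (f (zeta x0 t0) - l * zeta x0 t0 + l * zeta x t))%C
        with (f (zeta x t) - f (zeta x0 t0) - l * (zeta x t - zeta x0 t0))%C by ring.
      apply Rle_trans with (1 := Hb (zeta x t) ltac:(lra)).
      apply Rmult_le_compat_l; lra.
  + replace eps with (eta * (4 * (1 + K))) by (unfold eta; field; lra).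
    assert (P1 : x2 - x1 + K * (t2 - t1) <= (1 + K) * s).
    { unfold s. assert (0 <= K * (x2 - x1)) by (apply Rmult_le_pos; lra). lra. }
    assert (P0 : 0 <= s) by (unfold s; lra).
    assert (P2 : 0 <= eta * s) by (apply Rmult_le_pos; lra).
    assert (P3 := Rmult_le_compat_l _ _ _ P2 P1).
    replace (eta * (4 * (1 + K)) * s ^ 2) with (4 * (eta * s * ((1 + K) * s))) by ring.
    lra.
Qed.

Let two_pi_pos : 0 < 2 * PI.
Proof. pose proof PI_RGT_0. lra. Qed.

(** The edges [t = 0] and [t = 2 * PI] have the same image and cancel, so [goursat] compares the
    integrals over the two circles. *)
Let const_in_x (X : R) : X <= 0 ->
  CInt (fun t => k t * f (zeta X t))%C 0 (2 * PI) = CInt (fun t => k t * f (g t))%C 0 (2 * PI).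
Proof.
intros HX. pose proof (goursat X (2 * PI) HX ltac:(lra)) as H.
unfold boundary_int in H.
assert (Hper : forall x, zeta x (2 * PI) = zeta x 0)
  by (intros x; unfold zeta, g; now rewrite polar_periodic).
rewrite (CInt_ext (fun x => f (zeta x 0) - f (zeta x (2 * PI)))%C (fun _ => RtoC 0)) in H
  by (auto; intros; rewrite Hper; ring).
rewrite CInt_const, Cmult_0_r, Cplus_0_l in H.
assert (X0 : forall t, zeta 0 t = g t) by (intros t; unfold zeta; rewrite exp_0; ring).
rewrite (CInt_ext _ (fun t => Ci * (k t * f (g t) - k t * f (zeta X t)))%C) in H
  by (try lra; intros; rewrite X0; ring).
assert (I1 : ex_CInt (fun t => k t * f (zeta X t))%C 0 (2 * PI)).
{ apply ex_CInt_cont; [lra|]. intros t _. apply Ccont_mult; [apply k_cont|].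
  apply (fz_cont X t HX). }
assert (I2 : ex_CInt (fun t => k t * f (g t))%C 0 (2 * PI)).
{ apply ex_CInt_cont; [lra|]. intros t _. apply Ccont_mult; [apply k_cont|].
  apply Ccont_comp; [apply Ccont_polar|]. apply analytic_Ccont; [exact Hf|].
  rewrite <- X0. apply zeta_inD. lra. }
rewrite CInt_scal, CInt_minus in H; auto.
2: { apply (ex_RInt_minus (V := C_R_NormedModule)); assumption. }
symmetry. apply Cminus_eq_0.
replace (CInt (fun t => k t * f (g t)) 0 (2 * PI) - CInt (fun t => k t * f (zeta X t)) 0 (2 * PI))%C
  with (- Ci * (Ci * (CInt (fun t => k t * f (g t)) 0 (2 * PI)
    - CInt (fun t => k t * f (zeta X t)) 0 (2 * PI))))%C.
- rewrite H. ring.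
- rewrite Cmult_assoc.
  replace (- Ci * Ci)%C with (RtoC 1); [ring|].
  unfold Ci, Cmult, Copp; simpl. unfold RtoC. f_equal; ring.
Qed.

(** The integral does not change while the circle shrinks to [z], where continuity lets [f] be
    replaced by [f z]. *)
Let limit_at_center :
  CInt (fun t => k t * f (g t))%C 0 (2 * PI) = (f z * CInt k 0 (2 * PI))%C.
Proof.
assert (Ik : ex_CInt k 0 (2 * PI)) by (apply ex_CInt_cont; [lra|auto]).
apply Cminus_eq_0, Cmod_eq_0. apply Rle_antisym; [|apply Cmod_ge_0].
apply Rnot_lt_le. intros Hpos.
set (d := Cmod _) in Hpos.
set (K := / (r - Cmod z)).
assert (HK : 0 < K) by (apply Rinv_0_lt_compat; lra).
assert (Hz : inD z) by (unfold inD; lra).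
pose proof (analytic_Ccont f z Hf Hz) as Hc. rewrite Ccont_spec in Hc.
(* Chosen so that the error [2 * PI * (K * eps)] is half of the supposed discrepancy [d]. *)
set (eps := d / (2 * (2 * PI * K))).
assert (HPK : 0 < 2 * PI * K) by (apply Rmult_lt_0_compat; lra).
assert (He : 0 < eps) by (apply Rdiv_lt_0_compat; lra).
specialize (Hc eps He). apply locally_Cmod in Hc. destruct Hc as [del [Hdel Hb]].
(* Since [Cmod (g t - z) <= 2], this puts the contracted circle within [del / 2] of [z]; the minimum
   with 0 keeps it inside the disc. *)
set (X := Rmin 0 (ln (del / 4))).
assert (HX : X <= 0) by apply Rmin_l.
assert (HeX : exp X <= del / 4).
{ rewrite <- (exp_ln (del / 4)) by lra.
  destruct (Rmin_r 0 (ln (del / 4))) as [H|H]; unfold X.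
  - left. apply exp_increasing, H.
  - right. now rewrite H. }
assert (L : d <= 2 * PI * (K * eps)); [|].
{ unfold d. rewrite <- (const_in_x X HX), <- CInt_scal by exact Ik.
  rewrite <- CInt_minus.
  - rewrite <- (Rminus_0_r (2 * PI)) at 2.
    apply Cmod_CInt_le_const; [lra|..].
    + apply ex_CInt_cont; [lra|]. intros t _. apply Ccont_minus.
      * apply Ccont_mult; [apply k_cont|apply (fz_cont X t HX)].
      * apply Ccont_mult; [apply Ccont_const|apply k_cont].
    + intros t _. replace (k t * f (zeta X t) - f z * k t)%C
        with (k t * (f (zeta X t) - f z))%C by ring.
      rewrite Cmod_mult. apply Rmult_le_compat; try apply Cmod_ge_0; [apply k_bound|].
      left. apply Hb. unfold zeta.
      replace (z + RtoC (exp X) * (g t - z) - z)%C with (RtoC (exp X) * (g t - z))%C by ring.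
      rewrite Cmod_mult, Cmod_R, Rabs_pos_eq by (left; apply exp_pos).
      assert (B : Cmod (g t - z)%C <= 2).
      { unfold Cminus. apply Rle_trans with (1 := Cmod_triangle _ _).
        rewrite Cmod_opp. unfold g. rewrite Cmod_polar; lra. }
      pose proof (exp_pos X). pose proof (Cmod_ge_0 (g t - z)%C). nra.
  - apply ex_CInt_cont; [lra|]. intros t _. apply Ccont_mult; [apply k_cont|apply (fz_cont X t HX)].
  - apply ex_CInt_cont; [lra|]. intros t _. apply Ccont_mult; [apply Ccont_const|apply k_cont]. }
assert (Ed : 2 * PI * (K * eps) = d / 2) by (unfold eps; field; pose proof PI_RGT_0; lra).
lra.
Qed.

Lemma cauchy_unnormalized :
  CInt (fun t => polar r t / (polar r t - z) * f (polar r t))%C 0 (2 * PI)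
  = (f z * CInt (fun t => polar r t / (polar r t - z))%C 0 (2 * PI))%C.
Proof. exact limit_at_center. Qed.

End CauchyFormula.

(** * Cauchy transforms *)

Lemma two_pi_pos : 0 < 2 * PI.
Proof. pose proof PI_RGT_0. lra. Qed.

Lemma polar_pow (r t : R) (n : nat) : (polar r t ^ n)%C = polar (r ^ n) (INR n * t).
Proof.
induction n as [|n IH].
- unfold polar. simpl. rewrite Rmult_0_l, cos_0, sin_0. unfold RtoC. f_equal; ring.
- rewrite Cpow_S, IH, S_INR. unfold polar, Cmult; simpl.
  replace ((INR n + 1) * t) with (t + INR n * t) by ring.
  rewrite cos_plus, sin_plus. f_equal; ring.
Qed.

Lemma polar_inv (r t : R) : r <> 0 -> (/ polar r t)%C = polar (/ r) (- t).
Proof.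
intros Hr. unfold polar, Cinv; simpl. rewrite cos_neg, sin_neg.
replace (r * cos t * (r * cos t * 1) + r * sin t * (r * sin t * 1))
  with (r * r * (Rsqr (sin t) + Rsqr (cos t))) by (unfold Rsqr; ring).
rewrite sin2_cos2. f_equal; field; exact Hr.
Qed.

Lemma CInt_polar_harmonic (r : R) (n : nat) :
  CInt (fun t => polar r (- (INR (S n) * t))) 0 (2 * PI) = RtoC 0.
Proof.
assert (Hn : INR (S n) <> 0) by (apply not_0_INR; lia).
assert (Ec : cos (- (INR (S n) * (2 * PI))) = 1).
{ rewrite cos_neg. replace (INR (S n) * (2 * PI)) with (0 + 2 * INR (S n) * PI) by ring.
  rewrite cos_period. apply cos_0. }
assert (Es : sin (- (INR (S n) * (2 * PI))) = 0).
{ rewrite sin_neg. replace (INR (S n) * (2 * PI)) with (0 + 2 * INR (S n) * PI) by ring.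
  rewrite sin_period, sin_0. ring. }
revert Hn Ec Es. generalize (INR (S n)). intros m Hn Ec Es.
apply (is_RInt_unique (V := C_R_CompleteNormedModule)).
unfold polar. apply is_RInt_pair; simpl fst; simpl snd; cbv beta iota.
- assert (K : is_RInt (fun t => r * cos (- (m * t))) 0 (2 * PI)
   (minus (- r / m * sin (- (m * (2 * PI))))
      (- r / m * sin (- (m * 0))))).
  { apply (is_RInt_derive (V := R_CompleteNormedModule)
      (fun t => - r / m * sin (- (m * t)))).
    + intros x _. auto_derive; [exact I|]. field; exact Hn.
    + intros x _. apply (ex_derive_continuous (K := R_AbsRing) (V := R_NormedModule)).
      auto_derive; exact I. }
  rewrite Es, !Rmult_0_r, Ropp_0, sin_0, !Rmult_0_r in K.
  replace (minus 0 0) with 0 in K; [exact K|].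
  unfold minus, plus, opp; simpl; ring.
- assert (K : is_RInt (fun t => r * sin (- (m * t))) 0 (2 * PI)
   (minus (r / m * cos (- (m * (2 * PI))))
      (r / m * cos (- (m * 0))))).
  { apply (is_RInt_derive (V := R_CompleteNormedModule)
      (fun t => r / m * cos (- (m * t)))).
    + intros x _. auto_derive; [exact I|]. field; exact Hn.
    + intros x _. apply (ex_derive_continuous (K := R_AbsRing) (V := R_NormedModule)).
      auto_derive; exact I. }
  rewrite Ec, Rmult_0_r, Ropp_0, cos_0 in K.
  replace (minus (r / m * 1) (r / m * 1)) with 0 in K; [exact K|].
  unfold minus, plus, opp; simpl; ring.
Qed.

Lemma Ccont_pow (X : UniformSpace) (f : X -> C) (x : X) (n : nat) :
  Ccont f x -> Ccont (fun y => f y ^ n)%C x.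
Proof.
intros H. induction n as [|n IH].
- apply (Ccont_const X 1%C).
- apply (Ccont_mult X f (fun y => f y ^ n)%C); assumption.
Qed.

Lemma polar_neq_0 (r t : R) : 0 < r -> polar r t <> RtoC 0.
Proof. intros Hr. apply Cmod_gt_0. rewrite Cmod_polar; lra. Qed.

Lemma Cmod_resolvent_le (z : C) (r rho t : R) :
  Cmod z <= rho -> rho < r -> Cmod (/ (polar r t - z))%C <= / (r - rho).
Proof.
intros H1 H2. pose proof (Cmod_ge_0 z).
rewrite Cmod_inv by (apply polar_minus_neq_0; lra).
apply Rinv_le_contravar; [lra|]. pose proof (Cmod_polar_minus_ge z r ltac:(lra) t). lra.
Qed.

Lemma Ccont_resolvent (z : C) (r t : R) :
  Cmod z < r -> Ccont (fun t => / (polar r t - z))%C t.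
Proof.
intros H. apply Ccont_inv; [|apply polar_minus_neq_0, H].
apply Ccont_minus; [apply Ccont_polar|apply Ccont_const].
Qed.

(* Expand [1 / (1 - q)] in powers of [q = z / polar r t]: every positive power has integral 0. *)
Lemma CInt_cauchy_kernel (z : C) (r : R) :
  Cmod z < r -> CInt (fun t => polar r t / (polar r t - z))%C 0 (2 * PI) = RtoC (2 * PI).
Proof.
intros Hz. pose proof two_pi_pos as HP. pose proof (Cmod_ge_0 z) as Hz0.
assert (Hr : 0 < r) by lra.
set (q := fun t => (z * / polar r t)%C).
assert (Cq : forall t, Ccont q t).
{ intros t. apply Ccont_mult; [apply Ccont_const|].
  apply Ccont_inv; [apply Ccont_polar|apply polar_neq_0, Hr]. }
set (k := fun t => (polar r t / (polar r t - z))%C).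
assert (Ck : forall t, Ccont k t).
{ intros t. apply Ccont_mult; [apply Ccont_polar|apply Ccont_resolvent, Hz]. }
assert (Eqn : forall n, CInt (fun t => q t ^ S n)%C 0 (2 * PI) = RtoC 0).
{ intros n.
  rewrite (CInt_ext _ (fun t => z ^ S n * polar ((/ r) ^ S n) (- (INR (S n) * t)))%C).
  - rewrite CInt_scal, CInt_polar_harmonic; [apply Cmult_0_r|].
    apply ex_CInt_cont; [lra|]. intros t _.
    apply Ccont_pair; unfold polar; simpl fst; simpl snd; cbv beta iota;
    apply (ex_derive_continuous (K := R_AbsRing) (V := R_NormedModule)); auto_derive; exact I.
  - lra.
  - intros t _. unfold q. rewrite Cpow_mult_l, polar_inv, polar_pow by lra.
    now replace (INR (S n) * - t) with (- (INR (S n) * t)) by ring. }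
(* This is [k = 1 + q * k] multiplied by [q ^ n]. *)
assert (Rec : forall n, CInt (fun t => q t ^ n * k t)%C 0 (2 * PI) =
  (CInt (fun t => q t ^ n)%C 0 (2 * PI) + CInt (fun t => q t ^ S n * k t)%C 0 (2 * PI))%C).
{ intros n. rewrite <- CInt_plus.
  - apply CInt_ext; [lra|]. intros t _. rewrite Cpow_S. unfold k, q. field.
    split; [apply polar_minus_neq_0, Hz|apply polar_neq_0, Hr].
  - apply ex_CInt_cont; [lra|]. intros t _. apply Ccont_pow, Cq.
  - apply ex_CInt_cont; [lra|]. intros t _. apply Ccont_mult; [apply Ccont_pow, Cq|apply Ck]. }
(* The remainders all have the same integral, because the powers between them integrate to 0, while
   their bounds decay geometrically; hence that integral is 0. *)
assert (Tail : forall n, CInt (fun t => q t ^ S n * k t)%C 0 (2 * PI)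
  = CInt (fun t => q t ^ 1 * k t)%C 0 (2 * PI)).
{ induction n as [|n IH]; [reflexivity|]. rewrite <- IH, (Rec (S n)), Eqn. symmetry. apply Cplus_0_l. }
assert (T0 : CInt (fun t => q t ^ 1 * k t)%C 0 (2 * PI) = RtoC 0).
{ apply Cmod_eq_0. apply Rle_antisym; [|apply Cmod_ge_0]. apply Rnot_lt_le. intros Hpos.
  set (d := Cmod _) in Hpos.
  set (K := 2 * PI * (r / (r - Cmod z))).
  assert (HK : 0 < K) by (apply Rmult_lt_0_compat; [lra|apply Rdiv_lt_0_compat; lra]).
  assert (Hq : 0 <= Cmod z / r < 1).
  { split; [apply Rmult_le_pos; [lra|left; apply Rinv_0_lt_compat, Hr]|].
    apply Rlt_div_l; lra. }
  destruct (pow_lt_1_zero (Cmod z / r) ltac:(rewrite Rabs_pos_eq; lra) (d / K)) as [n Hn].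
  { apply Rdiv_lt_0_compat; assumption. }
  specialize (Hn (S n) ltac:(lia)). rewrite Rabs_pos_eq in Hn by (apply pow_le; lra).
  assert (B : d <= (2 * PI - 0) * ((Cmod z / r) ^ S n * (r * / (r - Cmod z)))).
  { unfold d. rewrite <- (Tail n). apply Cmod_CInt_le_const; [lra|..].
    - apply ex_CInt_cont; [lra|]. intros t _. apply Ccont_mult; [apply Ccont_pow, Cq|apply Ck].
    - intros t _. rewrite Cmod_mult, Cmod_pow. unfold q, k, Cdiv.
      rewrite !Cmod_mult, (Cmod_inv (polar r t)), Cmod_polar by (lra || apply polar_neq_0, Hr).
      apply Rmult_le_compat_l; [apply pow_le; apply Hq|].
      apply Rmult_le_compat_l; [lra|]. apply Cmod_resolvent_le; lra. }
  apply (Rmult_lt_compat_l K) in Hn; [|exact HK].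
  replace (K * (d / K)) with d in Hn by (field; lra).
  unfold K in Hn. unfold Rdiv in Hn, B. lra. }
pose proof (Rec 0%nat) as R0. rewrite T0 in R0.
rewrite (CInt_ext (fun t => q t ^ 0)%C (fun _ => RtoC 1)) in R0 by (auto; lra).
rewrite CInt_const, (CInt_ext _ k) in R0 by (try lra; intros; apply Cmult_1_l).
fold k. rewrite R0, Cplus_0_r, Cmult_1_r, Rminus_0_r. reflexivity.
Qed.

(** The shift to [S k] makes [k = 0] the Cauchy integral, and each differentiation raises [k] by
    one. *)
Definition cauchy_transform (r : R) (g : R -> C) (k : nat) (z : C) : C :=
  CInt (fun t => g t * (/ (polar r t - z)) ^ S k)%C 0 (2 * PI).

(** Intended for a = 1 / (zeta - y), b = 1 / (zeta - z), h = y - z, where the equation is the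
    resolvent identity. The error, quadratic in [h] and uniform on the circle, allows
    differentiation under the integral. *)
Lemma resolvent_pow_taylor (a b h : C) (M : R) (k : nat) :
  Cmod a <= M -> Cmod b <= M -> (a - b = h * a * b)%C ->
  Cmod (a ^ k - b ^ k - RtoC (INR k) * h * b ^ S k)%C <= INR k ^ 2 * M ^ (k + 2) * Cmod h ^ 2.
Proof.
intros Ha Hb E. pose proof (Cmod_ge_0 a) as Ha0. pose proof (Cmod_ge_0 b) as Hb0.
pose proof (Cmod_ge_0 h) as Hh0.
induction k as [|k IH].
- simpl. replace (1 - 1 - 0 * h * (b * 1))%C with (RtoC 0) by ring.
  rewrite Cmod_0. simpl. nra.
- set (e := (a ^ k - b ^ k - RtoC (INR k) * h * b ^ S k)%C) in *.
  (* The errors satisfy e_(k+1) = a e_k + (k + 1) h^2 a b^(k+2), and the constant [INR k ^ 2] keeps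
     pace because k^2 + k + 1 <= (k + 1)^2. *)
  assert (D : (a ^ S k - b ^ S k - RtoC (INR (S k)) * h * b ^ S (S k)
     = a * e + RtoC (INR k + 1) * (h * h * a * (b ^ S (S k))))%C).
  { unfold e. rewrite S_INR, RtoC_plus. rewrite !Cpow_S.
    set (p := (b ^ k)%C). set (s := (a ^ k)%C).
    replace a with (b + h * a * b)%C at 1 by (rewrite <- E; ring).
    transitivity ((b + (a - b)) * s - b * p - (RtoC (INR k) + 1) * h * (b * (b * p))
      + ((h * a * b - (a - b)) * s))%C; [ring|].
    replace (h * a * b - (a - b))%C with (RtoC 0) by (rewrite E; ring).
    transitivity (a * s - b * p - (RtoC (INR k) + 1) * h * (b * (b * p)))%C; [ring|].
    transitivity (a * s - a * p - a * RtoC (INR k) * h * (b * p)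
      + ((a - b) * p + RtoC (INR k) * h * b * p * (a - b) - h * b * b * p))%C; [ring|].
    rewrite E.
    transitivity (a * s - a * p - a * RtoC (INR k) * h * (b * p)
      + (h * b * p * (a - b) + RtoC (INR k) * h * b * p * (h * a * b)))%C; [ring|].
    rewrite E. ring. }
  rewrite D. apply Rle_trans with (1 := Cmod_triangle _ _).
  pose proof (pos_INR k) as Hk.
  rewrite !Cmod_mult, Cmod_pow, Cmod_R, Rabs_pos_eq by lra.
  assert (B1 : Cmod a * Cmod e <= M * (INR k ^ 2 * M ^ (k + 2) * Cmod h ^ 2))
    by (apply Rmult_le_compat; auto; apply Cmod_ge_0).
  assert (B2 : Cmod a * Cmod b ^ S (S k) <= M * M ^ S (S k)).
  { apply Rmult_le_compat; auto; [apply pow_le, Hb0|]. apply pow_incr. lra. }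
  assert (B3 : (INR k + 1) * (Cmod h * Cmod h * Cmod a * Cmod b ^ S (S k))
    <= (INR k + 1) * (Cmod h * Cmod h) * (M * M ^ S (S k))).
  { replace ((INR k + 1) * (Cmod h * Cmod h * Cmod a * Cmod b ^ S (S k)))
      with ((INR k + 1) * (Cmod h * Cmod h) * (Cmod a * Cmod b ^ S (S k))) by ring.
    apply Rmult_le_compat_l; [|exact B2]. nra. }
  replace (S k + 2)%nat with (S (S (S k))) by lia.
  replace (k + 2)%nat with (S (S k)) in B1 by lia.
  rewrite S_INR. simpl (M ^ S (S (S k))) in *. change (M * (M * (M * M ^ k))) with (M * M ^ S (S k)).
  assert (HM : 0 <= M * M ^ S (S k)) by (apply (pow_le M (S (S (S k)))); lra).
  assert (0 <= INR k * (Cmod h ^ 2 * (M * M ^ S (S k)))) by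
    (apply Rmult_le_pos; [lra|apply Rmult_le_pos; [nra|exact HM]]).
  simpl (M ^ S (S k)) in *. nra.
Qed.

Lemma continuous_bounded (g : R -> C) (a b : R) :
  a <= b -> (forall t, Ccont g t) -> exists M, 0 < M /\ forall t, a <= t <= b -> Cmod (g t) <= M.
Proof.
intros Hab Hg.
destruct (continuity_ab_maj (fun t => Cmod (g t)) a b Hab) as [m [Hm _]].
{ intros t _. apply continuity_pt_filterlim. apply Ccont_Cmod, Hg. }
exists (Cmod (g m) + 1). pose proof (Cmod_ge_0 (g m)). split; [lra|].
intros t Ht. specialize (Hm t Ht). lra.
Qed.

Lemma ex_cauchy_transform (r : R) (g : R -> C) (k : nat) (z : C) :
  (forall t, Ccont g t) -> Cmod z < r ->
  ex_CInt (fun t => g t * (/ (polar r t - z)) ^ k)%C 0 (2 * PI).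
Proof.
intros Hg Hz. apply ex_CInt_cont; [apply Rlt_le, two_pi_pos|]. intros t _.
apply Ccont_mult; [apply Hg|]. apply Ccont_pow, Ccont_resolvent, Hz.
Qed.

Lemma is_cder_cauchy_transform (r : R) (g : R -> C) (k : nat) (z : C) :
  (forall t, Ccont g t) -> Cmod z < r ->
  is_cder (cauchy_transform r g k) z (RtoC (INR (S k)) * cauchy_transform r g (S k) z)%C.
Proof.
intros Hg Hz. pose proof two_pi_pos as HP. pose proof (Cmod_ge_0 z) as Hz0.
destruct (continuous_bounded g 0 (2 * PI) ltac:(lra) Hg) as [Mg [HMg Bg]].
apply is_cder_spec. intros eps He.
(* Points [y] close to [z] stay within radius [(r + Cmod z) / 2], so [M] bounds the resolvents at
   [y] and [z] alike. *)
set (M := / (r - (r + Cmod z) / 2)).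
assert (HM : 0 < M) by (apply Rinv_0_lt_compat; lra).
set (K := 2 * PI * (Mg * (INR (S k) ^ 2 * M ^ (S k + 2)))).
assert (HK : 0 < K).
{ assert (Hk : 0 < INR (S k)) by (apply lt_0_INR; lia).
  apply Rmult_lt_0_compat; [exact HP|]. apply Rmult_lt_0_compat; [exact HMg|].
  apply Rmult_lt_0_compat; apply pow_lt; assumption. }
(* The first bound keeps [y] within that radius; the second turns the quadratic error
   [K * Cmod (y - z) ^ 2] into a linear one with factor [eps]. *)
exists (Rmin ((r - Cmod z) / 2) (eps / K)). split.
{ apply Rmin_pos; [lra|apply Rdiv_lt_0_compat; assumption]. }
intros y Hy.
assert (Hy1 : Cmod (y - z)%C < (r - Cmod z) / 2) by (apply Rlt_le_trans with (1 := Hy), Rmin_l).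
assert (Hy2 : Cmod (y - z)%C < eps / K) by (apply Rlt_le_trans with (1 := Hy), Rmin_r).
assert (Hyr : Cmod y <= (r + Cmod z) / 2).
{ replace y with ((y - z) + z)%C by ring. pose proof (Cmod_triangle (y - z)%C z). lra. }
unfold cauchy_transform.
rewrite <- CInt_minus by (apply ex_cauchy_transform; auto; lra).
replace (RtoC (INR (S k)) * CInt (fun t => g t * (/ (polar r t - z)) ^ S (S k)) 0 (2 * PI) * (y - z))%C
  with ((RtoC (INR (S k)) * (y - z)) * CInt (fun t => g t * (/ (polar r t - z)) ^ S (S k)) 0 (2 * PI))%C
  by ring.
rewrite <- CInt_scal by (apply ex_cauchy_transform; auto; lra).
assert (X1 : ex_CInt (fun t => g t * (/ (polar r t - y)) ^ S k
   - g t * (/ (polar r t - z)) ^ S k)%C 0 (2 * PI)).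
{ apply ex_CInt_cont; [lra|]. intros t _. apply Ccont_minus;
  (apply Ccont_mult; [apply Hg|]; apply Ccont_pow, Ccont_resolvent; lra). }
assert (X2 : ex_CInt (fun t => RtoC (INR (S k)) * (y - z)
   * (g t * (/ (polar r t - z)) ^ S (S k)))%C 0 (2 * PI)).
{ apply ex_CInt_cont; [lra|]. intros t _. apply Ccont_mult; [apply Ccont_const|].
  apply Ccont_mult; [apply Hg|]; apply Ccont_pow, Ccont_resolvent; lra. }
rewrite <- CInt_minus by assumption.
apply Rle_trans with ((2 * PI - 0) *
  (Mg * (INR (S k) ^ 2 * M ^ (S k + 2) * Cmod (y - z)%C ^ 2))).
- apply Cmod_CInt_le_const; [lra|..].
  + apply (ex_RInt_minus (V := C_R_NormedModule)); assumption.
  + intros t Ht.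
    set (a := (/ (polar r t - y))%C). set (b := (/ (polar r t - z))%C).
    replace (g t * a ^ S k - g t * b ^ S k - RtoC (INR (S k)) * (y - z) * (g t * b ^ S (S k)))%C
      with (g t * (a ^ S k - b ^ S k - RtoC (INR (S k)) * (y - z) * b ^ S (S k)))%C by ring.
    rewrite Cmod_mult. apply Rmult_le_compat; try apply Cmod_ge_0; [apply Bg, Ht|].
    apply resolvent_pow_taylor.
    * apply Cmod_resolvent_le; lra.
    * apply Cmod_resolvent_le; lra.
    * unfold a, b. field. split; apply polar_minus_neq_0; lra.
- replace ((2 * PI - 0) * (Mg * (INR (S k) ^ 2 * M ^ (S k + 2) * Cmod (y - z)%C ^ 2)))
    with (K * Cmod (y - z)%C * Cmod (y - z)%C) by (unfold K; ring).
  apply Rmult_le_compat_r; [apply Cmod_ge_0|].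
  apply (Rmult_lt_compat_l K) in Hy2; [|exact HK].
  replace (K * (eps / K)) with eps in Hy2 by (field; lra). lra.
Qed.

(** * Cauchy's formula for derivatives and removable zeros *)

Lemma polar_inD (r t : R) : 0 <= r < 1 -> inD (polar r t).
Proof. intros Hr. unfold inD. rewrite Cmod_polar; lra. Qed.

Lemma Ccont_circle (f : C -> C) (r t : R) :
  analytic_on_D f -> 0 <= r < 1 -> Ccont (fun t => f (polar r t)) t.
Proof.
intros Hf Hr. apply Ccont_comp; [apply Ccont_polar|].
apply analytic_Ccont; [exact Hf|apply polar_inD, Hr].
Qed.

(** The factor [polar r t] comes from d zeta = i zeta dt; the i cancels against the 2 pi i of
    Cauchy's formula. *)
Definition circle_weight (f : C -> C) (r : R) : R -> C :=
  fun t => (f (polar r t) * polar r t)%C.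

Lemma Ccont_circle_weight (f : C -> C) (r t : R) :
  analytic_on_D f -> 0 <= r < 1 -> Ccont (circle_weight f r) t.
Proof. intros Hf Hr. apply Ccont_mult; [apply Ccont_circle; assumption|apply Ccont_polar]. Qed.

Lemma RtoC_two_pi_neq_0 : RtoC (2 * PI) <> RtoC 0.
Proof. intros E. apply RtoC_inj in E. pose proof two_pi_pos. lra. Qed.

Lemma cauchy_formula (f : C -> C) (r : R) (z : C) :
  analytic_on_D f -> Cmod z < r -> r < 1 ->
  f z = (/ RtoC (2 * PI) * cauchy_transform r (circle_weight f r) 0 z)%C.
Proof.
intros Hf Hz Hr. pose proof RtoC_two_pi_neq_0 as HP.
pose proof (cauchy_unnormalized z r Hz Hr f Hf) as H.
rewrite CInt_cauchy_kernel in H by exact Hz.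
unfold cauchy_transform.
rewrite (CInt_ext _ (fun t => polar r t / (polar r t - z) * f (polar r t))%C).
- rewrite H. field. exact HP.
- apply Rlt_le, two_pi_pos.
- intros t _. unfold circle_weight. rewrite Cpow_S. unfold Cdiv.
  change ((/ (polar r t - z)) ^ 0)%C with (RtoC 1). ring.
Qed.

Lemma disk_nbhd (z : C) (r : R) :
  Cmod z < r -> exists d, 0 < d /\ forall y, Cmod (y - z)%C < d -> Cmod y < r.
Proof.
intros Hz. exists (r - Cmod z). split; [lra|]. intros y Hy.
replace y with ((y - z) + z)%C by ring. pose proof (Cmod_triangle (y - z)%C z). lra.
Qed.

Lemma cderiv_n_cauchy (f : C -> C) (r : R) (k : nat) (z : C) :
  analytic_on_D f -> Cmod z < r -> r < 1 ->
  cderiv_n k f z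
  = (RtoC (INR (fact k)) * / RtoC (2 * PI) * cauchy_transform r (circle_weight f r) k z)%C.
Proof.
intros Hf Hz Hr. revert z Hz. induction k as [|k IH]; intros z Hz.
- simpl. rewrite (cauchy_formula f r z) by assumption. simpl. ring.
- assert (Hr0 : 0 <= r < 1) by (pose proof (Cmod_ge_0 z); lra).
  change (cderiv_n (S k) f z) with (cderiv (cderiv_n k f) z).
  apply cderiv_eq. destruct (disk_nbhd z r Hz) as [d [Hd Hb]].
  apply (is_cder_ext_loc (fun z => RtoC (INR (fact k)) * / RtoC (2 * PI)
    * cauchy_transform r (circle_weight f r) k z)%C _ z _ d Hd).
  { intros y Hy. symmetry. apply IH, Hb, Hy. }
  replace (RtoC (INR (fact (S k))) * / RtoC (2 * PI)
     * cauchy_transform r (circle_weight f r) (S k) z)%C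
    with (RtoC (INR (fact k)) * / RtoC (2 * PI) * (RtoC (INR (S k))
     * cauchy_transform r (circle_weight f r) (S k) z))%C.
  + apply is_cder_scal, is_cder_cauchy_transform; [|exact Hz].
    intros t. apply Ccont_circle_weight; assumption.
  + rewrite fact_simpl, mult_INR, (RtoC_mult (INR (S k))). ring.
Qed.

(** One circle reaches only the points inside it, so a representation is required for every radius
    near 1, with a density that may depend on the radius; at [z] one takes a radius between the
    larger of [r0] and [Cmod z], and 1. *)
Lemma analytic_cauchy_transform (f : C -> C) (g : R -> R -> C) (k : nat) (c : C) (r0 : R) :
  (forall r t, r0 < r < 1 -> Ccont (g r) t) ->
  (forall r z, r0 < r < 1 -> Cmod z < r -> f z = (c * cauchy_transform r (g r) k z)%C) ->
  0 <= r0 < 1 -> analytic_on_D f.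
Proof.
intros Hg H Hr0 z Hz. unfold inD in Hz.
set (r := (1 + Rmax r0 (Cmod z)) / 2).
assert (Hm : Rmax r0 (Cmod z) < 1) by (apply Rmax_lub_lt; lra).
pose proof (Rmax_l r0 (Cmod z)). pose proof (Rmax_r r0 (Cmod z)).
assert (Hr : r0 < r < 1) by (unfold r; lra).
assert (Hzr : Cmod z < r) by (unfold r; lra).
exists (c * (RtoC (INR (S k)) * cauchy_transform r (g r) (S k) z))%C.
destruct (disk_nbhd z r Hzr) as [d [Hd Hb]].
apply (is_cder_ext_loc (fun z => c * cauchy_transform r (g r) k z)%C _ z _ d Hd).
{ intros y Hy. symmetry. apply H; [exact Hr|apply Hb, Hy]. }
apply is_cder_scal, is_cder_cauchy_transform; [|exact Hzr]. intros t. apply Hg, Hr.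
Qed.

Lemma analytic_cderiv_n (f : C -> C) (k : nat) :
  analytic_on_D f -> analytic_on_D (cderiv_n k f).
Proof.
intros Hf. apply (analytic_cauchy_transform (cderiv_n k f) (circle_weight f) k
  (RtoC (INR (fact k)) * / RtoC (2 * PI))%C 0).
- intros r t Hr. apply Ccont_circle_weight; [exact Hf|lra].
- intros r z Hr Hz. apply cderiv_n_cauchy; [exact Hf|exact Hz|lra].
- lra.
Qed.

Lemma analytic_cderiv (f : C -> C) : analytic_on_D f -> analytic_on_D (cderiv f).
Proof. exact (analytic_cderiv_n f 1). Qed.

(** Removable singularity: subtracting Cauchy's formulas at [z] and [w] shows that the slope is a
    Cauchy transform with density divided by [polar r t - w]. At [z = w] the same integral is the
    formula for the first derivative. *)
Lemma analytic_slope (f : C -> C) (w : C) :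
  analytic_on_D f -> inD w -> analytic_on_D (slope f w (cderiv f w)).
Proof.
intros Hf Hw. pose proof RtoC_two_pi_neq_0 as HP.
apply (analytic_cauchy_transform _ (fun r t => circle_weight f r t * / (polar r t - w))%C 0
  (/ RtoC (2 * PI))%C (Cmod w)).
- intros r t Hr. pose proof (Cmod_ge_0 w).
  apply Ccont_mult; [apply Ccont_circle_weight; [exact Hf|lra]|].
  apply Ccont_resolvent. lra.
- intros r z Hr Hz. pose proof (Cmod_ge_0 w).
  assert (Hc : forall t, Ccont (circle_weight f r) t)
    by (intros t; apply Ccont_circle_weight; [exact Hf|lra]).
  unfold slope. destruct (excluded_middle_informative (z = w)) as [->|n].
  + change (cderiv f w) with (cderiv_n 1 f w).
    rewrite (cderiv_n_cauchy f r 1 w) by (auto; lra).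
    simpl fact. simpl INR.
    replace (RtoC 1 * / RtoC (2 * PI) * cauchy_transform r (circle_weight f r) 1 w)%C
      with (/ RtoC (2 * PI) * cauchy_transform r (circle_weight f r) 1 w)%C by ring.
    f_equal. unfold cauchy_transform. apply CInt_ext; [apply Rlt_le, two_pi_pos|].
    intros t _. rewrite !Cpow_S. ring.
  + rewrite (cauchy_formula f r z), (cauchy_formula f r w) by (auto; lra).
    assert (Hzw : (z - w)%C <> RtoC 0) by (intros E; apply n, Cminus_eq_0, E).
    replace (/ RtoC (2 * PI) * cauchy_transform r (circle_weight f r) 0 z
      - / RtoC (2 * PI) * cauchy_transform r (circle_weight f r) 0 w)%C
      with (/ RtoC (2 * PI) * (cauchy_transform r (circle_weight f r) 0 z
      - cauchy_transform r (circle_weight f r) 0 w))%C by ring.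
    unfold Cdiv. rewrite <- Cmult_assoc. f_equal.
    unfold cauchy_transform.
    rewrite <- CInt_minus by (apply ex_cauchy_transform; auto; lra).
    rewrite (CInt_ext _ (fun t => (z - w) * (circle_weight f r t * / (polar r t - w)
      * (/ (polar r t - z)) ^ 1))%C).
    * rewrite CInt_scal; [field; exact Hzw|].
      apply (ex_cauchy_transform r (fun t => circle_weight f r t * / (polar r t - w))%C 1 z);
      [|exact Hz].
      intros t. apply Ccont_mult; [apply Hc|apply Ccont_resolvent; lra].
    * apply Rlt_le, two_pi_pos.
    * intros t _. rewrite !Cpow_1_r. field.
      split; apply polar_minus_neq_0; lra.
- unfold inD in Hw. pose proof (Cmod_ge_0 w). lra.
Qed.

Lemma factor_zero (f : C -> C) (w : C) :
  analytic_on_D f -> inD w ->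
  exists q, analytic_on_D q /\ q w = cderiv f w /\ forall z, f z = (f w + (z - w) * q z)%C.
Proof.
intros Hf Hw. exists (slope f w (cderiv f w)).
split; [apply analytic_slope; assumption|]. split; [apply slope_eq|].
intros z. pose proof (slope_mult f w (cderiv f w) z) as K.
replace (f z) with (f w + (f z - f w))%C by ring. rewrite K. ring.
Qed.

(** The Cauchy-Schwarz inequality in integrated form, from the pointwise bound m <= eta / 2 + m^2 /
    (2 eta). *)
Lemma circle_mean_sqrt_bound (f : C -> C) (r eta : R) :
  analytic_on_D f -> 0 <= r < 1 -> 0 < eta -> circ_mean2 f r <= eta ^ 2 ->
  RInt (fun t => Cmod (f (polar r t))) 0 (2 * PI) <= 2 * PI * eta.
Proof.
intros Hf Hr He H. pose proof two_pi_pos as HP.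
assert (Cm : forall t, continuous (fun t => Cmod (f (polar r t))) t)
  by (intros t; apply Ccont_Cmod, Ccont_circle; assumption).
assert (E1 : ex_RInt (fun t => Cmod (f (polar r t))) 0 (2 * PI))
  by (apply (ex_RInt_continuous (V := R_CompleteNormedModule)); auto).
assert (E2 : ex_RInt (fun t => Cmod (f (polar r t)) ^ 2) 0 (2 * PI)).
{ apply (ex_RInt_continuous (V := R_CompleteNormedModule)). intros t _. apply continuous_sqr, Cm. }
unfold circ_mean2 in H.
set (I := RInt (fun t => Cmod (f (polar r t)) ^ 2) 0 (2 * PI)) in *.
assert (HI : I <= 2 * PI * eta ^ 2).
{ apply (Rmult_le_compat_l (2 * PI)) in H; [|lra].
  rewrite <- Rmult_assoc, Rinv_r, Rmult_1_l in H by lra. exact H. }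
assert (E3 : ex_RInt (fun t => eta / 2) 0 (2 * PI)) by apply ex_RInt_const.
assert (E4 : ex_RInt (fun t => / (2 * eta) * Cmod (f (polar r t)) ^ 2) 0 (2 * PI))
  by (apply (ex_RInt_scal (V := R_NormedModule)); exact E2).
apply Rle_trans with (RInt (fun t => eta / 2 + / (2 * eta) * Cmod (f (polar r t)) ^ 2) 0 (2 * PI)).
- apply RInt_le; [lra|exact E1|apply (ex_RInt_plus (V := R_NormedModule)); assumption|].
  intros t _. set (m := Cmod _).
  apply Rmult_le_reg_l with (2 * eta); [lra|].
  replace (2 * eta * (eta / 2 + / (2 * eta) * m ^ 2)) with (eta ^ 2 + m ^ 2) by (field; lra).
  pose proof (pow2_ge_0 (eta - m)). nra.
- rewrite (RInt_plus (V := R_CompleteNormedModule) (fun _ => eta / 2)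
    (fun t => / (2 * eta) * Cmod (f (polar r t)) ^ 2)) by assumption.
  rewrite (RInt_scal (V := R_CompleteNormedModule) (fun t => Cmod (f (polar r t)) ^ 2)) by exact E2.
  rewrite (RInt_const (V := R_CompleteNormedModule)). fold I.
  change (plus (scal (2 * PI - 0) (eta / 2)) (scal (/ (2 * eta)) I))
    with ((2 * PI - 0) * (eta / 2) + / (2 * eta) * I).
  assert (/ (2 * eta) * I <= / (2 * eta) * (2 * PI * eta ^ 2)).
  { apply Rmult_le_compat_l; [|exact HI]. left. apply Rinv_0_lt_compat. lra. }
  replace (/ (2 * eta) * (2 * PI * eta ^ 2)) with (PI * eta) in H0 by (field; lra). lra.
Qed.

Lemma cderiv_n_mean_bound (f : C -> C) (rho r eta : R) (k : nat) (z : C) :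
  analytic_on_D f -> Cmod z <= rho -> rho < r -> r < 1 -> 0 < eta -> circ_mean2 f r <= eta ^ 2 ->
  Cmod (cderiv_n k f z) <= INR (fact k) * (/ (r - rho)) ^ S k * eta.
Proof.
intros Hf Hz Hrho Hr He H. pose proof two_pi_pos as HP. pose proof (Cmod_ge_0 z) as Hz0.
assert (Hc : forall t, Ccont (circle_weight f r) t)
  by (intros t; apply Ccont_circle_weight; [exact Hf|lra]).
rewrite (cderiv_n_cauchy f r k z) by (auto; lra).
rewrite !Cmod_mult, Cmod_inv, !Cmod_R by apply RtoC_two_pi_neq_0.
rewrite (Rabs_pos_eq (2 * PI)), (Rabs_pos_eq (INR _)) by (try apply pos_INR; lra).
set (P := (/ (r - rho)) ^ S k).
assert (HP0 : 0 < / (r - rho)) by (apply Rinv_0_lt_compat; lra).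
assert (HPp : 0 < P) by (apply pow_lt, HP0).
assert (Cm : forall t, continuous (fun t => Cmod (f (polar r t))) t)
  by (intros t; apply Ccont_Cmod, Ccont_circle; [exact Hf|lra]).
assert (E1 : ex_RInt (fun t => Cmod (f (polar r t))) 0 (2 * PI))
  by (apply (ex_RInt_continuous (V := R_CompleteNormedModule)); auto).
assert (B : Cmod (cauchy_transform r (circle_weight f r) k z)
  <= P * RInt (fun t => Cmod (f (polar r t))) 0 (2 * PI)).
{ unfold cauchy_transform.
  replace (P * RInt (fun t => Cmod (f (polar r t))) 0 (2 * PI))
    with (RInt (fun t => P * Cmod (f (polar r t))) 0 (2 * PI))
    by (apply (RInt_scal (V := R_CompleteNormedModule) (fun t => Cmod (f (polar r t)))); exact E1).
  apply Cmod_CInt_le; [lra|apply ex_cauchy_transform; auto; lra|..].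
  - apply (ex_RInt_scal (V := R_NormedModule)), E1.
  - intros t _. unfold circle_weight. rewrite !Cmod_mult, Cmod_pow, Cmod_polar by lra.
    pose proof (Cmod_ge_0 (f (polar r t))).
    assert (Cmod (/ (polar r t - z))%C ^ S k <= P).
    { apply pow_incr. split; [apply Cmod_ge_0|]. apply Cmod_resolvent_le; lra. }
    assert (0 <= Cmod (/ (polar r t - z))%C ^ S k) by (apply pow_le, Cmod_ge_0).
    rewrite (Rmult_comm P). apply Rmult_le_compat; nra. }
pose proof (circle_mean_sqrt_bound f r eta Hf ltac:(lra) He H) as M.
assert (B2 : Cmod (cauchy_transform r (circle_weight f r) k z) <= P * (2 * PI * eta)).
{ apply Rle_trans with (1 := B). apply Rmult_le_compat_l; lra. }
rewrite !Rmult_assoc. apply Rmult_le_compat_l; [apply pos_INR|].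
apply Rmult_le_reg_l with (2 * PI); [exact HP|].
rewrite <- Rmult_assoc, Rinv_r, Rmult_1_l by lra. lra.
Qed.

(** * Orders of vanishing at the fixed point *)

Lemma cderiv_n_ext (f g : C -> C) (k : nat) (z : C) :
  analytic_on_D f -> (forall y, inD y -> f y = g y) -> inD z -> cderiv_n k f z = cderiv_n k g z.
Proof.
intros Hf E. revert z. induction k as [|k IH]; intros z Hz; [apply E, Hz|].
symmetry. apply cderiv_eq. apply (is_cder_ext_D (cderiv_n k f)); [exact Hz|exact IH|].
apply is_cder_cderiv; [apply analytic_cderiv_n, Hf|exact Hz].
Qed.

Lemma cderiv_n_lin (a b : C) (f g : C -> C) (k : nat) (z : C) :
  analytic_on_D f -> analytic_on_D g -> inD z ->
  cderiv_n k (fun y => a * f y + b * g y)%C z = (a * cderiv_n k f z + b * cderiv_n k g z)%C.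
Proof.
intros Hf Hg. revert z. induction k as [|k IH]; intros z Hz; [reflexivity|].
apply cderiv_eq.
apply (is_cder_ext_D (fun y => a * cderiv_n k f y + b * cderiv_n k g y)%C); [exact Hz|..].
- intros y Hy. symmetry. apply IH, Hy.
- apply is_cder_plus; apply is_cder_scal, is_cder_cderiv; auto; apply analytic_cderiv_n; assumption.
Qed.

(** The cofactor is kept explicit because [h w] is the Taylor coefficient of order [m] of [f] at
    [w]. The identity is confined to the disc, as values outside it carry no meaning. *)
Definition factors (w : C) (m : nat) (f h : C -> C) : Prop :=
  analytic_on_D h /\ forall z, inD z -> f z = ((z - w) ^ m * h z)%C.

Definition vanishes (w : C) (m : nat) (f : C -> C) : Prop := exists h, factors w m f h.

Lemma analytic_monomial (w : C) (m : nat) : analytic_on_D (fun z => (z - w) ^ m)%C.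
Proof.
apply (analytic_pow (fun z => z - w)%C).
apply analytic_minus; [apply analytic_id|apply analytic_const].
Qed.

Lemma factors_analytic (w : C) (m : nat) (f h : C -> C) : factors w m f h -> analytic_on_D f.
Proof.
intros [Hh E]. apply (analytic_ext (fun z => (z - w) ^ m * h z)%C).
- intros y Hy. symmetry. apply E, Hy.
- apply analytic_mult; [apply analytic_monomial|exact Hh].
Qed.

Lemma factors_lin (w : C) (m : nat) (a b : C) (f g h k : C -> C) :
  factors w m f h -> factors w m g k ->
  factors w m (fun z => a * f z + b * g z)%C (fun z => a * h z + b * k z)%C.
Proof.
intros [Hh Eh] [Hk Ek]. split.
- apply analytic_plus; apply analytic_scal; assumption.
- intros z Hz. rewrite Eh, Ek by exact Hz. ring.
Qed.

Lemma factors_weaken (w : C) (m j : nat) (f h : C -> C) :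
  factors w (j + m) f h -> factors w m f (fun z => (z - w) ^ j * h z)%C.
Proof.
intros [Hh E]. split.
- apply analytic_mult; [apply analytic_monomial|exact Hh].
- intros z Hz. rewrite E, Cpow_add_r by exact Hz. ring.
Qed.

Lemma vanishes_le (w : C) (m j : nat) (f : C -> C) :
  (j <= m)%nat -> vanishes w m f -> vanishes w j f.
Proof.
intros Hj [h Hh]. exists (fun z => (z - w) ^ (m - j) * h z)%C.
apply factors_weaken. now replace (m - j + j)%nat with m by lia.
Qed.

Lemma factors_leading_zero (w : C) (m : nat) (f h : C -> C) :
  inD w -> factors w m f h -> h w = RtoC 0 -> vanishes w (S m) f.
Proof.
intros Hw [Hh E] H0. destruct (factor_zero h w Hh Hw) as [q [Hq [_ Eq]]].
exists q. split; [exact Hq|]. intros z Hz. rewrite E, Eq, H0, Cpow_S by exact Hz. ring.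
Qed.

Lemma is_cder_monomial (w z : C) (m : nat) :
  is_cder (fun z => (z - w) ^ S m)%C z (RtoC (INR (S m)) * (z - w) ^ m)%C.
Proof.
assert (H1 : is_cder (fun z => z - w)%C z (RtoC 1)).
{ replace (RtoC 1) with (1 + 0)%C by ring.
  apply (is_cder_plus (fun z => z) (fun _ => - w)%C); [apply is_cder_id|apply is_cder_const]. }
induction m as [|m IH].
- replace (RtoC (INR 1) * (z - w) ^ 0)%C with (RtoC 1) by (simpl; ring).
  apply (is_cder_ext_loc (fun z => z - w)%C _ z _ 1); [lra| |exact H1].
  intros y _. rewrite Cpow_1_r. reflexivity.
- replace (RtoC (INR (S (S m))) * (z - w) ^ S m)%C
    with (1 * (z - w) ^ S m + (z - w) * (RtoC (INR (S m)) * (z - w) ^ m))%C.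
  + apply (is_cder_mult (fun z => z - w)%C (fun z => (z - w) ^ S m)%C); assumption.
  + rewrite (S_INR (S m)), RtoC_plus, Cpow_S. ring.
Qed.

Lemma factors_cderiv (w : C) (m : nat) (f h : C -> C) :
  factors w (S m) f h ->
  exists k, factors w m (cderiv f) k /\ k w = (RtoC (INR (S m)) * h w)%C.
Proof.
intros [Hh E].
exists (fun z => RtoC (INR (S m)) * h z + (z - w) * cderiv h z)%C. split; [split|].
- apply analytic_plus; [apply analytic_scal, Hh|].
  apply analytic_mult; [|apply analytic_cderiv, Hh].
  apply analytic_minus; [apply analytic_id|apply analytic_const].
- intros z Hz. apply cderiv_eq.
  apply (is_cder_ext_D (fun z => (z - w) ^ S m * h z)%C); [exact Hz|..].
  { intros y Hy. symmetry. apply E, Hy. }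
  replace ((z - w) ^ m * (RtoC (INR (S m)) * h z + (z - w) * cderiv h z))%C
    with (RtoC (INR (S m)) * (z - w) ^ m * h z + (z - w) ^ S m * cderiv h z)%C
    by (rewrite Cpow_S; ring).
  apply (is_cder_mult (fun z => (z - w) ^ S m)%C h); [apply is_cder_monomial|].
  apply is_cder_cderiv; assumption.
- ring.
Qed.

Lemma factors_cderiv_n (w : C) (m n : nat) (f h : C -> C) :
  (n <= m)%nat -> factors w m f h ->
  exists k, factors w (m - n) (cderiv_n n f) k /\
    (RtoC (INR (fact (m - n))) * k w = RtoC (INR (fact m)) * h w)%C.
Proof.
intros Hn Hf. induction n as [|n IH].
- exists h. rewrite Nat.sub_0_r. split; [exact Hf|reflexivity].
- destruct (IH ltac:(lia)) as [k [Hk Ek]].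
  replace (m - n)%nat with (S (m - S n)) in Hk, Ek by lia.
  destruct (factors_cderiv w _ _ _ Hk) as [k' [Hk' Ek']].
  exists k'. split; [exact Hk'|]. rewrite Ek', <- Ek, fact_simpl, mult_INR, RtoC_mult. ring.
Qed.

Lemma factors_cderiv_n_at (w : C) (m : nat) (f h : C -> C) :
  inD w -> factors w m f h -> cderiv_n m f w = (RtoC (INR (fact m)) * h w)%C.
Proof.
intros Hw Hf. destruct (factors_cderiv_n w m m f h (Nat.le_refl m) Hf) as [k [[_ Hk] Ek]].
rewrite Nat.sub_diag in Hk, Ek. rewrite Hk, <- Ek by exact Hw. simpl. ring.
Qed.

(** Needed to read the hypothesis on [psi] and to pass orders of vanishing to limits. Conversely to
    Leibniz's rule, each vanishing derivative kills the current leading coefficient and frees one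
    more factor. *)
Lemma vanishes_cderiv_n (w : C) (m : nat) (f : C -> C) :
  analytic_on_D f -> inD w ->
  (vanishes w m f <-> forall j, (j < m)%nat -> cderiv_n j f w = RtoC 0).
Proof.
intros Hf Hw. split.
- intros Hv j Hj. destruct (vanishes_le w m (S j) f ltac:(lia) Hv) as [h Hh].
  rewrite (factors_cderiv_n_at w j f _ Hw (factors_weaken w j 1 f h Hh)).
  replace (w - w)%C with (RtoC 0) by ring. simpl. ring.
- induction m as [|m IH]; intros H.
  + exists f. split; [exact Hf|]. intros z _. simpl. ring.
  + destruct IH as [h Hh]; [intros j Hj; apply H; lia|].
    apply (factors_leading_zero w m f h Hw Hh).
    pose proof (factors_cderiv_n_at w m f h Hw Hh) as K. rewrite H in K by lia.
    destruct (Ceq_dec (h w) (RtoC 0)) as [e|n]; [exact e|].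
    exfalso. symmetry in K. revert K. apply Cmult_neq_0; [|exact n].
    intros E. apply RtoC_inj in E. exact (INR_fact_neq_0 m E).
Qed.

(** * Blaschke factors and the identity theorem *)

Lemma Cmod_sqr (a : C) : Cmod a ^ 2 = fst a ^ 2 + snd a ^ 2.
Proof. apply Cmod2_alt. Qed.

(** For [w] in the disc, it shows that the Blaschke factor (z - w) / (1 - conj(w) z) has modulus
    less than 1 inside the disc, tending to 1 at the boundary. *)
Lemma blaschke_identity (w z : C) :
  Cmod (1 - Cconj w * z)%C ^ 2 - Cmod (z - w)%C ^ 2 = (1 - Cmod z ^ 2) * (1 - Cmod w ^ 2).
Proof.
rewrite !Cmod_sqr. destruct w as [a b], z as [x y]. simpl. ring.
Qed.

Lemma Cmod_one_minus_conj (w z : C) :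
  1 - Cmod w * Cmod z <= Cmod (1 - Cconj w * z)%C <= 1 + Cmod w * Cmod z.
Proof.
rewrite <- (Cmod_conj w), <- Cmod_mult. split.
- pose proof (Cmod_minus_ge 1 (Cconj w * z)%C) as K. rewrite Cmod_1 in K. exact K.
- unfold Cminus. pose proof (Cmod_triangle 1 (- (Cconj w * z))%C) as K.
  rewrite Cmod_1, Cmod_opp in K. exact K.
Qed.

(** A weak maximum principle straight from Cauchy's formula. The lost factor [/ (r - Cmod z)] does
    not depend on [f], so it cannot spoil a geometric decay obtained from a sequence of
    functions. *)
Lemma maximum_bound (f : C -> C) (z : C) (r M : R) :
  analytic_on_D f -> Cmod z < r -> r < 1 -> 0 <= M ->
  (forall t, 0 <= t <= 2 * PI -> Cmod (f (polar r t)) <= M) -> Cmod (f z) <= M / (r - Cmod z).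
Proof.
intros Hf Hz Hr HM H. pose proof two_pi_pos as HP. pose proof (Cmod_ge_0 z).
rewrite (cauchy_formula f r z) by assumption.
rewrite Cmod_mult, Cmod_inv, Cmod_R, Rabs_pos_eq by (apply RtoC_two_pi_neq_0 || lra).
apply Rmult_le_reg_l with (2 * PI); [exact HP|].
rewrite <- Rmult_assoc, Rinv_r, Rmult_1_l by lra.
replace (2 * PI * (M / (r - Cmod z))) with ((2 * PI - 0) * (M * / (r - Cmod z)))
  by (unfold Rdiv; ring).
apply Cmod_CInt_le_const; [lra|apply ex_cauchy_transform; auto|].
- intros t. apply Ccont_circle_weight; [exact Hf|lra].
- intros t Ht. rewrite Cpow_1_r, Cmod_mult.
  apply Rmult_le_compat; try apply Cmod_ge_0.
  + unfold circle_weight. rewrite Cmod_mult, Cmod_polar by lra.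
    specialize (H t Ht). pose proof (Cmod_ge_0 (f (polar r t))). nra.
  + apply Cmod_resolvent_le; lra.
Qed.

(* Compare [f] with powers of the Blaschke factor of [w], whose modulus tends to 1 at the
   boundary but is a fixed number < 1 at [z]. *)
Lemma identity_theorem (f : C -> C) (w : C) :
  analytic_on_D f -> inD w -> (forall m, vanishes w m f) -> forall z, inD z -> f z = RtoC 0.
Proof.
intros Hf Hw H z Hz.
pose proof (Cmod_ge_0 z) as Hz0. pose proof (Cmod_ge_0 w) as Hw0. unfold inD in Hw, Hz.
set (a := Cmod (z - w)%C). set (b := Cmod (1 - Cconj w * z)%C).
pose proof (blaschke_identity w z) as Bz. fold a b in Bz.
assert (Ha : 0 <= a) by apply Cmod_ge_0.
assert (Hb : 0 < b).
{ pose proof (Cmod_one_minus_conj w z) as L. fold b in L.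
  assert (Cmod w * Cmod z <= 1 * Cmod z) by (apply Rmult_le_compat_r; lra). lra. }
assert (Hab : a < b).
{ assert (0 < (1 - Cmod z ^ 2) * (1 - Cmod w ^ 2)) by (apply Rmult_lt_0_compat; nra).
  apply Rnot_le_lt. intros Hba. assert (b ^ 2 <= a ^ 2) by (apply pow_incr; lra). lra. }
(* [a / b] is the modulus of the Blaschke factor at [z]; the midpoint [q] is still larger, yet below
   1, hence attainable as a lower bound on a large circle. *)
set (q := (a / b + 1) / 2).
assert (Haq : a / b < 1) by (apply Rlt_div_l; lra).
assert (Ha0 : 0 <= a / b) by (apply Rdiv_le_0_compat; lra).
(* By [blaschke_identity] and [1 - Cmod w <= Cmod (1 - Cconj w * polar r t)], the factor has modulus
   at least [q] on the circle as soon as [1 - r ^ 2 <= s]. *)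
set (s := (1 - q ^ 2) * (1 - Cmod w) ^ 2 / (1 - Cmod w ^ 2)).
assert (Hq : a / b < q < 1) by (unfold q; lra).
assert (Hs : 0 < s).
{ apply Rdiv_lt_0_compat; [|nra]. apply Rmult_lt_0_compat; [nra|]. apply pow_lt. lra. }
set (r := Rmax ((1 + Cmod z) / 2) (1 - s / 2)).
assert (Hr1 : r < 1) by (apply Rmax_lub_lt; lra).
assert (Hrz : Cmod z < r) by (pose proof (Rmax_l ((1 + Cmod z) / 2) (1 - s / 2)); unfold r; lra).
assert (Hrs : 1 - r ^ 2 <= s)
  by (pose proof (Rmax_r ((1 + Cmod z) / 2) (1 - s / 2)) as L; fold r in L; nra).
assert (Bdry : forall t, q * Cmod (1 - Cconj w * polar r t)%C <= Cmod (polar r t - w)%C).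
{ intros t. pose proof (blaschke_identity w (polar r t)) as B.
  rewrite Cmod_polar in B by lra.
  pose proof (Cmod_one_minus_conj w (polar r t)) as L. rewrite Cmod_polar in L by lra.
  set (u := Cmod (1 - Cconj w * polar r t)%C) in *.
  set (v := Cmod (polar r t - w)%C) in *.
  assert (Hv : 0 <= v) by apply Cmod_ge_0.
  assert (Cmod w * r <= Cmod w * 1) by (apply Rmult_le_compat_l; lra).
  assert (Hu : 1 - Cmod w <= u) by lra.
  assert (Hu2 : (1 - Cmod w) ^ 2 <= u ^ 2) by (apply pow_incr; lra).
  assert (S1 : (1 - r ^ 2) * (1 - Cmod w ^ 2) <= s * (1 - Cmod w ^ 2))
    by (apply Rmult_le_compat_r; nra).
  assert (S2 : s * (1 - Cmod w ^ 2) = (1 - q ^ 2) * (1 - Cmod w) ^ 2)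
    by (unfold s; field; nra).
  assert (S3 : (1 - q ^ 2) * (1 - Cmod w) ^ 2 <= (1 - q ^ 2) * u ^ 2)
    by (apply Rmult_le_compat_l; nra).
  apply Rsqr_incr_0_var; [|exact Hv]. unfold Rsqr. nra. }
destruct (continuous_bounded (fun t => f (polar r t)) 0 (2 * PI)) as [M [HM HMb]].
{ apply Rlt_le, two_pi_pos. }
{ intros t. apply Ccont_circle; [exact Hf|lra]. }
assert (Ha' : 0 <= a / b / q) by (apply Rdiv_le_0_compat; lra).
assert (Ha1 : a / b / q < 1) by (apply Rlt_div_l; lra).
assert (Bound : forall m, Cmod (f z) <= M / (r - Cmod z) * (a / b / q) ^ m).
{ intros m. destruct (H m) as [h [Hh E]].
  (* This is [f] divided by the [m]-th power of the Blaschke factor, with the zero at [w]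
     cancelled. *)
  set (g := fun y => ((1 - Cconj w * y) ^ m * h y)%C).
  assert (Hg : analytic_on_D g).
  { apply analytic_mult; [|exact Hh]. apply (analytic_pow (fun y => 1 - Cconj w * y)%C).
    apply analytic_minus; [apply analytic_const|apply analytic_scal, analytic_id]. }
  assert (Hqm : 0 < q ^ m) by (apply pow_lt; lra).
  assert (Bg : Cmod (g z) <= M / q ^ m / (r - Cmod z)).
  { apply maximum_bound; [exact Hg|exact Hrz|exact Hr1|apply Rdiv_le_0_compat; lra|].
    intros t Ht. apply Rle_div_r; [exact Hqm|].
    apply Rle_trans with (2 := HMb t Ht). rewrite E by (apply polar_inD; lra).
    unfold g. rewrite !Cmod_mult, !Cmod_pow.
    replace (Cmod (1 - Cconj w * polar r t)%C ^ m * Cmod (h (polar r t)) * q ^ m)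
      with ((q * Cmod (1 - Cconj w * polar r t)%C) ^ m * Cmod (h (polar r t)))
      by (rewrite Rpow_mult_distr; ring).
    apply Rmult_le_compat_r; [apply Cmod_ge_0|]. apply pow_incr. split; [|apply Bdry].
    apply Rmult_le_pos; [lra|apply Cmod_ge_0]. }
  rewrite E by exact Hz. unfold g in Bg. rewrite Cmod_mult, Cmod_pow in Bg |- *.
  fold a. fold b in Bg.
  unfold Rdiv at 2 3. rewrite !Rpow_mult_distr, !pow_inv.
  assert (Hbm : 0 < b ^ m) by (apply pow_lt, Hb).
  assert (Ham : 0 <= a ^ m) by (apply pow_le, Ha).
  replace (M / (r - Cmod z) * (a ^ m * / b ^ m * / q ^ m))
    with (a ^ m * / b ^ m * (M / q ^ m / (r - Cmod z))) by (field; lra).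
  rewrite (Rmult_assoc (a ^ m)). apply Rmult_le_compat_l; [exact Ham|].
  apply Rmult_le_reg_l with (b ^ m); [exact Hbm|].
  rewrite <- Rmult_assoc, Rinv_r, Rmult_1_l by lra. exact Bg. }
apply Cmod_eq_0, Rle_antisym; [|apply Cmod_ge_0]. apply Rnot_lt_le. intros Hpos.
set (K := M / (r - Cmod z)) in *.
assert (HK : 0 < K) by (apply Rdiv_lt_0_compat; lra).
destruct (pow_lt_1_zero (a / b / q) ltac:(rewrite Rabs_pos_eq; lra) (Cmod (f z) / K)) as [m Hm].
{ apply Rdiv_lt_0_compat; assumption. }
specialize (Hm m (Nat.le_refl m)). rewrite Rabs_pos_eq in Hm by (apply pow_le; lra).
apply (Rmult_lt_compat_l K) in Hm; [|exact HK].
replace (K * (Cmod (f z) / K)) with (Cmod (f z)) in Hm by (field; lra).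
specialize (Bound m). lra.
Qed.

(** * Triangular action of the operator at the fixed point *)

Section Operator.

Variables (psi phi : C -> C) (n : nat) (w : C).
Hypothesis Hpsi : analytic_on_D psi.
Hypothesis Hphi : analytic_on_D phi.
Hypothesis Hself : forall z, inD z -> inD (phi z).
Hypothesis Hw : inD w.
Hypothesis Hfix : phi w = w.

Lemma analytic_Dop (f : C -> C) : analytic_on_D f -> analytic_on_D (Dop psi phi n f).
Proof.
intros Hf. apply analytic_mult; [exact Hpsi|].
apply (analytic_comp (cderiv_n n f) phi); auto. apply analytic_cderiv_n, Hf.
Qed.

Lemma Dop_lin (a b : C) (f g : C -> C) (z : C) :
  analytic_on_D f -> analytic_on_D g -> inD z ->
  Dop psi phi n (fun y => a * f y + b * g y)%C z
  = (a * Dop psi phi n f z + b * Dop psi phi n g z)%C.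
Proof.
intros Hf Hg Hz. unfold Dop. rewrite cderiv_n_lin by auto. ring.
Qed.

Lemma Dop_ext (f g : C -> C) (z : C) :
  analytic_on_D f -> (forall y, inD y -> f y = g y) -> inD z ->
  Dop psi phi n f z = Dop psi phi n g z.
Proof. intros Hf E Hz. unfold Dop. rewrite (cderiv_n_ext f g); auto. Qed.

(* Eigenvalues of the operator, read off the diagonal of its lower triangular action on
   Taylor coefficients at [w]; the test handles [m < n], where [Binomial.C m n] is not 0. *)
Definition diagonal (m : nat) : C :=
  if le_dec n m
  then (RtoC (Binomial.C m n) * cderiv_n n psi w * cderiv phi w ^ (m - n))%C
  else RtoC 0.

(** For [n <= m], differentiation lowers the order to [m - n], composition with [phi] keeps it
    because phi - w = (z - w) chi with chi(w) = phi'(w), and [psi] restores the missing [n] factors.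
    The factor m! / (m - n)! from differentiating and psi^(n)(w) = n! p(w) combine into the
    binomial. For [m < n], [psi] alone already vanishes to an order larger than [m]. *)
Lemma factors_Dop (m : nat) (f h : C -> C) :
  vanishes w n psi -> factors w m f h ->
  exists k, factors w m (Dop psi phi n f) k /\ k w = (diagonal m * h w)%C.
Proof.
intros [p Hp] Hf. pose proof (factors_cderiv_n_at w n psi p Hw Hp) as Ep.
destruct Hp as [Hp Epsi].
unfold diagonal. destruct (le_dec n m) as [Hn|Hn].
- destruct (factors_cderiv_n w m n f h Hn Hf) as [k [[Hk Ek] Ekw]].
  destruct (factor_zero phi w Hphi Hw) as [chi [Hchi [Echi Ephi]]].
  exists (fun z => p z * (chi z ^ (m - n) * k (phi z)))%C. split; [split|].
  + apply analytic_mult; [exact Hp|]. apply analytic_mult; [apply analytic_pow, Hchi|].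
    apply analytic_comp; assumption.
  + intros z Hz. unfold Dop. rewrite Epsi, Ek by auto.
    replace (phi z - w)%C with ((z - w) * chi z)%C
      by (rewrite Ephi, Hfix at 1; ring).
    rewrite Cpow_mult_l.
    replace ((z - w) ^ m)%C with ((z - w) ^ n * (z - w) ^ (m - n))%C
      by (rewrite <- Cpow_add_r; f_equal; lia).
    ring.
  + rewrite Hfix, Echi, Ep. unfold Binomial.C.
    assert (F1 : RtoC (INR (fact n)) <> RtoC 0)
      by (intros E; apply RtoC_inj in E; exact (INR_fact_neq_0 n E)).
    assert (F2 : RtoC (INR (fact (m - n))) <> RtoC 0)
      by (intros E; apply RtoC_inj in E; exact (INR_fact_neq_0 (m - n) E)).
    assert (Ekw' : k w = (RtoC (INR (fact m)) * h w / RtoC (INR (fact (m - n))))%C)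
      by (rewrite <- Ekw; field; exact F2).
    rewrite Ekw', RtoC_div, RtoC_mult.
    2: { apply Rmult_integral_contrapositive. split; apply INR_fact_neq_0. }
    field. split; assumption.
- exists (fun z => (z - w) ^ (n - m) * (p z * cderiv_n n f (phi z)))%C. split; [split|].
  + apply analytic_mult; [apply analytic_monomial|]. apply analytic_mult; [exact Hp|].
    apply (analytic_comp (cderiv_n n f) phi); auto.
    apply analytic_cderiv_n, (factors_analytic w m f h Hf).
  + intros z Hz. unfold Dop. rewrite Epsi by exact Hz.
    replace ((z - w) ^ n)%C with ((z - w) ^ m * (z - w) ^ (n - m))%C
      by (rewrite <- Cpow_add_r; f_equal; lia).
    ring.
  + replace (n - m)%nat with (S (n - m - 1)) by lia. rewrite Cpow_S.
    replace (w - w)%C with (RtoC 0) by ring. ring.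
Qed.

Lemma vanishes_Dop (m : nat) (f : C -> C) :
  vanishes w n psi -> vanishes w m f -> vanishes w m (Dop psi phi n f).
Proof.
intros Hv [h Hh]. destruct (factors_Dop m f h Hv Hh) as [k [Hk _]]. exists k. exact Hk.
Qed.

Lemma factors_Dop_minus (m : nat) (lam : C) (f h : C -> C) :
  vanishes w n psi -> factors w m f h ->
  exists k, factors w m (fun z => Dop psi phi n f z - lam * f z)%C k /\ k w = ((diagonal m - lam) * h w)%C.
Proof.
intros Hv Hf. destruct (factors_Dop m f h Hv Hf) as [k [Hk Ek]].
exists (fun z => 1 * k z + - lam * h z)%C. split.
- destruct (factors_lin w m 1 (- lam) _ _ _ _ Hk Hf) as [A B]. split; [exact A|].
  intros z Hz. rewrite <- B by exact Hz. ring.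
- rewrite Ek. ring.
Qed.

Lemma factors_unique (m : nat) (f h k : C -> C) :
  factors w m f h -> factors w m f k -> h w = k w.
Proof.
intros Hh Hk. pose proof (factors_cderiv_n_at w m f h Hw Hh) as E1.
rewrite (factors_cderiv_n_at w m f k Hw Hk) in E1.
assert (F : RtoC (INR (fact m)) <> RtoC 0)
  by (intros E; apply RtoC_inj in E; exact (INR_fact_neq_0 m E)).
replace (h w) with (/ RtoC (INR (fact m)) * (RtoC (INR (fact m)) * h w))%C by (field; exact F).
rewrite <- E1. field. exact F.
Qed.

Lemma factors_ext (m : nat) (f g h : C -> C) :
  (forall z, inD z -> f z = g z) -> factors w m f h -> factors w m g h.
Proof. intros E [A B]. split; [exact A|]. intros z Hz. rewrite <- E; auto. Qed.

(** Once [f] is known to vanish to order m, the coefficient of order m of the image is that of [f]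
    times [diagonal m - lam], a nonzero number; so both vanish together. *)
Lemma Dop_minus_vanishes (lam : C) (M : nat) (f : C -> C) :
  vanishes w n psi -> analytic_on_D f ->
  (forall m, (m < M)%nat -> diagonal m <> lam) ->
  vanishes w M (fun z => Dop psi phi n f z - lam * f z)%C -> vanishes w M f.
Proof.
intros Hv Hf Hd HS. induction M as [|M IH].
- exists f. split; [exact Hf|]. intros; simpl; ring.
- destruct IH as [h Hh]; [intros m Hm; apply Hd; lia|apply vanishes_le with (2 := HS); lia|].
  apply (factors_leading_zero w M f h Hw Hh).
  destruct (factors_Dop_minus M lam f h Hv Hh) as [k [Hk Ek]].
  destruct HS as [q Hq].
  pose proof (factors_unique M _ _ _ Hk (factors_weaken w M 1 _ q Hq)) as E.
  replace (w - w)%C with (RtoC 0) in E by ring.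
  destruct (Ceq_dec (h w) (RtoC 0)) as [e|ne]; [exact e|].
  exfalso. apply (Cmult_neq_0 (diagonal M - lam) (h w)); [|exact ne|].
  + intros E0. apply (Hd M); [lia|]. apply Cminus_eq_0, E0.
  + rewrite <- Ek, E. simpl. ring.
Qed.

(** The coefficient of order [M] is [(diagonal M - lam) * h w = 0] on the left and 1 on the
    right. *)
Lemma Dop_minus_unsolvable (lam : C) (M : nat) (f : C -> C) :
  vanishes w n psi -> diagonal M = lam -> vanishes w M f ->
  ~ (forall z, inD z -> Dop psi phi n f z - lam * f z = (z - w) ^ M)%C.
Proof.
intros Hv HM [h Hh] H.
destruct (factors_Dop_minus M lam f h Hv Hh) as [k [Hk Ek]].
assert (H1 : factors w M (fun z => Dop psi phi n f z - lam * f z)%C (fun _ => RtoC 1)).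
{ split; [apply analytic_const|]. intros z Hz. rewrite H by exact Hz. ring. }
pose proof (factors_unique M _ _ _ Hk H1) as E. rewrite Ek, HM in E.
apply C1_nz. rewrite <- E. ring.
Qed.

End Operator.

(** * The Hardy and Bergman norms *)

Lemma RInt_scal_R (f : R -> R) (c a b : R) :
  ex_RInt f a b -> RInt (fun x => c * f x) a b = c * RInt f a b.
Proof. exact (RInt_scal (V := R_CompleteNormedModule) f a b c). Qed.

Lemma ex_RInt_lin (f g : R -> R) (c d a b : R) :
  ex_RInt f a b -> ex_RInt g a b -> ex_RInt (fun x => c * f x + d * g x) a b.
Proof.
intros Hf Hg.
exact (ex_RInt_plus (V := R_NormedModule) _ _ _ _
  (ex_RInt_scal (V := R_NormedModule) f a b c Hf) (ex_RInt_scal (V := R_NormedModule) g a b d Hg)).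
Qed.

Lemma RInt_lin (f g : R -> R) (c d a b : R) :
  ex_RInt f a b -> ex_RInt g a b ->
  RInt (fun x => c * f x + d * g x) a b = c * RInt f a b + d * RInt g a b.
Proof.
intros Hf Hg. rewrite <- !RInt_scal_R by assumption.
exact (RInt_plus (V := R_CompleteNormedModule) _ _ _ _
  (ex_RInt_scal (V := R_NormedModule) f a b c Hf) (ex_RInt_scal (V := R_NormedModule) g a b d Hg)).
Qed.

Lemma Cmod_polar_abs (r t : R) : Cmod (polar r t) = Rabs r.
Proof.
replace (polar r t) with (RtoC r * polar 1 t)%C.
- rewrite Cmod_mult, Cmod_R, Cmod_polar by lra. ring.
- unfold polar, Cmult; simpl. f_equal; ring.
Qed.

Lemma polar_abs_inD (r t : R) : -1 < r < 1 -> inD (polar r t).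
Proof. intros Hr. unfold inD. rewrite Cmod_polar_abs. apply Rabs_def1; lra. Qed.

Lemma continuous_circle_sqr (f : C -> C) (r t : R) :
  analytic_on_D f -> -1 < r < 1 -> continuous (fun t => Cmod (f (polar r t)) ^ 2) t.
Proof.
intros Hf Hr. apply continuous_sqr, Ccont_Cmod.
apply Ccont_comp; [apply Ccont_polar|]. apply analytic_Ccont; [exact Hf|apply polar_abs_inD, Hr].
Qed.

Lemma ex_RInt_circle (f : C -> C) (r : R) :
  analytic_on_D f -> -1 < r < 1 -> ex_RInt (fun t => Cmod (f (polar r t)) ^ 2) 0 (2 * PI).
Proof.
intros Hf Hr. apply (ex_RInt_continuous (V := R_CompleteNormedModule)).
intros t _. apply continuous_circle_sqr; assumption.
Qed.

Lemma continuity_2d_circle (f : C -> C) (r t : R) :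
  analytic_on_D f -> -1 < r < 1 ->
  continuity_2d_pt (fun r t => Cmod (f (polar r t)) ^ 2) r t.
Proof.
intros Hf Hr. apply continuity_2d_pt_filterlim.
change (continuous (fun z : R * R => Cmod (f (polar (fst z) (snd z))) ^ 2) (r, t)).
apply continuous_sqr, Ccont_Cmod.
apply (Ccont_comp _ (fun z : R * R => polar (fst z) (snd z)) f).
- apply Ccont_pair; unfold polar; simpl fst; simpl snd; cbv beta iota;
  apply (continuous_mult (K := R_AbsRing)); try apply continuous_fst.
  + apply (continuous_comp snd cos); [apply continuous_snd|].
    apply continuity_pt_filterlim, continuity_cos.
  + apply (continuous_comp snd sin); [apply continuous_snd|].
    apply continuity_pt_filterlim, continuity_sin.
- apply analytic_Ccont; [exact Hf|apply polar_abs_inD, Hr].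
Qed.

Lemma continuous_circ_mean2 (f : C -> C) (r : R) :
  analytic_on_D f -> -1 < r < 1 -> continuous (circ_mean2 f) r.
Proof.
intros Hf Hr. pose proof two_pi_pos as HP.
intros P [eps HPe]. change (locally r (fun y => P (circ_mean2 f y))).
assert (He2 : 0 < eps / 2) by (pose proof (cond_pos eps); lra).
destruct (uniform_continuity_2d_1d' (fun r t => Cmod (f (polar r t)) ^ 2) 0 (2 * PI) r
  (fun t _ => continuity_2d_circle f r t Hf Hr) (mkposreal _ He2)) as [del Hdel].
simpl in Hdel.
assert (Hd : 0 < Rmin del (Rmin (1 - r) (1 + r)))
  by (repeat apply Rmin_pos; try lra; apply cond_pos).
exists (mkposreal _ Hd). intros y Hy.
change (Rabs (y - r) < Rmin del (Rmin (1 - r) (1 + r))) in Hy.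
assert (H1 : Rabs (y - r) < del) by (apply Rlt_le_trans with (1 := Hy), Rmin_l).
assert (H2 : Rabs (y - r) < Rmin (1 - r) (1 + r)) by (apply Rlt_le_trans with (1 := Hy), Rmin_r).
assert (H3 : Rabs (y - r) < 1 - r) by (apply Rlt_le_trans with (1 := H2), Rmin_l).
assert (H4 : Rabs (y - r) < 1 + r) by (apply Rlt_le_trans with (1 := H2), Rmin_r).
apply Rabs_def2 in H1. apply Rabs_def2 in H3. apply Rabs_def2 in H4.
apply HPe. change (Rabs (circ_mean2 f y - circ_mean2 f r) < eps).
unfold circ_mean2. rewrite <- Rmult_minus_distr_l.
pose proof (ex_RInt_circle f y Hf ltac:(lra)) as E1.
pose proof (ex_RInt_circle f r Hf Hr) as E2.
replace (RInt (fun t => Cmod (f (polar y t)) ^ 2) 0 (2 * PI)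
  - RInt (fun t => Cmod (f (polar r t)) ^ 2) 0 (2 * PI))
  with (RInt (fun t => Cmod (f (polar y t)) ^ 2 - Cmod (f (polar r t)) ^ 2) 0 (2 * PI))
  by exact (RInt_minus (V := R_CompleteNormedModule) _ _ _ _ E1 E2).
assert (B : Rabs (RInt (fun t => Cmod (f (polar y t)) ^ 2 - Cmod (f (polar r t)) ^ 2) 0 (2 * PI))
  <= (2 * PI - 0) * (eps / 2)).
{ apply abs_RInt_le_const; [lra|exact (ex_RInt_minus (V := R_NormedModule) _ _ _ _ E1 E2)|].
  intros t Ht. left. apply (Hdel t r t y); try lra.
  rewrite Rminus_diag, Rabs_R0. apply cond_pos. }
rewrite Rabs_mult, Rabs_pos_eq by (left; apply Rinv_0_lt_compat, HP).
apply Rle_lt_trans with (/ (2 * PI) * ((2 * PI - 0) * (eps / 2))).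
- apply Rmult_le_compat_l; [left; apply Rinv_0_lt_compat, HP|exact B].
- replace (/ (2 * PI) * ((2 * PI - 0) * (eps / 2))) with (eps / 2) by (field; lra).
  pose proof (cond_pos eps). lra.
Qed.

Lemma circ_mean2_ge_0 (f : C -> C) (r : R) :
  analytic_on_D f -> -1 < r < 1 -> 0 <= circ_mean2 f r.
Proof.
intros Hf Hr. pose proof two_pi_pos as HP. apply Rmult_le_pos.
- left. apply Rinv_0_lt_compat, HP.
- apply RInt_ge_0; [lra|apply ex_RInt_circle; assumption|]. intros t _. apply pow2_ge_0.
Qed.

Lemma circ_mean2_ext (f g : C -> C) (r : R) :
  (forall z, inD z -> f z = g z) -> -1 < r < 1 -> circ_mean2 f r = circ_mean2 g r.
Proof.
intros E Hr. unfold circ_mean2. f_equal. apply RInt_ext. intros t _.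
rewrite E; [reflexivity|apply polar_abs_inD, Hr].
Qed.

Lemma circ_mean2_le_bound (f : C -> C) (r M : R) :
  analytic_on_D f -> -1 < r < 1 -> (forall z, inD z -> Cmod (f z) <= M) ->
  circ_mean2 f r <= M ^ 2.
Proof.
intros Hf Hr HM. pose proof two_pi_pos as HP. unfold circ_mean2.
apply Rmult_le_reg_l with (2 * PI); [exact HP|].
rewrite <- Rmult_assoc, Rinv_r, Rmult_1_l by lra.
replace (2 * PI * M ^ 2) with (RInt (fun _ => M ^ 2) 0 (2 * PI)).
- apply RInt_le; [lra|apply ex_RInt_circle; assumption|apply ex_RInt_const|].
  intros t _. apply pow_incr. split; [apply Cmod_ge_0|]. apply HM, polar_abs_inD, Hr.
- rewrite (RInt_const (V := R_CompleteNormedModule)).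
  change ((2 * PI - 0) * M ^ 2 = 2 * PI * M ^ 2). ring.
Qed.

(** Pointwise (x + y)^2 <= 2 x^2 + 2 y^2, so that bounds on squared norms combine linearly. *)
Lemma circ_mean2_lin (a b : C) (f g : C -> C) (r : R) :
  analytic_on_D f -> analytic_on_D g -> -1 < r < 1 ->
  circ_mean2 (fun z => a * f z + b * g z)%C r
  <= 2 * Cmod a ^ 2 * circ_mean2 f r + 2 * Cmod b ^ 2 * circ_mean2 g r.
Proof.
intros Hf Hg Hr. pose proof two_pi_pos as HP.
pose proof (ex_RInt_circle f r Hf Hr) as E1. pose proof (ex_RInt_circle g r Hg Hr) as E2.
unfold circ_mean2.
replace (2 * Cmod a ^ 2 * (/ (2 * PI) * RInt (fun t => Cmod (f (polar r t)) ^ 2) 0 (2 * PI))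
  + 2 * Cmod b ^ 2 * (/ (2 * PI) * RInt (fun t => Cmod (g (polar r t)) ^ 2) 0 (2 * PI)))
  with (/ (2 * PI) * (2 * Cmod a ^ 2 * RInt (fun t => Cmod (f (polar r t)) ^ 2) 0 (2 * PI)
   + 2 * Cmod b ^ 2 * RInt (fun t => Cmod (g (polar r t)) ^ 2) 0 (2 * PI))) by ring.
apply Rmult_le_compat_l; [left; apply Rinv_0_lt_compat, HP|].
replace (2 * Cmod a ^ 2 * RInt (fun t => Cmod (f (polar r t)) ^ 2) 0 (2 * PI)
   + 2 * Cmod b ^ 2 * RInt (fun t => Cmod (g (polar r t)) ^ 2) 0 (2 * PI))
  with (RInt (fun t => 2 * Cmod a ^ 2 * Cmod (f (polar r t)) ^ 2
    + 2 * Cmod b ^ 2 * Cmod (g (polar r t)) ^ 2) 0 (2 * PI)).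
- apply RInt_le; [lra|..].
  + apply (ex_RInt_circle (fun z => a * f z + b * g z)%C); [|exact Hr].
    apply analytic_plus; apply analytic_scal; assumption.
  + apply ex_RInt_lin; assumption.
  + intros t _. set (u := f (polar r t)). set (v := g (polar r t)).
    pose proof (Cmod_triangle (a * u) (b * v)) as T. rewrite !Cmod_mult in T.
    pose proof (Cmod_ge_0 (a * u + b * v)%C).
    apply Rle_trans with ((Cmod a * Cmod u + Cmod b * Cmod v) ^ 2); [apply pow_incr; lra|].
    pose proof (pow2_ge_0 (Cmod a * Cmod u - Cmod b * Cmod v)). nra.
- apply (RInt_lin (fun t => Cmod (f (polar r t)) ^ 2) (fun t => Cmod (g (polar r t)) ^ 2)); assumption.
Qed.

Lemma circ_mean2_scal (a : C) (f : C -> C) (r : R) :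
  analytic_on_D f -> -1 < r < 1 ->
  circ_mean2 (fun z => a * f z)%C r = Cmod a ^ 2 * circ_mean2 f r.
Proof.
intros Hf Hr. unfold circ_mean2.
rewrite (RInt_ext _ (fun t => Cmod a ^ 2 * Cmod (f (polar r t)) ^ 2))
  by (intros t _; rewrite Cmod_mult, Rpow_mult_distr; reflexivity).
rewrite (RInt_scal_R (fun t => Cmod (f (polar r t)) ^ 2)) by (apply ex_RInt_circle; assumption).
ring.
Qed.

Definition bergman_weight (alpha r : R) : R := 2 * r * (alpha + 1) * Rpower (1 - r ^ 2) alpha.

Lemma continuous_bergman_weight (alpha r : R) :
  -1 < r < 1 -> continuous (bergman_weight alpha) r.
Proof.
intros Hr. unfold bergman_weight, Rpower.
apply (ex_derive_continuous (K := R_AbsRing) (V := R_NormedModule)). auto_derive. nra.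
Qed.

Lemma bergman_weight_ge_0 (alpha r : R) : -1 <= alpha -> 0 <= r -> 0 <= bergman_weight alpha r.
Proof.
intros Ha Hr. unfold bergman_weight, Rpower.
repeat apply Rmult_le_pos; try lra. left. apply exp_pos.
Qed.

(** For [alpha >= -1] the total mass is thus at most 1, whence a function bounded by [M] has squared
    norm at most [M ^ 2]. *)
Lemma RInt_bergman_weight (alpha rho : R) :
  0 <= rho < 1 ->
  RInt (bergman_weight alpha) 0 rho = 1 - Rpower (1 - rho ^ 2) (alpha + 1).
Proof.
intros Hrho. apply (is_RInt_unique (V := R_CompleteNormedModule)).
replace (1 - Rpower (1 - rho ^ 2) (alpha + 1))
  with (minus (- Rpower (1 - rho ^ 2) (alpha + 1)) (- Rpower (1 - 0 ^ 2) (alpha + 1))).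
- apply (is_RInt_derive (V := R_CompleteNormedModule) (fun r => - Rpower (1 - r ^ 2) (alpha + 1))).
  + intros x Hx. rewrite Rmin_left, Rmax_right in Hx by lra.
    assert (Hp : 0 < 1 - x ^ 2) by nra.
    assert (E : Rpower (1 - x ^ 2) (alpha + 1) = Rpower (1 - x ^ 2) alpha * (1 - x ^ 2))
      by (rewrite Rpower_plus, Rpower_1 by exact Hp; reflexivity).
    unfold bergman_weight.
    replace (2 * x * (alpha + 1) * Rpower (1 - x ^ 2) alpha)
      with (2 * x * (alpha + 1) * Rpower (1 - x ^ 2) (alpha + 1) / (1 - x ^ 2))
      by (rewrite E; field; lra).
    unfold Rpower. auto_derive; [nra|].
    replace (1 + - (x * (x * 1))) with (1 - x ^ 2) by ring. field. lra.
  + intros x Hx. rewrite Rmin_left, Rmax_right in Hx by lra.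
    apply continuous_bergman_weight. lra.
- unfold minus, plus, opp; simpl.
  replace (1 - 0 * (0 * 1)) with 1 by ring. unfold Rpower at 2. rewrite ln_1, Rmult_0_r, exp_0. ring.
Qed.

Lemma ex_RInt_bergman (alpha : R) (f : C -> C) (a b : R) :
  analytic_on_D f -> 0 <= a <= b -> b < 1 ->
  ex_RInt (fun r => bergman_weight alpha r * circ_mean2 f r) a b.
Proof.
intros Hf Hab Hb. apply (ex_RInt_continuous (V := R_CompleteNormedModule)).
intros r Hr. rewrite Rmin_left, Rmax_right in Hr by lra.
apply (continuous_mult (K := R_AbsRing)).
- apply continuous_bergman_weight. lra.
- apply continuous_circ_mean2; [exact Hf|lra].
Qed.

(** An upper bound on the extended real [Hnorm2], unfolded into real inequalities at each radius;
    the norm estimates use this form. *)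
Definition norm2_le (alpha : R) (f : C -> C) (B : R) : Prop :=
  if Req_EM_T alpha (-1) then forall r, 0 <= r < 1 -> circ_mean2 f r <= B
  else forall rho, 0 <= rho < 1 ->
    RInt (fun r => bergman_weight alpha r * circ_mean2 f r) 0 rho <= B.

Lemma Lub_Rbar_le_iff (E : R -> Prop) (B : R) :
  Rbar_le (Lub_Rbar E) B <-> forall x, E x -> x <= B.
Proof.
destruct (Lub_Rbar_correct E) as [H1 H2]. split.
- intros H x Hx. exact (Rbar_le_trans _ _ _ (H1 x Hx) H).
- intros H. apply H2. intros x Hx. apply H, Hx.
Qed.

Lemma Hnorm2_le_iff (alpha : R) (f : C -> C) (B : R) :
  Rbar_le (Hnorm2 alpha f) B <-> norm2_le alpha f B.
Proof.
unfold Hnorm2, norm2_le, hardy_norm2, bergman_norm2.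
destruct (Req_EM_T alpha (-1)); rewrite Lub_Rbar_le_iff.
- split; [intros H r Hr; apply H; now exists r|].
  intros H x [r [Hr ->]]. apply H, Hr.
- assert (E : forall rho, RInt (fun r => 2 * r * circ_mean2 f r * (alpha + 1)
      * Rpower (1 - r ^ 2) alpha) 0 rho
    = RInt (fun r => bergman_weight alpha r * circ_mean2 f r) 0 rho).
  { intros rho. apply RInt_ext. intros r _. unfold bergman_weight. simpl. ring. }
  split.
  + intros H rho Hrho. rewrite <- E. apply H. now exists rho.
  + intros H x [rho [Hrho ->]]. rewrite E. apply H, Hrho.
Qed.

Lemma inH_iff (alpha : R) (f : C -> C) :
  inH alpha f <-> analytic_on_D f /\ exists B, norm2_le alpha f B.
Proof.
unfold inH. split; intros [Hf H]; (split; [exact Hf|]).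
- destruct (Hnorm2 alpha f) as [x| |] eqn:E.
  + exists x. apply Hnorm2_le_iff. rewrite E. apply Rbar_le_refl.
  + destruct H.
  + exists 0. apply Hnorm2_le_iff. rewrite E. exact I.
- destruct H as [B HB]. apply Hnorm2_le_iff in HB.
  apply Rbar_le_lt_trans with (1 := HB). exact I.
Qed.

Lemma norm2_le_ext (alpha : R) (f g : C -> C) (B : R) :
  (forall z, inD z -> f z = g z) -> norm2_le alpha f B -> norm2_le alpha g B.
Proof.
intros E. unfold norm2_le. destruct (Req_EM_T alpha (-1)); intros H r Hr.
- rewrite <- (circ_mean2_ext f g r E) by lra. apply H, Hr.
- rewrite (RInt_ext _ (fun r => bergman_weight alpha r * circ_mean2 f r)).
  + apply H, Hr.
  + intros x Hx. rewrite Rmin_left, Rmax_right in Hx by lra.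
    rewrite (circ_mean2_ext f g x E) by lra. reflexivity.
Qed.

Lemma norm2_le_weaken (alpha : R) (f : C -> C) (A B : R) :
  A <= B -> norm2_le alpha f A -> norm2_le alpha f B.
Proof.
intros HAB. unfold norm2_le. destruct (Req_EM_T alpha (-1)); intros H r Hr;
specialize (H r Hr); lra.
Qed.

Lemma norm2_le_scal (alpha : R) (c : C) (f : C -> C) (B : R) :
  analytic_on_D f -> norm2_le alpha f B ->
  norm2_le alpha (fun z => c * f z)%C (Cmod c ^ 2 * B).
Proof.
intros Hf. pose proof (pow2_ge_0 (Cmod c)) as Hc.
unfold norm2_le. destruct (Req_EM_T alpha (-1)); intros H r Hr.
- rewrite circ_mean2_scal by (auto; lra). apply Rmult_le_compat_l; auto.
- rewrite (RInt_ext _ (fun r => Cmod c ^ 2 * (bergman_weight alpha r * circ_mean2 f r))).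
  + rewrite (RInt_scal_R (fun r => bergman_weight alpha r * circ_mean2 f r))
      by (apply ex_RInt_bergman; auto; lra).
    apply Rmult_le_compat_l; auto.
  + intros x Hx. rewrite Rmin_left, Rmax_right in Hx by lra.
    rewrite circ_mean2_scal by (auto; lra). simpl. ring.
Qed.

Lemma norm2_le_lin (alpha : R) (a b : C) (f g : C -> C) (A B : R) :
  -1 <= alpha -> analytic_on_D f -> analytic_on_D g ->
  norm2_le alpha f A -> norm2_le alpha g B ->
  norm2_le alpha (fun z => a * f z + b * g z)%C (2 * Cmod a ^ 2 * A + 2 * Cmod b ^ 2 * B).
Proof.
intros Ha Hf Hg. pose proof (pow2_ge_0 (Cmod a)) as Pa. pose proof (pow2_ge_0 (Cmod b)) as Pb.
unfold norm2_le. destruct (Req_EM_T alpha (-1)); intros H1 H2 r Hr;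
specialize (H1 r Hr); specialize (H2 r Hr).
- apply Rle_trans with (1 := circ_mean2_lin a b f g r Hf Hg ltac:(lra)).
  apply Rplus_le_compat; apply Rmult_le_compat_l; lra.
- pose proof (ex_RInt_bergman alpha f 0 r Hf ltac:(lra) ltac:(lra)) as E1.
  pose proof (ex_RInt_bergman alpha g 0 r Hg ltac:(lra) ltac:(lra)) as E2.
  apply Rle_trans with (RInt (fun r => 2 * Cmod a ^ 2 * (bergman_weight alpha r * circ_mean2 f r)
    + 2 * Cmod b ^ 2 * (bergman_weight alpha r * circ_mean2 g r)) 0 r).
  + apply RInt_le; [lra|..].
    * apply ex_RInt_bergman; try lra. apply analytic_plus; apply analytic_scal; assumption.
    * apply ex_RInt_lin; assumption.
    * intros x Hx. pose proof (circ_mean2_lin a b f g x Hf Hg ltac:(lra)) as L.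
      pose proof (bergman_weight_ge_0 alpha x Ha ltac:(lra)) as W.
      apply (Rmult_le_compat_l _ _ _ W) in L. lra.
  + rewrite (RInt_lin (fun r => bergman_weight alpha r * circ_mean2 f r)
      (fun r => bergman_weight alpha r * circ_mean2 g r)) by assumption.
    apply Rplus_le_compat; apply Rmult_le_compat_l; lra.
Qed.

Lemma norm2_le_bounded (alpha : R) (f : C -> C) (M : R) :
  -1 <= alpha -> analytic_on_D f -> (forall z, inD z -> Cmod (f z) <= M) ->
  norm2_le alpha f (M ^ 2).
Proof.
intros Ha Hf HM. unfold norm2_le. destruct (Req_EM_T alpha (-1)); intros r Hr.
- apply circ_mean2_le_bound; auto; lra.
- assert (Ew : ex_RInt (bergman_weight alpha) 0 r).
  { apply (ex_RInt_continuous (V := R_CompleteNormedModule)).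
    intros x Hx. rewrite Rmin_left, Rmax_right in Hx by lra.
    apply continuous_bergman_weight. lra. }
  apply Rle_trans with (RInt (fun x => M ^ 2 * bergman_weight alpha x) 0 r).
  + apply RInt_le; [lra|apply ex_RInt_bergman; auto; lra|
      apply (ex_RInt_scal (V := R_NormedModule)), Ew|].
    intros x Hx. rewrite (Rmult_comm (M ^ 2)).
    apply Rmult_le_compat_l; [apply bergman_weight_ge_0; lra|].
    apply circ_mean2_le_bound; auto; lra.
  + rewrite (RInt_scal_R (bergman_weight alpha)) by exact Ew.
    rewrite RInt_bergman_weight by lra.
    assert (0 < Rpower (1 - r ^ 2) (alpha + 1)) by apply exp_pos.
    pose proof (pow2_ge_0 M). nra.
Qed.

(** Reduces both spaces to a mean over one circle. In the Bergman case the circle depends on [f]: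
    some circle of an annulus has a mean controlled by the average over that annulus. *)
Lemma norm2_le_circle (alpha rho : R) :
  -1 <= alpha -> 0 < rho < 1 -> exists K, 0 < K /\ forall f B,
    analytic_on_D f -> 0 < B -> norm2_le alpha f B ->
    exists r, rho <= r < 1 /\ circ_mean2 f r <= K ^ 2 * B.
Proof.
intros Ha Hrho. unfold norm2_le. destruct (Req_EM_T alpha (-1)) as [e|ne].
- exists 1. split; [lra|]. intros f B Hf HB H. exists rho. split; [lra|].
  specialize (H rho ltac:(lra)). lra.
- set (rho2 := (1 + rho) / 2). assert (H2 : rho < rho2 < 1) by (unfold rho2; lra).
  (* The weight vanishes at radius 0 and may degenerate at radius 1; on the annulus it has a
     positive minimum. *)
  destruct (continuity_ab_min (bergman_weight alpha) rho rho2 ltac:(lra)) as [m [Hm Hm2]].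
  { intros x Hx. apply continuity_pt_filterlim. apply continuous_bergman_weight. lra. }
  set (c := bergman_weight alpha m) in *.
  assert (Hc : 0 < c).
  { unfold c, bergman_weight. repeat apply Rmult_lt_0_compat; try lra. apply exp_pos. }
  (* If all means on the annulus were at least [q * B], its contribution alone would be at least
     [2 * B], exceeding the bound [B]. *)
  set (q := 2 / (c * (rho2 - rho))).
  assert (Hq : 0 < q) by (apply Rdiv_lt_0_compat; [lra|apply Rmult_lt_0_compat; lra]).
  exists (sqrt q). split; [apply sqrt_lt_R0, Hq|].
  rewrite pow2_sqrt by lra.
  intros f B Hf HB H. apply NNPP. intros Hno.
  assert (Hbig : forall r, rho <= r < 1 -> q * B <= circ_mean2 f r).
  { intros r Hr. apply Rnot_lt_le. intros L. apply Hno. exists r. split; [exact Hr|lra]. }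
  specialize (H rho2 ltac:(lra)).
  pose proof (ex_RInt_bergman alpha f 0 rho Hf ltac:(lra) ltac:(lra)) as E1.
  pose proof (ex_RInt_bergman alpha f rho rho2 Hf ltac:(lra) ltac:(lra)) as E2.
  rewrite <- (RInt_Chasles (V := R_CompleteNormedModule) _ 0 rho rho2 E1 E2) in H.
  assert (P1 : 0 <= RInt (fun r => bergman_weight alpha r * circ_mean2 f r) 0 rho).
  { apply RInt_ge_0; [lra|exact E1|]. intros x Hx.
    apply Rmult_le_pos; [apply bergman_weight_ge_0; lra|apply circ_mean2_ge_0; auto; lra]. }
  assert (P2 : (rho2 - rho) * (c * (q * B))
    <= RInt (fun r => bergman_weight alpha r * circ_mean2 f r) rho rho2).
  { replace ((rho2 - rho) * (c * (q * B))) with (RInt (fun _ => c * (q * B)) rho rho2)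
      by (rewrite (RInt_const (V := R_CompleteNormedModule)); reflexivity).
    apply RInt_le; [lra|apply ex_RInt_const|exact E2|].
    intros x Hx. apply Rmult_le_compat; try lra.
    - apply Rmult_le_pos; lra.
    - apply Hm. lra.
    - apply Hbig. lra. }
  replace ((rho2 - rho) * (c * (q * B))) with (2 * B) in P2 by (unfold q; field; lra).
  change (plus (RInt (fun r => bergman_weight alpha r * circ_mean2 f r) 0 rho)
    (RInt (fun r => bergman_weight alpha r * circ_mean2 f r) rho rho2))
    with (RInt (fun r => bergman_weight alpha r * circ_mean2 f r) 0 rho
     + RInt (fun r => bergman_weight alpha r * circ_mean2 f r) rho rho2) in H.
  lra.
Qed.

(** Evaluating a derivative is a bounded functional, so norm limits determine values and Taylor
    coefficients. The radius [r] found for [f] is at least [rho], which makes the constant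
    independent of [f]. *)
Lemma norm2_le_cderiv_n (alpha : R) (k : nat) (z : C) :
  -1 <= alpha -> inD z -> exists K, 0 < K /\ forall f eta,
    analytic_on_D f -> 0 < eta -> norm2_le alpha f (eta ^ 2) ->
    Cmod (cderiv_n k f z) <= K * eta.
Proof.
intros Ha Hz. unfold inD in Hz. pose proof (Cmod_ge_0 z) as Hz0.
set (rho := (1 + Cmod z) / 2).
assert (Hrho : Cmod z < rho < 1) by (unfold rho; lra).
destruct (norm2_le_circle alpha rho Ha ltac:(lra)) as [K [HK H]].
assert (Hi : 0 < / (rho - Cmod z)) by (apply Rinv_0_lt_compat; lra).
exists (INR (fact k) * (/ (rho - Cmod z)) ^ S k * K). split.
{ repeat apply Rmult_lt_0_compat; auto; [apply INR_fact_lt_0|apply pow_lt, Hi]. }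
intros f eta Hf He Hn.
destruct (H f (eta ^ 2) Hf ltac:(apply pow_lt, He) Hn) as [r [Hr Hc]].
rewrite <- Rpow_mult_distr in Hc.
assert (HKe : 0 < K * eta) by (apply Rmult_lt_0_compat; assumption).
apply Rle_trans with (1 := cderiv_n_mean_bound f (Cmod z) r (K * eta) k z Hf
  (Rle_refl _) ltac:(lra) ltac:(lra) HKe Hc).
rewrite <- !Rmult_assoc. rewrite !(Rmult_assoc _ K eta).
apply Rmult_le_compat_r; [lra|]. apply Rmult_le_compat_l; [apply pos_INR|].
apply pow_incr. split; [left; apply Rinv_0_lt_compat; lra|].
apply Rinv_le_contravar; lra.
Qed.

(** * The compact operator *)

Lemma analytic_lin (a b : C) (f g : C -> C) :
  analytic_on_D f -> analytic_on_D g -> analytic_on_D (fun z => a * f z + b * g z)%C.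
Proof. intros Hf Hg. apply analytic_plus; apply analytic_scal; assumption. Qed.

Lemma inH_lin (alpha : R) (a b : C) (f g : C -> C) :
  -1 <= alpha -> inH alpha f -> inH alpha g -> inH alpha (fun z => a * f z + b * g z)%C.
Proof.
rewrite !inH_iff. intros Ha [Hf [A HA]] [Hg [B HB]]. split; [apply analytic_lin; assumption|].
eexists. apply (norm2_le_lin alpha a b f g A B Ha Hf Hg HA HB).
Qed.

Lemma inH_ext (alpha : R) (f g : C -> C) :
  (forall z, inD z -> f z = g z) -> inH alpha f -> inH alpha g.
Proof.
rewrite !inH_iff. intros E [Hf [B HB]]. split; [apply (analytic_ext f g E Hf)|].
exists B. exact (norm2_le_ext alpha f g B E HB).
Qed.

Lemma inH_bounded (alpha : R) (f : C -> C) (M : R) :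
  -1 <= alpha -> analytic_on_D f -> (forall z, inD z -> Cmod (f z) <= M) -> inH alpha f.
Proof.
intros Ha Hf HM. apply inH_iff. split; [exact Hf|]. exists (M ^ 2).
apply norm2_le_bounded; assumption.
Qed.

Lemma inH_monomial (alpha : R) (c w : C) (m : nat) :
  -1 <= alpha -> inD w -> inH alpha (fun z => c * (z - w) ^ m)%C.
Proof.
intros Ha Hw. apply (inH_bounded alpha _ (Cmod c * 2 ^ m) Ha).
- apply analytic_scal, analytic_monomial.
- intros z Hz. rewrite Cmod_mult, Cmod_pow. unfold inD in *.
  apply Rmult_le_compat_l; [apply Cmod_ge_0|]. apply pow_incr. split; [apply Cmod_ge_0|].
  unfold Cminus. apply Rle_trans with (1 := Cmod_triangle _ _). rewrite Cmod_opp. lra.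
Qed.

Lemma inH_analytic (alpha : R) (f : C -> C) : inH alpha f -> analytic_on_D f.
Proof. intros [H _]. exact H. Qed.

Lemma cderiv_n_close (alpha : R) (k : nat) (z : C) (eps : R) :
  -1 <= alpha -> inD z -> 0 < eps -> exists e, 0 < e /\ forall f g,
    analytic_on_D f -> analytic_on_D g -> norm2_le alpha (fun y => f y - g y)%C e ->
    Cmod (cderiv_n k f z - cderiv_n k g z)%C <= eps.
Proof.
intros Ha Hz He. destruct (norm2_le_cderiv_n alpha k z Ha Hz) as [K [HK H]].
assert (Hd : 0 < eps / K) by (apply Rdiv_lt_0_compat; assumption).
exists ((eps / K) ^ 2). split; [apply pow_lt, Hd|].
intros f g Hf Hg Hn.
assert (E : forall y, (f y - g y = 1 * f y + (-1) * g y)%C) by (intros; ring).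
replace (cderiv_n k f z - cderiv_n k g z)%C
  with (cderiv_n k (fun y => 1 * f y + (-1) * g y)%C z)
  by (rewrite cderiv_n_lin by assumption; ring).
replace eps with (K * (eps / K)) by (field; lra).
apply H; [apply analytic_lin; assumption|exact Hd|].
apply (norm2_le_ext alpha (fun y => f y - g y)%C); [intros y _; apply E|exact Hn].
Qed.

Lemma Cmod_small_eq_0 (a : C) (K : R) : (forall eps, 0 < eps -> Cmod a <= K * eps) -> a = RtoC 0.
Proof.
intros H. apply Cmod_eq_0, Rle_antisym; [|apply Cmod_ge_0].
apply Rnot_lt_le. intros Hpos.
assert (HK : 0 < K) by (specialize (H 1 Rlt_0_1); lra).
specialize (H (Cmod a / (2 * K)) ltac:(apply Rdiv_lt_0_compat; lra)).
replace (K * (Cmod a / (2 * K))) with (Cmod a / 2) in H by (field; lra). lra.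
Qed.

Section CompactOperator.

Variables (alpha : R) (n : nat) (psi phi : C -> C) (w : C).
Hypothesis Ha : -1 <= alpha.
Hypothesis Hpsi : analytic_on_D psi.
Hypothesis Hphi : analytic_on_D phi.
Hypothesis Hself : forall z, inD z -> inD (phi z).
Hypothesis Hcompact : compact_on alpha (Dop psi phi n).
Hypothesis Hw : inD w.
Hypothesis Hfix : phi w = w.
Hypothesis Hzero : vanishes w n psi.

Let T := Dop psi phi n.
Let mu := diagonal psi phi n w.

Lemma Dop_inH (f : C -> C) : inH alpha f -> inH alpha (T f).
Proof. apply Hcompact. Qed.

(** Continuity of [T] at each point, from boundedness of the [n]-th derivative at [phi z]; it
    identifies the limit of the iteration. *)
Lemma Dop_close (z : C) (eps : R) : inD z -> 0 < eps -> exists e, 0 < e /\ forall f g,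
  analytic_on_D f -> analytic_on_D g -> norm2_le alpha (fun y => f y - g y)%C e ->
  Cmod (T f z - T g z)%C <= eps.
Proof.
intros Hz He. pose proof (Cmod_ge_0 (psi z)) as Hp.
destruct (cderiv_n_close alpha n (phi z) (eps / (Cmod (psi z) + 1)) Ha (Hself z Hz)) as [e [He' H]].
{ apply Rdiv_lt_0_compat; lra. }
exists e. split; [exact He'|]. intros f g Hf Hg Hn. specialize (H f g Hf Hg Hn).
unfold T, Dop.
replace (psi z * cderiv_n n f (phi z) - psi z * cderiv_n n g (phi z))%C
  with (psi z * (cderiv_n n f (phi z) - cderiv_n n g (phi z)))%C by ring.
rewrite Cmod_mult.
apply Rle_trans with ((Cmod (psi z) + 1) * (eps / (Cmod (psi z) + 1))).
- apply Rmult_le_compat; try apply Cmod_ge_0; [lra|exact H].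
- right. field. lra.
Qed.

Lemma compact_subsequence (u : nat -> C -> C) (M : R) :
  (forall k, inH alpha (u k)) -> (forall k, norm2_le alpha (u k) M) ->
  exists s g, (forall k, (k <= s k)%nat) /\ inH alpha g /\
    forall eps, 0 < eps -> exists K, forall k, (K <= k)%nat ->
      norm2_le alpha (fun z => T (u (s k)) z - g z)%C eps.
Proof.
intros Hu HM. destruct Hcompact as [_ H].
destruct (H u M Hu) as [s [g [Hs [Hg Hlim]]]].
{ intros k. apply Hnorm2_le_iff, HM. }
exists s, g. split; [|split; [exact Hg|]].
- induction k as [|k IH]; [lia|]. specialize (Hs k). lia.
- intros eps He. destruct (Hlim eps He) as [K HK]. exists K.
  intros k Hk. apply Hnorm2_le_iff, HK, Hk.
Qed.

(* A limit point of [T v_m], with [v_m] normalized and vanishing to order [m], vanishes to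
   infinite order at [w]; hence it is 0. *)
Lemma small_on_vanishing (del : R) : 0 < del -> exists m0, forall u B,
  inH alpha u -> vanishes w m0 u -> 0 < B -> norm2_le alpha u B -> norm2_le alpha (T u) (del * B).
Proof.
intros Hdel. apply NNPP. intros Hno.
assert (Hv : forall m, exists v, inH alpha v /\ vanishes w m v /\ norm2_le alpha v 1 /\
  ~ norm2_le alpha (T v) del).
{ intros m. apply NNPP. intros Hno2. apply Hno. exists m.
  intros u B Hu Hvu HB Hn. apply NNPP. intros Hbad. apply Hno2.
  pose proof (inH_analytic _ _ Hu) as Au.
  assert (Hs : 0 < sqrt B) by (apply sqrt_lt_R0, HB).
  assert (Hs2 : sqrt B ^ 2 = B) by (apply pow2_sqrt; lra).
  assert (Hsn : RtoC (sqrt B) <> RtoC 0) by (intros E; apply RtoC_inj in E; lra).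
  (* [B] bounds the squared norm, so dividing by [sqrt B] normalizes [u]. *)
  set (c := RtoC (/ sqrt B)).
  assert (Hc : Cmod c ^ 2 = / B).
  { unfold c. rewrite Cmod_R, Rabs_pos_eq by (left; apply Rinv_0_lt_compat, Hs).
    rewrite pow_inv, Hs2. reflexivity. }
  assert (N1 : norm2_le alpha (fun z => c * u z)%C 1).
  { replace 1 with (Cmod c ^ 2 * B) by (rewrite Hc; field; lra).
    apply norm2_le_scal; assumption. }
  assert (A1 : analytic_on_D (fun z => c * u z)%C) by (apply analytic_scal, Au).
  exists (fun z => c * u z)%C. repeat split.
  - exact A1.
  - apply inH_iff. split; [exact A1|]. exists 1. exact N1.
  (* The summand with coefficient 0 casts a scalar multiple as a linear combination. *)
  - destruct Hvu as [h Hh]. exists (fun z => c * h z + 0 * h z)%C.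
    apply (factors_ext w m (fun z => c * u z + 0 * u z)%C); [intros; ring|].
    apply factors_lin; assumption.
  - exact N1.
  - intros Hgood. apply Hbad.
    replace (del * B) with (Cmod (RtoC (sqrt B)) ^ 2 * del)
      by (rewrite Cmod_R, Rabs_pos_eq, Hs2 by lra; ring).
    apply (norm2_le_ext alpha (fun z => RtoC (sqrt B) * T (fun z => c * u z)%C z)%C).
    + intros z Hz.
      rewrite (Dop_ext psi phi n Hself (fun z => c * u z)%C (fun z => c * u z + 0 * u z)%C)
        by (auto; intros; ring).
      rewrite Dop_lin by auto. fold T. unfold c. rewrite RtoC_inv by lra. field. exact Hsn.
    + apply norm2_le_scal; [|exact Hgood]. apply analytic_Dop; assumption. }
set (v := fun m => proj1_sig (constructive_indefinite_description _ (Hv m))).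
assert (Hv' := fun m => proj2_sig (constructive_indefinite_description _ (Hv m))).
change (forall m, inH alpha (v m) /\ vanishes w m (v m) /\
  norm2_le alpha (v m) 1 /\ ~ norm2_le alpha (T (v m)) del) in Hv'.
clearbody v. clear Hv.
destruct (compact_subsequence v 1) as [s [g [Hs [Hg Hlim]]]]; [apply Hv'|apply Hv'|].
pose proof (inH_analytic _ _ Hg) as Ag.
assert (AT : forall k, analytic_on_D (T (v k))).
{ intros k. apply (inH_analytic alpha), Dop_inH, Hv'. }
assert (Hg0 : forall z, inD z -> g z = RtoC 0).
{ apply (identity_theorem g w Ag Hw). intros m. apply vanishes_cderiv_n; [exact Ag|exact Hw|].
  intros j _. apply (Cmod_small_eq_0 _ 1). intros eps He.
  destruct (cderiv_n_close alpha j w eps Ha Hw He) as [e [He' Hcl]].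
  destruct (Hlim e He') as [K HK].
  (* Then [s k >= S j], so the image of [v (s k)] has vanishing [j]-th derivative at [w]. *)
  set (k := Nat.max K (S j)). specialize (HK k ltac:(lia)).
  specialize (Hcl _ g (AT (s k)) Ag HK).
  assert (E : cderiv_n j (T (v (s k))) w = RtoC 0).
  { apply (proj1 (vanishes_cderiv_n w (S j) _ (AT (s k)) Hw)); [|lia].
    apply vanishes_Dop; auto. apply (vanishes_le w (s k)); [|apply Hv'].
    specialize (Hs k). lia. }
  rewrite E in Hcl. rewrite Rmult_1_l.
  replace (0 - cderiv_n j g w)%C with (- cderiv_n j g w)%C in Hcl by ring.
  rewrite Cmod_opp in Hcl. exact Hcl. }
destruct (Hlim del Hdel) as [K HK]. specialize (HK K (Nat.le_refl K)).
destruct (Hv' (s K)) as [_ [_ [_ Hbad]]]. apply Hbad.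
revert HK. apply norm2_le_ext. intros z Hz. rewrite Hg0 by exact Hz. ring.
Qed.

(* Where [T] is small, iterate [f |-> (T f - g) / lam]; compactness of [T] supplies the limit,
   so that completeness of the space is not needed. *)
Lemma solve_high_order (lam0 : R) : 0 < lam0 -> exists m0, forall m lam g,
  (m0 <= m)%nat -> lam0 <= Cmod lam -> inH alpha g -> vanishes w m g ->
  exists f, inH alpha f /\ vanishes w m f /\
    forall z, inD z -> (T f z - lam * f z = g z)%C.
Proof.
intros Hl0. set (c := / lam0 ^ 2).
assert (Hl2 : 0 < lam0 ^ 2) by (apply pow_lt, Hl0).
assert (Hc : 0 < c) by (apply Rinv_0_lt_compat, Hl2).
(* Together with [Cmod (/ lam) ^ 2 <= c] this makes f -> T f / lam contract squared norms by 1/8,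
   leaving room for the factor 2 of [norm2_le_lin]. *)
destruct (small_on_vanishing (lam0 ^ 2 / 8) ltac:(lra)) as [m0 Hsmall].
(* [m0] is fixed before [lam]: [diagonal_not_bounded_below] takes [lam = mu m], which varies with
   [m]. *)
exists m0. intros m lam g Hm Hlam Hg Hvg.
assert (Hlam0 : lam <> RtoC 0) by (apply Cmod_gt_0; lra).
assert (Hli : Cmod (/ lam)%C ^ 2 <= c).
{ rewrite Cmod_inv by exact Hlam0. rewrite pow_inv. unfold c.
  apply Rinv_le_contravar; [exact Hl2|]. apply pow_incr. lra. }
pose proof (pow2_ge_0 (Cmod (/ lam)%C)) as Hli0.
pose proof (inH_analytic _ _ Hg) as Ag.
assert (HA : exists A, 0 < A /\ norm2_le alpha g A).
{ apply inH_iff in Hg. destruct Hg as [_ [A HA]]. exists (Rmax A 1).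
  split; [apply Rlt_le_trans with (1 := Rlt_0_1), Rmax_r|].
  apply norm2_le_weaken with (2 := HA), Rmax_l. }
destruct HA as [A [HA0 HA]].
set (step := fun f z => (/ lam * T f z + - / lam * g z)%C).
set (it := fun k => Nat.iter k step (fun _ => RtoC 0)).
assert (Hcd : c * (lam0 ^ 2 / 8) = / 8) by (unfold c; field; lra).
(* A bound preserved by [step]: the new squared norm is at most 2 (B / 8) + 2 c A = B / 4 + B /
   2. *)
set (B := 4 * c * A).
assert (HB : 0 < B) by (unfold B; repeat apply Rmult_lt_0_compat; lra).
assert (HcA : c * A = B / 4) by (unfold B; field).
assert (P : forall k, inH alpha (it k) /\ vanishes w m (it k) /\ norm2_le alpha (it k) B).
{ induction k as [|k [IH1 [IH2 IH3]]].
  - assert (A0 : analytic_on_D (fun _ => RtoC 0)) by apply analytic_const.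
    assert (N0 : norm2_le alpha (fun _ => RtoC 0) (0 ^ 2)).
    { apply norm2_le_bounded; [exact Ha|exact A0|]. intros z _. rewrite Cmod_0. lra. }
    split; [apply inH_iff; split; [exact A0|now exists (0 ^ 2)]|]. split.
    + exists (fun _ => RtoC 0). split; [exact A0|]. intros z _. change (RtoC 0 = (z - w) ^ m * 0)%C. ring.
    + apply norm2_le_weaken with (2 := N0). simpl. lra.
  - change (it (S k)) with (step (it k)). unfold step.
    pose proof (Dop_inH _ IH1) as HT.
    split; [apply inH_lin; assumption|]. split.
    + destruct (vanishes_Dop psi phi n w Hphi Hself Hw Hfix m (it k) Hzero IH2) as [h Hh].
      destruct Hvg as [q Hq]. exists (fun z => / lam * h z + - / lam * q z)%C.
      apply factors_lin; assumption.
    + apply norm2_le_weaken with (2 * Cmod (/ lam)%C ^ 2 * (lam0 ^ 2 / 8 * B)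
         + 2 * Cmod (- / lam)%C ^ 2 * A).
      * rewrite Cmod_opp.
        assert (Cmod (/ lam)%C ^ 2 * (lam0 ^ 2 / 8 * B) <= c * (lam0 ^ 2 / 8 * B)).
        { apply Rmult_le_compat_r; [|exact Hli]. apply Rmult_le_pos; lra. }
        assert (Cmod (/ lam)%C ^ 2 * A <= c * A) by (apply Rmult_le_compat_r; lra).
        replace (c * (lam0 ^ 2 / 8 * B)) with (B / 8) in H
          by (rewrite <- Rmult_assoc, Hcd; field).
        lra.
      * apply norm2_le_lin; [exact Ha|apply (inH_analytic alpha), HT|exact Ag| |exact HA].
        apply Hsmall; auto. apply (vanishes_le w m); assumption. }
assert (Ait : forall k, analytic_on_D (it k)) by (intros k; apply (inH_analytic alpha), P).
assert (AT : forall f, analytic_on_D f -> analytic_on_D (T f))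
  by (intros f Hf; apply analytic_Dop; assumption).
(* In the difference of two successive iterates [g] cancels, so the contraction factor 1/8 applies
   without loss. *)
assert (Dsmall : forall k, norm2_le alpha (fun z => it (S k) z - it k z)%C (B * (/ 8) ^ k)).
{ induction k as [|k IH].
  - apply norm2_le_weaken with B; [simpl; lra|].
    apply (norm2_le_ext alpha (it 1%nat)); [|apply P]. intros z _. simpl (it 0%nat z). ring.
  - set (d := fun z => (1 * it (S k) z + (-1) * it k z)%C).
    assert (Ad : analytic_on_D d) by (apply analytic_lin; apply Ait).
    assert (Nd : norm2_le alpha d (B * (/ 8) ^ k)).
    { revert IH. apply norm2_le_ext. intros z _. unfold d. ring. }
    assert (Hk : 0 < B * (/ 8) ^ k) by (apply Rmult_lt_0_compat; [exact HB|apply pow_lt; lra]).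
    apply (norm2_le_ext alpha (fun z => / lam * T d z)%C).
    + intros z Hz. unfold d. unfold T. rewrite Dop_lin by auto. fold T.
      change (it (S (S k)) z) with (/ lam * T (it (S k)) z + - / lam * g z)%C.
      change (it (S k) z) with (/ lam * T (it k) z + - / lam * g z)%C. ring.
    + apply norm2_le_weaken with (Cmod (/ lam)%C ^ 2 * (lam0 ^ 2 / 8 * (B * (/ 8) ^ k))).
      * apply Rle_trans with (c * (lam0 ^ 2 / 8 * (B * (/ 8) ^ k))).
        { apply Rmult_le_compat_r; [|exact Hli]. apply Rmult_le_pos; lra. }
        rewrite <- (Rmult_assoc c), Hcd. simpl. lra.
      * apply norm2_le_scal; [apply AT, Ad|]. apply Hsmall; auto.
        -- apply inH_lin; [exact Ha|apply P|apply P].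
        -- destruct (proj1 (proj2 (P (S k)))) as [h1 Hh1].
           destruct (proj1 (proj2 (P k))) as [h2 Hh2].
           apply (vanishes_le w m); [exact Hm|].
           exists (fun z => 1 * h1 z + (-1) * h2 z)%C. apply factors_lin; assumption. }
destruct (compact_subsequence it B) as [s [h [Hs [Hh Hlim]]]]; [apply P|apply P|].
pose proof (inH_analytic _ _ Hh) as Ah.
(* [h] is the limit of the images [T (it (s k))]; applying the rest of [step] gives the limit [f] of
   the next iterates [it (S (s k))]. *)
set (f := fun z => (/ lam * h z + - / lam * g z)%C).
assert (Hf : inH alpha f) by (apply inH_lin; assumption).
pose proof (inH_analytic _ _ Hf) as Af.
assert (Hconv : forall e, 0 < e -> exists K, forall k, (K <= k)%nat ->
  norm2_le alpha (fun z => it (S (s k)) z - f z)%C e).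
{ intros e He. destruct (Hlim (e / c)) as [K HK]; [apply Rdiv_lt_0_compat; assumption|].
  exists K. intros k Hk. specialize (HK k Hk).
  apply (norm2_le_ext alpha (fun z => / lam * (T (it (s k)) z - h z))%C).
  - intros z _. change (it (S (s k)) z) with (/ lam * T (it (s k)) z + - / lam * g z)%C.
    unfold f. ring.
  - apply norm2_le_weaken with (Cmod (/ lam)%C ^ 2 * (e / c)).
    + apply Rle_trans with (c * (e / c)); [|right; field; lra].
      apply Rmult_le_compat_r; [left; apply Rdiv_lt_0_compat; assumption|exact Hli].
    + apply norm2_le_scal; [|exact HK]. apply analytic_minus; [apply AT, Ait|exact Ah]. }
(* [T (it (S (s k)))] tends to [T f] and [T (it (s k))] to [h]; [Dsmall] closes the gap between the
   shifted indices. The constant 3 counts these three errors. *)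
assert (ETf : forall z, inD z -> T f z = h z).
{ intros z Hz. apply Cminus_eq_0, (Cmod_small_eq_0 _ 3). intros eps He.
  destruct (Dop_close z eps Hz He) as [e1 [He1 C1]].
  destruct (cderiv_n_close alpha 0 z eps Ha Hz He) as [e2 [He2 C2]].
  destruct (Hconv e1 He1) as [K1 HK1]. destruct (Hlim e2 He2) as [K2 HK2].
  destruct (pow_lt_1_zero (/ 8) ltac:(rewrite Rabs_pos_eq; lra) (e1 / B)) as [K3 HK3].
  { apply Rdiv_lt_0_compat; assumption. }
  set (k := Nat.max K1 (Nat.max K2 K3)).
  specialize (HK1 k ltac:(lia)). specialize (HK2 k ltac:(lia)).
  specialize (HK3 (s k) ltac:(specialize (Hs k); lia)).
  rewrite Rabs_pos_eq in HK3 by (apply pow_le; lra).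
  assert (D3 : norm2_le alpha (fun z => it (S (s k)) z - it (s k) z)%C e1).
  { apply norm2_le_weaken with (2 := Dsmall (s k)).
    apply (Rmult_lt_compat_l B) in HK3; [|exact HB].
    replace (B * (e1 / B)) with e1 in HK3 by (field; lra). lra. }
  pose proof (C1 _ _ (Ait (S (s k))) Af HK1) as B1.
  pose proof (C1 _ _ (Ait (S (s k))) (Ait (s k)) D3) as B2.
  pose proof (C2 _ _ (AT _ (Ait (s k))) Ah HK2) as B3. simpl in B3.
  replace (T f z - h z)%C with (- (T (it (S (s k))) z - T f z)
    + ((T (it (S (s k))) z - T (it (s k)) z) + (T (it (s k)) z - h z)))%C by ring.
  pose proof (Cmod_triangle (- (T (it (S (s k))) z - T f z))%C
    ((T (it (S (s k))) z - T (it (s k)) z) + (T (it (s k)) z - h z))%C) as T1.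
  pose proof (Cmod_triangle (T (it (S (s k))) z - T (it (s k)) z)%C (T (it (s k)) z - h z)%C) as T2.
  rewrite Cmod_opp in T1. lra. }
exists f. split; [exact Hf|]. split.
(* Factorizations do not pass to the limit directly, but vanishing derivatives at [w] do. *)
- apply vanishes_cderiv_n; [exact Af|exact Hw|]. intros j Hj.
  apply (Cmod_small_eq_0 _ 1). intros eps He.
  destruct (cderiv_n_close alpha j w eps Ha Hw He) as [e [He' Hcl]].
  destruct (Hconv e He') as [K HK]. specialize (HK K (Nat.le_refl K)).
  specialize (Hcl _ f (Ait _) Af HK).
  rewrite (proj1 (vanishes_cderiv_n w m _ (Ait (S (s K))) Hw) (proj1 (proj2 (P _))) j Hj) in Hcl.
  replace (0 - cderiv_n j f w)%C with (- cderiv_n j f w)%C in Hcl by ring.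
  rewrite Cmod_opp in Hcl. lra.
- intros z Hz. rewrite ETf by exact Hz. unfold f. field. exact Hlam0.
Qed.

Lemma Dop_minus_surjective (lam : C) : lam <> RtoC 0 -> (forall m, mu m <> lam) ->
  forall g, inH alpha g -> exists f, inH alpha f /\
    forall z, inD z -> (T f z - lam * f z = g z)%C.
Proof.
intros Hlam Hmu.
destruct (solve_high_order (Cmod lam) (proj1 (Cmod_gt_0 lam) Hlam)) as [m0 Hsolve].
(* Induction on the distance [k] from [j] to [m0]: each step raises the order of vanishing of the
   right-hand side by one, until [Hsolve] applies. *)
assert (P : forall k j, (j + k = m0)%nat -> forall g, inH alpha g -> vanishes w j g ->
  exists f, inH alpha f /\ forall z, inD z -> (T f z - lam * f z = g z)%C).
{ induction k as [|k IH]; intros j Hj g Hg Hv.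
  - destruct (Hsolve j lam g ltac:(lia) (Rle_refl _) Hg Hv) as [f [Hf [_ Ef]]].
    exists f. split; assumption.
  - destruct Hv as [q Hq].
    assert (Hd : (mu j - lam)%C <> RtoC 0) by (intros E; apply (Hmu j), Cminus_eq_0, E).
    (* With this coefficient the image of [p] under T - lam has the same coefficient of order [j] as
       [g], so that [g'] vanishes to order [S j]. *)
    set (c := (q w / (mu j - lam))%C).
    set (p := fun z => (c * (z - w) ^ j)%C).
    assert (Hp : inH alpha p) by (apply inH_monomial; assumption).
    pose proof (inH_analytic _ _ Hp) as Ap.
    assert (Fp : factors w j p (fun _ => c)).
    { split; [apply analytic_const|]. intros z _. unfold p. ring. }
    destruct (factors_Dop_minus psi phi n w Hphi Hself Hw Hfix j lam p _ Hzero Fp)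
      as [k' [Hk' Ek']]. fold T in Hk'. fold mu in Ek'.
    set (g' := fun z => (1 * g z + (-1) * (T p z - lam * p z))%C).
    destruct (IH (S j) ltac:(lia) g') as [f [Hf Ef]].
    + apply inH_lin; [exact Ha|exact Hg|].
      apply (inH_ext alpha (fun z => 1 * T p z + - lam * p z)%C); [intros; ring|].
      apply inH_lin; [exact Ha|apply Dop_inH, Hp|exact Hp].
    + apply (factors_leading_zero w j g' (fun z => 1 * q z + (-1) * k' z)%C Hw).
      * apply factors_lin; assumption.
      * rewrite Ek'. unfold c. field. exact Hd.
    + pose proof (inH_analytic _ _ Hf) as Af.
      exists (fun z => 1 * f z + 1 * p z)%C. split; [apply inH_lin; assumption|].
      intros z Hz. unfold T. rewrite Dop_lin by auto. fold T.
      transitivity ((T f z - lam * f z) + (T p z - lam * p z))%C; [ring|].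
      rewrite Ef by exact Hz. unfold g'. ring. }
intros g Hg. apply (P m0 0%nat eq_refl g Hg).
exists g. split; [apply (inH_analytic alpha), Hg|]. intros z _. simpl. ring.
Qed.

Lemma Dop_minus_injective (lam : C) : (forall m, mu m <> lam) ->
  forall f g, inH alpha f -> inH alpha g ->
  (forall z, inD z -> T f z - lam * f z = T g z - lam * g z)%C ->
  forall z, inD z -> f z = g z.
Proof.
intros Hmu f g Hf Hg E.
apply inH_analytic in Hf. apply inH_analytic in Hg.
set (u := fun z => (1 * f z + (-1) * g z)%C).
assert (Au : analytic_on_D u) by (apply analytic_lin; assumption).
assert (H0 : forall z, inD z -> u z = RtoC 0).
{ apply (identity_theorem u w Au Hw). intros M.
  apply (Dop_minus_vanishes psi phi n w Hphi Hself Hw Hfix lam M u Hzero Au); [intros; apply Hmu|].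
  exists (fun _ => RtoC 0). split; [apply analytic_const|]. intros z Hz.
  unfold u. rewrite Dop_lin by auto. fold T.
  transitivity ((T f z - lam * f z) - (T g z - lam * g z))%C; [ring|].
  rewrite E by exact Hz. ring. }
intros z Hz. apply Cminus_eq_0. rewrite <- (H0 z Hz). unfold u. ring.
Qed.

(** Whether 0 belongs to the spectrum is left open; it cannot raise the supremum of the moduli. *)
Lemma spectrum_subset (lam : C) :
  spectrum alpha T lam -> lam = RtoC 0 \/ exists m, mu m = lam.
Proof.
intros Hs. apply NNPP. intros Hno. apply Hs.
assert (H0 : lam <> RtoC 0) by (intros E; apply Hno; now left).
assert (Hm : forall m, mu m <> lam) by (intros m E; apply Hno; right; now exists m).
split; [apply Dop_minus_injective, Hm|apply Dop_minus_surjective; assumption].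
Qed.

(** Diagonal entries may coincide; at the least index, elimination below it meets only nonzero
    pivots. *)
Lemma least_index (lam : C) (m : nat) :
  mu m = lam -> exists M, mu M = lam /\ forall j, (j < M)%nat -> mu j <> lam.
Proof.
induction m as [m IH] using (well_founded_induction Wf_nat.lt_wf). intros Em.
destruct (classic (exists j, (j < m)%nat /\ mu j = lam)) as [[j [Hj Ej]]|Hno].
- exact (IH j Hj Ej).
- exists m. split; [exact Em|]. intros j Hj Ej. apply Hno. now exists j.
Qed.

(** A preimage of [(z - w) ^ M] would vanish to order [M] by minimality of [M], and then the
    coefficient of order [M] of its image would be 0. *)
Lemma diagonal_in_spectrum (m : nat) : spectrum alpha T (mu m).
Proof.
destruct (least_index (mu m) m eq_refl) as [M [EM Hmin]].
intros [_ Hsurj].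
destruct (Hsurj (fun z => 1 * (z - w) ^ M)%C) as [f [Hf Ef]]; [apply inH_monomial; assumption|].
assert (Ef' : forall z, inD z -> (T f z - mu m * f z = (z - w) ^ M)%C)
  by (intros z Hz; rewrite Ef by exact Hz; ring).
apply (Dop_minus_unsolvable psi phi n w Hphi Hself Hw Hfix (mu m) M f Hzero EM); [|exact Ef'].
apply (Dop_minus_vanishes psi phi n w Hphi Hself Hw Hfix (mu m) M f Hzero
  (inH_analytic _ _ Hf) Hmin).
exists (fun _ => RtoC 1). split; [apply analytic_const|].
intros z Hz. fold T. rewrite Ef' by exact Hz. ring.
Qed.

(** Otherwise, for large [m], [solve_high_order] with [lam = mu m] would produce a preimage of
    [(z - w) ^ m] vanishing to order [m], which [Dop_minus_unsolvable] excludes. *)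
Lemma diagonal_not_bounded_below (c : R) (m1 : nat) :
  0 < c -> ~ (forall m, (m1 <= m)%nat -> c <= Cmod (mu m)).
Proof.
intros Hc Hb. destruct (solve_high_order c Hc) as [m0 Hsolve].
set (m := Nat.max m0 m1).
destruct (Hsolve m (mu m) (fun z => 1 * (z - w) ^ m)%C) as [f [_ [Hv Ef]]].
- lia.
- apply Hb. lia.
- apply inH_monomial; assumption.
- exists (fun _ => RtoC 1). split; [apply analytic_const|]. intros z _. ring.
- apply (Dop_minus_unsolvable psi phi n w Hphi Hself Hw Hfix (mu m) m f Hzero eq_refl Hv).
  intros z Hz. rewrite Ef by exact Hz. ring.
Qed.

End CompactOperator.

(** * The largest of the weights C(m, n) a^(m - n) *)

Lemma binomial_step (m n : nat) : (n <= m)%nat ->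
  Binomial.C (S m) n * (INR (S m) - INR n) = INR (S m) * Binomial.C m n.
Proof.
intros H. unfold Binomial.C. rewrite <- minus_INR by lia.
replace (S m - n)%nat with (S (m - n)) by lia.
rewrite (fact_simpl m), (fact_simpl (m - n)), !mult_INR.
field. repeat split; try apply INR_fact_neq_0; apply not_0_INR; lia.
Qed.

Lemma binomial_ge_1 (m n : nat) : (n <= m)%nat -> 1 <= Binomial.C m n.
Proof.
induction 1 as [|m Hm IH].
- unfold Binomial.C. rewrite Nat.sub_diag. simpl (fact 0).
  rewrite Rmult_1_r. right. field. apply INR_fact_neq_0.
- pose proof (binomial_step m n Hm) as E.
  assert (Hn : INR n <= INR m) by (apply le_INR, Hm). pose proof (pos_INR n).
  rewrite S_INR in E. nra.
Qed.

Section Maximum.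

Variables (n : nat) (a : R).
Hypothesis Hn : (0 < n)%nat.
Hypothesis Ha : 0 <= a < 1.

Let N := floor_nat (INR n / (1 - a)).
Let b (m : nat) := Binomial.C m n * a ^ (m - n).

(** The integer part is nonnegative here, so the truncation [Z.to_nat] in [floor_nat] loses
    nothing. *)
Lemma floor_index_spec : INR N <= INR n / (1 - a) < INR N + 1.
Proof.
set (x := INR n / (1 - a)). destruct (base_Int_part x) as [H1 H2].
assert (Hx : 0 <= x).
{ apply Rdiv_le_0_compat; [apply pos_INR|lra]. }
assert (Hz : (0 <= Int_part x)%Z).
{ assert (K : (-1 < Int_part x)%Z) by (apply lt_IZR; simpl; lra). lia. }
assert (E : INR N = IZR (Int_part x)).
{ unfold N, floor_nat. fold x. rewrite INR_IZR_INZ, Z2Nat.id by exact Hz. reflexivity. }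
rewrite E. lra.
Qed.

Lemma floor_index_ge : (n <= N)%nat.
Proof.
pose proof floor_index_spec as [_ H]. pose proof (pos_INR n).
assert (INR n <= INR n / (1 - a)).
{ apply Rle_div_r; [lra|]. nra. }
rewrite <- S_INR in H. assert (K : (n < S N)%nat) by (apply INR_lt; lra). lia.
Qed.

(** The origin of [N]: the ratio of consecutive weights is (m + 1) a / (m + 1 - n), which is at
    least 1 exactly when m + 1 <= n / (1 - a). *)
Lemma weight_step (m : nat) : (n <= m)%nat ->
  b (S m) * (INR (S m) - INR n) = INR (S m) * a * b m.
Proof.
intros H. unfold b. replace (S m - n)%nat with (S (m - n)) by lia.
transitivity (Binomial.C (S m) n * (INR (S m) - INR n) * a ^ S (m - n)); [ring|].
rewrite binomial_step by exact H. simpl. ring.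
Qed.

Lemma weight_ge_0 (m : nat) : (n <= m)%nat -> 0 <= b m.
Proof.
intros H. apply Rmult_le_pos; [pose proof (binomial_ge_1 m n H); lra|apply pow_le; lra].
Qed.

Lemma weight_incr (m : nat) : (n <= m)%nat -> (S m <= N)%nat -> b m <= b (S m).
Proof.
intros H1 H2. pose proof (weight_step m H1) as E. pose proof (weight_ge_0 m H1).
pose proof floor_index_spec as [F _].
assert (K : INR (S m) <= INR N) by (apply le_INR, H2).
assert (L : INR (S m) * (1 - a) <= INR n) by (apply Rle_div_r; lra).
assert (P : INR n < INR (S m)) by (apply lt_INR; lia).
apply Rmult_le_reg_r with (INR (S m) - INR n); [lra|]. rewrite E. nra.
Qed.

Lemma weight_decr (m : nat) : (N <= m)%nat -> b (S m) <= b m.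
Proof.
intros H. pose proof floor_index_ge as G. assert (H1 : (n <= m)%nat) by lia.
pose proof (weight_step m H1) as E. pose proof (weight_ge_0 m H1).
pose proof floor_index_spec as [_ F].
assert (K : INR N <= INR m) by (apply le_INR, H). rewrite S_INR in *.
assert (L : INR n <= (INR m + 1) * (1 - a)) by (apply Rle_div_l; lra).
assert (P : INR n <= INR m) by (apply le_INR, H1).
apply Rmult_le_reg_r with (INR m + 1 - INR n); [lra|]. rewrite E. nra.
Qed.

Lemma weight_max (m : nat) : (n <= m)%nat -> b m <= b N.
Proof.
intros H. destruct (Nat.le_ge_cases m N) as [L|L].
- assert (P : forall k, (n <= N - k)%nat -> b (N - k) <= b N).
  { induction k as [|k IH]; intros Hk; [rewrite Nat.sub_0_r; lra|].
    (* Truncated subtraction: the two indices coincide once [k] reaches [N]. *)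
    destruct (Nat.eq_dec (N - S k) (N - k)) as [e|ne]; [rewrite e; apply IH; lia|].
    apply Rle_trans with (b (N - k)); [|apply IH; lia].
    replace (N - k)%nat with (S (N - S k)) by lia. apply weight_incr; lia. }
  replace m with (N - (N - m))%nat by lia. apply P. lia.
- induction L as [|m L IH]; [lra|].
  apply Rle_trans with (b m); [apply weight_decr, L|apply IH].
  pose proof floor_index_ge. lia.
Qed.

End Maximum.

Theorem theorem2p5 (alpha : R) (n : nat) (psi phi : C -> C) (w : C) :
  -1 <= alpha ->
  (0 < n)%nat ->
  analytic_on_D psi ->
  analytic_on_D phi ->
  (forall z, inD z -> inD (phi z)) ->
  compact_on alpha (Dop psi phi n) ->
  inD w ->
  phi w = w ->
  (forall j, (j < n)%nat -> cderiv_n j psi w = 0%C) ->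
  cderiv_n n psi w <> 0%C ->
  let N := floor_nat (INR n / (1 - Cmod (cderiv phi w))) in
  spec_radius alpha (Dop psi phi n) =
    Finite (Binomial.C N n * Cmod (cderiv_n n psi w) * Cmod (cderiv phi w) ^ (N - n)).
Proof.
intros Ha Hn Hpsi Hphi Hself Hcompact Hw Hfix Hjet Hnz N.
assert (Hzero : vanishes w n psi) by (apply vanishes_cderiv_n; assumption).
set (a := Cmod (cderiv phi w)) in *.
set (L := Cmod (cderiv_n n psi w)).
assert (HL : 0 < L) by (apply Cmod_gt_0, Hnz).
assert (Ha0 : 0 <= a) by apply Cmod_ge_0.
set (mu := diagonal psi phi n w).
assert (Emu : forall m, (n <= m)%nat -> Cmod (mu m) = Binomial.C m n * L * a ^ (m - n)).
{ intros m Hm. unfold mu, diagonal. destruct (le_dec n m) as [_|H]; [|lia].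
  rewrite !Cmod_mult, Cmod_pow, Cmod_R, Rabs_pos_eq; [reflexivity|].
  pose proof (binomial_ge_1 m n Hm). lra. }
(* If [a >= 1], then every [Cmod (mu m)] with [m >= n] is at least [L], since the binomial and the
   power of [a] are at least 1. *)
assert (Ha1 : a < 1).
{ apply Rnot_le_lt. intros H1.
  apply (diagonal_not_bounded_below alpha n psi phi w Ha Hpsi Hphi Hself Hcompact Hw Hfix Hzero L n HL).
  intros m Hm. fold mu. rewrite Emu by exact Hm.
  pose proof (binomial_ge_1 m n Hm). pose proof (pow_R1_Rle a (m - n) H1).
  assert (L <= Binomial.C m n * L) by nra. nra. }
assert (HN : (n <= N)%nat) by (apply floor_index_ge; lra || assumption).
apply is_lub_Rbar_unique. split.
- intros x [lam [Hs ->]]. simpl.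
  destruct (spectrum_subset alpha n psi phi w Ha Hpsi Hphi Hself Hcompact Hw Hfix Hzero lam Hs)
    as [->|[m <-]].
  (* Reading the right-hand side as [Cmod (mu N)] shows that it is nonnegative. *)
  + rewrite Cmod_0, <- Emu by exact HN. apply Cmod_ge_0.
  + fold mu. destruct (le_dec n m) as [Hm|Hm].
    * rewrite Emu by exact Hm.
      assert (W : Binomial.C m n * a ^ (m - n) <= Binomial.C N n * a ^ (N - n))
        by (apply (weight_max n a); lra || assumption).
      apply (Rmult_le_compat_l L) in W; [|lra]. lra.
    * unfold mu at 1, diagonal. destruct (le_dec n m) as [H|_]; [lia|].
      rewrite Cmod_0, <- Emu by exact HN. apply Cmod_ge_0.
(* The supremum is attained at the eigenvalue [mu N]. *)
- intros u Hu. rewrite <- Emu by exact HN. apply Hu. exists (mu N). split; [|reflexivity].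
  apply (diagonal_in_spectrum alpha n psi phi w Ha Hphi Hself Hw Hfix Hzero).
Qed.
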